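(* Let $R>0$ and $B_R=\frac{\sqrt2}{2}+12R\,\pi^{3/2}\exp(2\pi^{3/2}R)$. Then for any complex-valued potentials $q,\tilde q\in L_2(0,\pi)$ with $$\|q\|_{L_2(0,\pi)}\le R,\qquad \|\tilde q\|_{L_2(0,\pi)}\le R,$$ and for every $x\in(0,\pi]$, the transmutation operator kernels $P,K$ (for $q$) and $\tilde P,\tilde K$ (for $\tilde q$) satisfy $$\|K'(x,\cdot)-\tilde K'(x,\cdot)\|_{L_2(0,x)}\le B_R\|q-\tilde q\|_{L_2(0,\pi)},\qquad \|\dot K(x,\cdot)-\dot{\tilde K}(x,\cdot)\|_{L_2(0,x)}\le B_R\|q-\tilde q\|_{L_2(0,\pi)},$$ $$\|P'(x,\cdot)-\tilde P'(x,\cdot)\|_{L_2(0,x)}\le B_R\|q-\tilde q\|_{L_2(0,\pi)},\qquad \|\dot P(x,\cdot)-\dot{\tilde P}(x,\cdot)\|_{L_2(0,x)}\le B_R\|q-\tilde q\|_{L_2(0,\pi)}.$$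
   Context: For complex-valued $q\in L_2(0,\pi)$ let $S(x,\lambda)$, $C(x,\lambda)$ be the solutions of $-y''+q(x)y=\lambda y$, $x\in(0,\pi)$, with $S(0,\lambda)=C'(0,\lambda)=0$, $S'(0,\lambda)=C(0,\lambda)=1$. With $\lambda=\rho^2$, the transmutation operator kernels $P(x,t)$ and $K(x,t)$, defined for $0\le t\le x\le\pi$, are the functions such that for each $x\in[0,\pi]$ $$S(x,\lambda)=\frac{\sin\rho x}{\rho}+\int_0^xP(x,t)\frac{\sin\rho t}{\rho}\,dt,\qquad C(x,\lambda)=\cos\rho x+\int_0^xK(x,t)\cos\rho t\,dt .$$ It is known that $P,K$ are absolutely continuous on $\mathcal D=\{(x,t):0\le t\le x\le\pi\}$, with partial derivatives in $L_2(\mathcal D)$, whose restrictions to each fixed $x\in(0,\pi]$ are in $L_2(0,x)$ as functions of $t$. A prime denotes the partial derivative with respect to the first argument $x$, a dot denotes the partial derivative with respect to the second argument $t$. $\tilde P,\tilde K$ are the kernels for $\tilde q$. The kernels can be obtained by successive approximations: with $Q(x)=\int_0^xq(t)\,dt$, one has $K=\sum_{n\ge1}K_n$, $P=\sum_{n\ge1}P_n$ (uniformly convergent on $\mathcal D$), where $K_1(x,t)=\frac12Q(\frac{x+t}2)+\frac12Q(\frac{x-t}2)$, $P_1(x,t)=\frac12Q(\frac{x+t}2)-\frac12Q(\frac{x-t}2)$, and for $n\ge1$ $$K_{n+1}(x,t)=\frac12\int_t^x\Big(\int_{\xi-t}^\xi q(\tau)K_n(\tau,t+\tau-\xi)d\tau+\int_{\frac{\xi+t}2}^\xi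 q(\tau)K_n(\tau,t-\tau+\xi)d\tau+\int_{\frac{\xi-t}2}^{\xi-t}q(\tau)K_n(\tau,-t-\tau+\xi)d\tau\Big)d\xi,$$ and $P_{n+1}$ is given by the same formula with $P_n$ in place of $K_n$ and with the sign of the third inner integral changed to minus. *)

(* Defs.v *)
From HB Require Import structures.
From mathcomp Require Import all_boot all_order all_algebra.
From mathcomp Require Import all_classical all_reals all_analysis.
From mathcomp Require Import complex.

Set Implicit Arguments.
Unset Strict Implicit.
Unset Printing Implicit Defensive.

Import Order.TTheory GRing.Theory Num.Theory.
Import numFieldNormedType.Exports.

Local Open Scope classical_set_scope.
Local Open Scope ring_scope.
Local Open Scope complex_scope.

Section complex_valued_functions.
Variable R : realType.
Implicit Types (A : set R) (f : R -> R[i]) (z : R[i]).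

Definition cabs z : R := Normc.normc z.

Definition cexp z : R[i] :=
  (expR (complex.Re z))%:C * (cos (complex.Im z) +i* sin (complex.Im z)).

Definition ccos z : R[i] := (cexp ('i%C * z) + cexp (- ('i%C * z))) / 2.

Definition csin z : R[i] := (cexp ('i%C * z) - cexp (- ('i%C * z))) / (2 * 'i%C).

(* sin(rho t) / rho is an entire function of rho, with value t at rho = 0. *)
Definition csin_div (rho : R[i]) (t : R) : R[i] :=
  if rho == 0 then t%:C else csin (rho * t%:C) / rho.

Definition cintegral (a b : R) f : R[i] :=
  (\int[lebesgue_measure]_(t in `]a, b[) complex.Re (f t)) +i*
  (\int[lebesgue_measure]_(t in `]a, b[) complex.Im (f t)).

Definition L2norm (a b : R) f : \bar R :=
  'N[lebesgue_measure]_(2%:E) [EFin \o ((cabs \o f) \_ `]a, b[)].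

Definition in_L2 (a b : R) f : Prop :=
  [/\ measurable_fun `]a, b[ (fun t => complex.Re (f t)),
      measurable_fun `]a, b[ (fun t => complex.Im (f t)) &
      (L2norm a b f < +oo)%E].

(* Derivatives are relative to A, so that they are one-sided at an endpoint
   of A; at interior points of A they are the usual derivatives. *)
Definition diff_quot (g : R -> R) (x y : R) : R := (g y - g x) / (y - x).

Definition derivable_in A f (x : R) : Prop :=
  cvg (diff_quot (fun t => complex.Re (f t)) x y @[y --> within A x^']) /\
  cvg (diff_quot (fun t => complex.Im (f t)) x y @[y --> within A x^']).

Definition derive_in A f (x : R) : R[i] :=
  lim (diff_quot (fun t => complex.Re (f t)) x y @[y --> within A x^']) +i*
  lim (diff_quot (fun t => complex.Im (f t)) x y @[y --> within A x^']).

Definition abs_continuous (a b : R) f : Prop :=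
  forall e : R, 0 < e -> exists2 d : R, 0 < d &
  forall (n : nat) (u v : 'I_n -> R),
    (forall i, a <= u i /\ u i <= v i /\ v i <= b) ->
    trivIset [set: 'I_n] (fun i => `]u i, v i[%classic) ->
    \sum_(i < n) (v i - u i) < d ->
    \sum_(i < n) cabs (f (v i) - f (u i)) < e.

End complex_valued_functions.

Section transmutation_kernels.
Variable R : realType.
Implicit Types (q y : R -> R[i]) (K P : R -> R -> R[i]).

(* y solves -y'' + q y = lambda y on (0, pi), y(0) = y0, y'(0) = y1, in the
   usual sense for integrable q: y is differentiable on [0, pi], y' is
   absolutely continuous there, and the equation holds almost everywhere. *)
Definition ivp_solution q (lambda y0 y1 : R[i]) y : Prop :=
  let I : set R := `[0, pi]%classic in
  let y' := derive_in I y in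
  [/\ forall x : R, I x -> derivable_in I y x,
      abs_continuous 0 pi y',
      {ae lebesgue_measure, forall x : R, 0 < x < pi ->
        derivable_in I y' x /\
        - derive_in I y' x + q x * y x = lambda * y x},
      y 0 = y0 &
      y' 0 = y1].

Definition continuous_on_triangle K : Prop :=
  let D := [set xt : R * R | 0 <= xt.2 <= xt.1 /\ xt.1 <= pi] in
  {within D, continuous (fun xt : R * R => complex.Re (K xt.1 xt.2))} /\
  {within D, continuous (fun xt : R * R => complex.Im (K xt.1 xt.2))}.

(* The integral representations determine K(x, .) and P(x, .) only almost
   everywhere; continuity on the triangle selects the kernel. *)
Definition cosine_kernel q K : Prop :=
  continuous_on_triangle K /\
  exists2 C : R -> R[i] -> R[i],
    forall lambda, ivp_solution q lambda 1 0 (C^~ lambda) &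
    forall (rho : R[i]) (x : R), 0 <= x <= pi ->
      C x (rho ^+ 2) = ccos (rho * x%:C) +
        cintegral 0 x (fun t => K x t * ccos (rho * t%:C)).

Definition sine_kernel q P : Prop :=
  continuous_on_triangle P /\
  exists2 S : R -> R[i] -> R[i],
    forall lambda, ivp_solution q lambda 0 1 (S^~ lambda) &
    forall (rho : R[i]) (x : R), 0 <= x <= pi ->
      S x (rho ^+ 2) = csin_div rho x +
        cintegral 0 x (fun t => P x t * csin_div rho t).

(* Partial derivatives of a function on the triangle 0 <= t <= x <= pi. *)
Definition partial1 K (x t : R) : R[i] := derive_in `[t, pi] (K^~ t) x.

Definition partial2 K (x t : R) : R[i] := derive_in `[0, x] (K x) t.

Definition ae_has_partials K (x : R) : Prop :=
  {ae lebesgue_measure, forall t : R, 0 < t < x ->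
    derivable_in `[t, pi] (K^~ t) x /\ derivable_in `[0, x] (K x) t}.

Definition Bconst (r : R) : R :=
  Num.sqrt 2 / 2
  + 12 * r * pi `^ (3 / 2) * expR (2 * pi `^ (3 / 2) * r).

End transmutation_kernels.

(* Main.v *)
(** The variation of constants formula turns the initial value problem into a
    Volterra equation for [C] (resp. [S]); inserting the integral
    representation and writing each product of trigonometric functions as an
    integral of [cos (rho t)] (resp. [sin (rho t) / rho]) gives, for every real
    [rho], vanishing moments of [K - G1 - G2], where [G1] is half the sum of
    [Q] at [(x + t) / 2] and [(x - t) / 2] and [G2] is a double integral of
    [q K]. Trigonometric moments determine a continuous function, so the
    kernel solves the Goursat equation [K = G1 + G2] pointwise (with a sign
    [eps = -1] for [P]).

    Gronwall's lemma bounds [K] and [K - Kt]. Since the inner integral of [G2]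
    is Lipschitz in [(x, t)], the difference of the two [G2] terms has
    partial derivatives bounded by a constant times [||q - qt||]. The partial
    derivatives of [G1] are, for almost every [t], one fourth of the sum or
    difference of [q] at [(x + t) / 2] and [(x - t) / 2], which contributes
    [sqrt 2 / 2] to the constant. *)
Require Import Defs.
From mathcomp Require Import all_boot all_order all_algebra.
From mathcomp Require Import all_classical all_reals all_analysis.
From mathcomp Require Import measurable_realfun.
From mathcomp Require Import complex.
From mathcomp Require Import ring lra.

Set Implicit Arguments.
Unset Strict Implicit.
Unset Printing Implicit Defensive.
Import Order.TTheory GRing.Theory Num.Theory.
Import numFieldNormedType.Exports.
Local Open Scope classical_set_scope.
Local Open Scope ring_scope.
Local Open Scope complex_scope.

(** * Absolutely continuous functions and the fundamental theorem *)

(** The kernels are known only through continuity and their integral representations, so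
    differentiability has to be drawn from the Goursat equation. The bounds concern every [x], while
    [q] is merely square integrable. What cannot be bounded pointwise is confined to [G1], which is
    explicit and linear in [q]; for fixed [x] its derivatives exist at almost every [t]. [G2] is
    controlled by its increments, and no formula for its derivatives is derived. Extending [q] and
    the kernels by zero turns all integrals into integrals over the line; [G1 + G2] then makes sense
    beyond the triangle, and the one-sided derivative at [x = pi] is that of a function
    differentiable from both sides. In the constant, [sqrt 2 / 2] is twice 1/4 times [sqrt 2], the
    effect on the norm of the dilation [t / 2]. The power [pi ^ (3/2)] is made of three factors
    [sqrt pi]: two from Cauchy-Schwarz, for [q] and for [q - qt], and one from the norm of a
    constant on []0, x[]. The factor 12 leaves room: the argument reaches 9/2. *)

Section real_analysis.
Variable R : realType.
Local Notation mu := (@lebesgue_measure R).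

Lemma aeS (P Q : R -> Prop) : (forall x, P x -> Q x) ->
  {ae mu, forall x, P x} -> {ae mu, forall x, Q x}.
Proof. move=> PQ; apply: filterS; first exact: (ae_filter_ringOfSetsType mu). exact: PQ. Qed.

Lemma aeS2 (P Q S : R -> Prop) : (forall x, P x -> Q x -> S x) ->
  {ae mu, forall x, P x} -> {ae mu, forall x, Q x} -> {ae mu, forall x, S x}.
Proof.
move=> PQS; apply: filterS2; first exact: (ae_filter_ringOfSetsType mu).
exact: PQS.
Qed.

Lemma negligible_set1 (a : R) : mu.-negligible [set a].
Proof. by apply/negligibleP; [exact: measurable_set1|exact: lebesgue_measure_set1]. Qed.

Lemma diff_quot_cvgP (f : R -> R) (x l : R) :
  diff_quot f x y @[y --> x^'] --> l <-> is_derive x 1 f l.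
Proof.
have E : (fun h : R => h^-1 *: (f (h *: 1 + x) - f x)) =
         (fun h => diff_quot f x (h + x)).
  by apply/funext => h; rewrite /diff_quot addrK mulrC -[h *: 1]/(h * 1) mulr1.
have cvgE : diff_quot f x y @[y --> x^'] --> l <->
            (fun h : R => h^-1 *: (f (h *: 1 + x) - f x)) @ 0^' --> l.
  rewrite E; split=> /cvgrPdist_lt H; apply/cvgrPdist_lt => e e0.
  - have := H e e0; rewrite !near_withinE => /nbhs_ballP[d /= d0 Hd].
    apply/nbhs_ballP; exists d => //= h /=; rewrite /ball/= sub0r normrN => hd h0.
    apply: Hd; first by rewrite /ball/= opprD addrCA subrr addr0 normrN.
    by rewrite -subr_eq0 addrK.
  - have := H e e0; rewrite !near_withinE => /nbhs_ballP[d /= d0 Hd].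
    apply/nbhs_ballP; exists d => //= y /=; rewrite /ball/= => hd h0.
    rewrite -(subrK x y); apply: Hd; last by rewrite subr_eq0.
    by rewrite /ball/= sub0r opprB.
rewrite cvgE; split=> [H|[Hd <-]].
  split; first by apply/cvg_ex; exists l.
  by apply/cvg_lim => //; exact: Rhausdorff.
exact: Hd.
Qed.

(** Cousin's lemma as an induction over intervals, in place of compactness. The points that [P]
    reaches from [a] have a supremum that is itself reached, and the local hypothesis there leads
    beyond it unless it is [b]. The local hypothesis with [u = v = a] also provides the start. *)
Lemma cousin (P : R -> R -> Prop) (a b : R) : a <= b ->
  (forall u m v, a <= u -> u <= m -> m <= v -> v <= b ->
     P u m -> P m v -> P u v) ->
  (forall x, a <= x <= b -> exists2 d, 0 < d & forall u v,
     a <= u -> u <= x -> x <= v -> v <= b -> v - u < d -> P u v) ->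
  P a b.
Proof.
move=> ab Padd Ploc.
pose S := [set x | a <= x <= b /\ P a x].
have Sa : S a.
  split; first by rewrite lexx.
  have [|d d0] := Ploc a; first by rewrite lexx.
  by apply => //; rewrite subrr.
have supS : has_sup S by split; [exists a | exists b => x [/andP[]]].
set s := sup S.
have as_ : a <= s by exact: sup_upper_bound.
have sb : s <= b by apply: sup_le_ub => //; [exists a | move=> x [/andP[]]].
have [|d d0 Pd] := Ploc s; first by rewrite as_ sb.
have [x Sx xs] := sup_adherent d0 supS.
have {xs}xs : s - d < x by [].
have xles : x <= s by exact: sup_upper_bound.
have [/andP[ax xb] Pax] := Sx.
have Pas : P a s.
  apply: (Padd _ x) => //; apply: Pd => //; lra.
have [<-//|sneb] := eqVneq s b.
have sltb : s < b by rewrite lt_neqAle sneb.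
pose v := Num.min b (s + d / 2).
have vb : v <= b by rewrite ge_min lexx.
have sv : s < v by rewrite lt_min sltb; lra.
have vd : v - s < d.
  have : v <= s + d / 2 by rewrite ge_min lexx orbT.
  lra.
have : S v.
  split; first by rewrite vb andbT (le_trans as_)// ltW.
  apply: (Padd _ s) => //; first exact: ltW.
  by apply: Pd => //; exact: ltW.
move=> /(sup_upper_bound supS); rewrite leNgt.
by rewrite sv.
Qed.

(** The real form of [abs_continuous]: real and imaginary parts are treated separately, since the
    fundamental theorem below is real. *)
Definition ac_fun (a b : R) (g : R -> R) : Prop :=
  forall e : R, 0 < e -> exists2 d : R, 0 < d &
  forall (n : nat) (u v : 'I_n -> R),
    (forall i, a <= u i /\ u i <= v i /\ v i <= b) ->
    trivIset [set: 'I_n] (fun i => `]u i, v i[%classic) ->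
    \sum_(i < n) (v i - u i) < d ->
    \sum_(i < n) `|g (v i) - g (u i)| < e.

(** Ordered lists of intervals concatenate when two adjacent intervals are joined, as [cousin]
    requires; the indexed disjoint families of [ac_fun] are recovered from them in
    [ac_fun_chain]. *)
Fixpoint chain (u : R) (l : seq (R * R)) (v : R) : Prop :=
  if l is p :: l' then [/\ u <= p.1, p.1 <= p.2 & chain p.2 l' v] else u <= v.

Lemma chain_le u l v : chain u l v -> u <= v.
Proof.
elim: l u => [//|p l IH] u /= [up pp /IH]; exact: le_trans (le_trans up pp).
Qed.

Lemma chain_cat u l m l' v :
  chain u l m -> chain m l' v -> chain u (l ++ l') v.
Proof.
elim: l u => [|p l IH] u /=.
  case: l' => [|p' l'] /= um; first exact: le_trans.
  by case=> mp pp c; split => //; exact: le_trans mp.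
by move=> [up pp c] c'; split => //; exact: IH.
Qed.

Lemma chain_nth u l v i : chain u l v -> (i < size l)%N ->
  [/\ u <= (nth (0, 0) l i).1, (nth (0, 0) l i).1 <= (nth (0, 0) l i).2 &
      (nth (0, 0) l i).2 <= v].
Proof.
elim: l u i => [//|p l IH] u [|i] /= [up pp c] il.
  by split => //; exact: chain_le c.
have [h1 h2 h3] := IH _ i c il; split => //.
exact: le_trans (le_trans up pp) h1.
Qed.

Lemma chain_nth_lt u l v i j : chain u l v -> (i < j)%N -> (j < size l)%N ->
  (nth (0, 0) l i).2 <= (nth (0, 0) l j).1.
Proof.
elim: l u i j => [//|p l IH] u [|i] [|j] //= [up pp c] ij jl.
  by have [] := chain_nth c jl.
exact: (IH _ _ _ c).
Qed.

Lemma ac_fun_chain a b g : ac_fun a b g -> forall e, 0 < e ->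
  exists2 d, 0 < d & forall l, chain a l b ->
  \sum_(p <- l) (p.2 - p.1) < d -> \sum_(p <- l) `|g p.2 - g p.1| < e.
Proof.
move=> acg e /acg[d d0 Hd]; exists d => // l cl.
rewrite !(big_nth (0, 0)) !big_mkord => Sd.
apply: (Hd _ (fun i => (nth (0, 0) l i).1) (fun i => (nth (0, 0) l i).2)) => //.
  by move=> i; have [] := chain_nth cl (ltn_ord i).
have dis (i j : 'I_(size l)) : (i < j)%N -> forall z : R,
    `](nth (0, 0) l i).1, (nth (0, 0) l i).2[%classic z ->
    `](nth (0, 0) l j).1, (nth (0, 0) l j).2[%classic z -> False.
  move=> ij z /=; rewrite !in_itv /= => /andP[_ zi] /andP[jz _].
  have := chain_nth_lt cl ij (ltn_ord j).
  by rewrite leNgt (lt_trans jz zi).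
move=> i j _ _ [z [zi zj]]; apply/val_inj => /=.
have [ij|ij|//] := ltngtP i j.
- by exfalso; exact: dis ij _ zi zj.
- by exfalso; exact: dis ij _ zj zi.
Qed.

Lemma integrable_subT (D : set R) (f : R -> R) : measurable D ->
  mu.-integrable setT (EFin \o f) -> mu.-integrable D (EFin \o f).
Proof. by move=> mD; apply: integrableS. Qed.

Lemma Rintegral_cst_oc (u v c : R) : u <= v ->
  \int[mu]_(t in `]u, v]) c = c * (v - u).
Proof.
move=> uv; rewrite Rintegral_cst//; congr (_ * _).
have := lebesgue_measure_itv `]u, v]; rewrite /= lte_fin => ->.
by case: ltP => //= vu; apply/eqP; rewrite eq_sym subr_eq0 eq_le vu.
Qed.

Section absolutely_continuous_ftc.

(** A budget: for [f >= 0] the increments of [mass U f] add up over adjacent intervals and never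
    exceed the integral over [U]. The cost of a partition can thus be carried by the invariant that
    [cousin] propagates. *)
Let mass (U : set R) (f : R -> R) (v : R) : R :=
  \int[mu]_(t in U `&` `]-oo, v]) f t.

Let mass_sub (U : set R) f u v : measurable U ->
  mu.-integrable U (EFin \o f) -> u <= v ->
  mass U f v - mass U f u = \int[mu]_(t in U `&` `]u, v]) f t.
Proof.
move=> mU If uv; rewrite /mass.
have -> : U `&` `]-oo, v]%classic =
    (U `&` `]-oo, u]%classic) `|` (U `&` `]u, v]%classic).
  rewrite -setIUr; congr (_ `&` _); apply/seteqP; split => z /=; rewrite !in_itv/=.
    by move=> zv; case: (leP z u) => ?; [left|right].
  by case=> [zu|/andP[]//]; exact: le_trans uv.
rewrite Rintegral_setU; last first.
- apply/disj_setPS => z [[_ /=] + [_ /=]]; rewrite !in_itv/= => zu /andP[].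
  by rewrite ltNge zu.
- apply: integrableS If => //; last by move=> z [[]|[]].
  by apply: measurableU; apply: measurableI.
- exact: measurableI.
- exact: measurableI.
by rewrite addrAC subrr add0r.
Qed.

Let mass_ge (U : set R) f u v : measurable U ->
  mu.-integrable U (EFin \o f) -> (forall x, 0 <= f x) -> u <= v ->
  0 <= mass U f v - mass U f u.
Proof.
by move=> mU If f0 uv; rewrite mass_sub//; apply: Rintegral_ge0.
Qed.

Let mass_le (U : set R) f u v : measurable U ->
  mu.-integrable U (EFin \o f) -> (forall x, 0 <= f x) -> u <= v ->
  mass U f v - mass U f u <= \int[mu]_(t in U) f t.
Proof.
move=> mU If f0 uv; rewrite mass_sub//.
have UE : U = (U `&` `]u, v]%classic) `|` (U `\` `]u, v]%classic).
  by rewrite setUIDK.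
rewrite [leRHS](_ : _ = \int[mu]_(t in (U `&` `]u, v]) `|` (U `\` `]u, v])) f t);
  last by rewrite -UE.
rewrite Rintegral_setU; last first.
- by apply/disj_setPS => z [[_ ?] [_ ?]].
- by rewrite -UE.
- exact: measurableD.
- exact: measurableI.
by rewrite lerDl; apply: Rintegral_ge0.
Qed.

(** The function [G = g - H], with [H] the primitive of [h], has derivative zero off a null set,
    which an open set [U] of small measure covers. Intervals tagged in the null set lie in [U],
    where absolute continuity of [g] and of the integral bounds the increments; on the others the
    derivative bounds the increment of [G] by [e] times the length. No covering theorem beyond
    [cousin] enters. *)
Lemma ac_fun_ftc (a b : R) (g h : R -> R) : a <= b -> ac_fun a b g ->
  mu.-integrable setT (EFin \o h) ->
  {ae mu, forall x : R, a < x < b -> diff_quot g x y @[y --> x^'] --> h x} ->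
  g b - g a = \int[mu]_(t in `]a, b]) h t.
Proof.
move=> ab acg Ih aeg.
pose H v := \int[mu]_(t in `]-oo, v]) h t.
have HB u v : u <= v -> H v - H u = \int[mu]_(t in `]u, v]) h t.
  move=> uv; apply: Rintegral_itvB; rewrite ?bnd_simp//.
  exact: integrableS Ih.
rewrite -HB//.
apply/eqP; rewrite -subr_eq0 -normr_le0; apply/ler_addgt0Pr => e' e'0; rewrite add0r.
(* Three costs: [e * (b - a)] from the tags with zero derivative, one [e] for the variation of [g]
   and one for the integral of the modulus of [h] over [U]. *)
pose e := e' / (b - a + 2).
have ba2 : 0 < b - a + 2 by rewrite ltr_wpDl ?subr_ge0.
have e0 : 0 < e by rewrite divr_gt0.
have [d1 d10 Hd1] := ac_fun_chain acg e0.
have [d2 [d20 Hd2]] := integral_normr_continuous Ih e0.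
pose d := Num.min d1 d2.
have d0 : 0 < d by rewrite lt_min d10.
pose G x := g x - H x.
have aeH : {ae mu, forall x : R, diff_quot H x y @[y --> x^'] --> h x}.
  have locf : locally_integrable [set: R] h.
    by apply: open_integrable_locally => //; exact: openT.
  have := @FTC1Ny R h (fun y => integrable_subT (measurable_itv _) Ih) locf.
  apply: aeS => x [dH dHx]; apply/diff_quot_cvgP.
  by split => //; rewrite -derive1E.
have aeG : {ae mu, forall x : R, a < x < b -> diff_quot G x y @[y --> x^'] --> 0}.
  move: aeg aeH; apply: aeS2 => x gx Hx axb.
  have -> : diff_quot G x = (fun y => diff_quot g x y - diff_quot H x y).
    by apply/funext => y; rewrite /diff_quot /G -mulrBl; congr (_ / _); ring.
  by rewrite -(subrr (h x)); apply: cvgB; [exact: gx|].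
(* The end points join the exceptional set because the derivative is known in the open interval
   only. *)
pose Z := (~` [set x : R | a < x < b -> diff_quot G x y @[y --> x^'] --> 0]) `|`
  ([set a] `|` [set b]).
have negZ : mu.-negligible Z.
  apply: negligibleU; first exact: aeG.
  by apply: negligibleU; exact: negligible_set1.
have [|U [oU ZU mUd]] := @outer_measure_open_le R Z (d / 2); first by rewrite divr_gt0.
have mU : measurable U by exact: open_measurable.
have {mUd}mUd : (mu U < d%:E)%E.
  have Z0 := (negligible_outer_measure Z).1 negZ.
  apply: le_lt_trans mUd _; rewrite Z0 add0e lte_fin; lra.
have Iabs : mu.-integrable U (EFin \o (fun t => `|h t|)).
  have := integrable_norm Ih; apply: integrableS => //.
have I1 : mu.-integrable U (EFin \o (fun t : R => 1)).
  apply: measurable_bounded_integrable => //; first exact: lt_trans mUd (ltry _).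
  exact: bounded_cst.
(* The list [l] collects the intervals tagged in [Z]. The second clause keeps their total length
   below the measure of [U], so that absolute continuity of [g] applies to all of them at once. *)
pose P u v := exists l, [/\ chain u l v,
  \sum_(p <- l) (p.2 - p.1) <= mass U (fun=> 1) v - mass U (fun=> 1) u &
  `|G v - G u| <= e * (v - u) + (mass U (fun t => `|h t|) v - mass U (fun t => `|h t|) u)
     + \sum_(p <- l) `|g p.2 - g p.1| ].
have : P a b.
  apply: cousin => //.
    move=> u m v au um mv vb [l1 [c1 s1 t1]] [l2 [c2 s2 t2]].
    exists (l1 ++ l2); split; first exact: chain_cat c1 c2.
      by rewrite big_cat/=; lra.
    rewrite big_cat/=.
    have -> : G v - G u = (G v - G m) + (G m - G u) by ring.
    apply: le_trans (ler_normD _ _) _; lra.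
  move=> x /andP[ax xb].
  have [xZ|xZ] := pselect (Z x).
    have /nbhs_ballP[r /= r0 xr] : nbhs x U by apply: open_nbhs_nbhs; split => //; exact: ZU.
    exists r => // u v au ux xv vb uvr.
    have uv : u <= v by exact: le_trans xv.
    have sU : `]u, v]%classic `<=` U.
      move=> z /=; rewrite in_itv/= => /andP[uz zv]; apply: xr; rewrite /ball/=.
      by rewrite ltr_norml; lra.
    exists [:: (u, v)]; rewrite !big_seq1/=; split => //.
      by rewrite mass_sub// setIidr// Rintegral_cst_oc// mul1r.
    have -> : G v - G u = (g v - g u) - (H v - H u) by rewrite /G; ring.
    apply: le_trans (ler_normB _ _) _; rewrite mass_sub// setIidr// HB//.
    have := @le_normr_Rintegral _ _ _ mu `]u, v] h (measurable_itv _)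
      (integrable_subT (measurable_itv _) Ih).
    have : 0 <= e * (v - u) by rewrite mulr_ge0 ?subr_ge0// ltW.
    lra.
  have /not_orP[/contrapT + /not_orP[/= xa' xb']] := xZ.
  have axb : a < x < b by rewrite !lt_neqAle ax xb !andbT eq_sym; apply/andP; split; apply/eqP.
  move=> /(_ axb) /cvgrPdist_lt /(_ _ e0); rewrite near_withinE => /nbhs_ballP[r /= r0 xr].
  have Gx y : `|y - x| < r -> `|G y - G x| <= e * `|y - x|.
    move=> yxr; have [->|yx] := eqVneq y x; first by rewrite !subrr normr0 mulr0.
    have := xr y; rewrite /ball/= distrC => /(_ yxr yx).
    rewrite sub0r normrN /diff_quot normrM normfV => /ltW.
    by rewrite ler_pdivrMr// normr_gt0 subr_eq0.
  exists r => // u v au ux xv vb uvr.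
  have uv : u <= v by exact: le_trans xv.
  exists [::]; rewrite !big_nil/=; split => //.
    exact: mass_ge.
  have -> : G v - G u = (G v - G x) - (G u - G x) by ring.
  apply: le_trans (ler_normB _ _) _; rewrite addr0.
  have := mass_ge mU Iabs (fun x => normr_ge0 _) uv.
  have : `|G v - G x| <= e * `|v - x| by apply: Gx; rewrite ger0_norm; lra.
  have : `|G u - G x| <= e * `|u - x| by apply: Gx; rewrite ler0_norm; lra.
  rewrite (ger0_norm (_ : 0 <= v - x)) ?subr_ge0// (ler0_norm (_ : u - x <= 0)) ?subr_le0//.
  lra.
move=> [l [cl sl tl]].
have ltmU : \sum_(p <- l) (p.2 - p.1) < d.
  apply: le_lt_trans sl _; apply: le_lt_trans (mass_le _ _ _ _) _ => //.
  rewrite Rintegral_cst// mul1r -lte_fin fineK//.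
  by rewrite ge0_fin_numE// (lt_trans mUd)// ltry.
have lth : \int[mu]_(t in U) `|h t| < e.
  by apply: Hd2 => //; apply: lt_le_trans mUd _; rewrite lee_fin ge_min lexx orbT.
have ltg : \sum_(p <- l) `|g p.2 - g p.1| < e.
  by apply: Hd1 => //; apply: lt_le_trans ltmU _; rewrite ge_min lexx.
have lem : mass U (fun t => `|h t|) b - mass U (fun t => `|h t|) a <= \int[mu]_(t in U) `|h t|.
  exact: mass_le.
have -> : g b - g a - (H b - H a) = G b - G a by rewrite /G; ring.
have -> : e' = e * (b - a) + 2 * e.
  by rewrite /e; field; rewrite gt_eqF.
apply: le_trans tl _; rewrite -addrA lerD2l mulr_natl mulr2n; apply: lerD.
  exact: le_trans lem (ltW lth).
exact: ltW.
Qed.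

End absolutely_continuous_ftc.
End real_analysis.

(** * Complex-valued integration *)

Section complex_integral.
Variable R : realType.
Local Notation mu := (@lebesgue_measure R).
Implicit Types (D : set R) (f g : R -> R[i]) (z w : R[i]).
Local Notation Re := (@complex.Re R).
Local Notation Im := (@complex.Im R).

Lemma ReM z w : Re (z * w) = Re z * Re w - Im z * Im w.
Proof. by case: z w => a b [c d]. Qed.

Lemma ImM z w : Im (z * w) = Re z * Im w + Im z * Re w.
Proof. by case: z w => a b [c d]. Qed.

Lemma ReD z w : Re (z + w) = Re z + Re w.
Proof. by case: z w => a b [c d]. Qed.

Lemma ImD z w : Im (z + w) = Im z + Im w.
Proof. by case: z w => a b [c d]. Qed.

Lemma ReN z : Re (- z) = - Re z.
Proof. by case: z. Qed.

Lemma ImN z : Im (- z) = - Im z.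
Proof. by case: z. Qed.

Lemma ReB z w : Re (z - w) = Re z - Re w.
Proof. by rewrite ReD ReN. Qed.

Lemma ImB z w : Im (z - w) = Im z - Im w.
Proof. by rewrite ImD ImN. Qed.

Lemma complex_ext z w : Re z = Re w -> Im z = Im w -> z = w.
Proof. by case: z w => a b [c d] /= -> ->. Qed.

Lemma cabsE z : cabs z = Num.sqrt (Re z ^+ 2 + Im z ^+ 2).
Proof. by case: z. Qed.

Lemma cabs_ge0 z : 0 <= cabs z.
Proof. by rewrite cabsE sqrtr_ge0. Qed.

Lemma cabs0 : cabs (0 : R[i]) = 0.
Proof. by rewrite cabsE /= expr0n addr0 sqrtr0. Qed.

Lemma cabsM z w : cabs (z * w) = cabs z * cabs w.
Proof. exact: Normc.normcM. Qed.

Lemma cabsD z w : cabs (z + w) <= cabs z + cabs w.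
Proof. exact: le_normcD. Qed.

Lemma cabsN z : cabs (- z) = cabs z.
Proof. exact: normcN. Qed.

Lemma cabsB z w : cabs (z - w) <= cabs z + cabs w.
Proof. by rewrite -(cabsN w) cabsD. Qed.

Lemma cabsR (a : R) : cabs a%:C = `|a|.
Proof. by rewrite cabsE /= expr0n addr0 sqrtr_sqr. Qed.

Lemma normRe_le_cabs z : `|Re z| <= cabs z.
Proof.
by rewrite cabsE -sqrtr_sqr ler_wsqrtr// lerDl sqr_ge0.
Qed.

Lemma normIm_le_cabs z : `|Im z| <= cabs z.
Proof.
by rewrite cabsE -sqrtr_sqr ler_wsqrtr// lerDr sqr_ge0.
Qed.

Lemma cabs_le_normD z : cabs z <= `|Re z| + `|Im z|.
Proof.
case: z => a b; have -> : a +i* b = a%:C + 0 +i* b.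
  by apply: complex_ext; rewrite /= ?addr0 ?add0r.
apply: le_trans (cabsD _ _) _; rewrite cabsR (cabsE (0 +i* b))/= addr0 add0r.
by rewrite expr0n add0r sqrtr_sqr.
Qed.

(** The modulus is the largest real part among the rotations of [z], attained in the direction of
    [z] itself ([cabs_dirP]). Arguing in one direction at a time carries real estimates over to
    complex ones without the constant lost by bounding real and imaginary parts separately. *)
Lemma cabs_dir_le z (c d : R) : c ^+ 2 + d ^+ 2 = 1 -> c * Re z + d * Im z <= cabs z.
Proof.
move=> cd1; have -> : c * Re z + d * Im z = Re ((c -i* d) * z).
  by rewrite ReM /=; ring.
apply: le_trans (ler_norm _) _; apply: le_trans (normRe_le_cabs _) _.
by rewrite cabsM [cabs (_ -i* _)]cabsE/= sqrrN cd1 sqrtr1 mul1r.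
Qed.

Lemma cabs_dirP z (L : R) : 0 <= L ->
  (forall c d, c ^+ 2 + d ^+ 2 = 1 -> c * Re z + d * Im z <= L) -> cabs z <= L.
Proof.
move=> L0 zL; have [z0|z0] := eqVneq (cabs z) 0; first by rewrite z0.
have zp : 0 < cabs z by rewrite lt_neqAle eq_sym z0 cabs_ge0.
have z2 : Re z ^+ 2 + Im z ^+ 2 = cabs z ^+ 2.
  by rewrite cabsE sqr_sqrtr// addr_ge0// sqr_ge0.
have := zL (Re z / cabs z) (Im z / cabs z).
rewrite !exprMn -mulrDl z2 exprVn divff ?expf_neq0// => /(_ erefl).
apply: le_trans.
have -> : Re z / cabs z * Re z + Im z / cabs z * Im z =
  (Re z ^+ 2 + Im z ^+ 2) / cabs z by ring.
by rewrite z2 expr2 mulfK.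
Qed.

Definition cint D f : R[i] :=
  (\int[mu]_(t in D) Re (f t)) +i* (\int[mu]_(t in D) Im (f t)).

Definition cmeas D f := measurable_fun D (Re \o f) /\ measurable_fun D (Im \o f).

Definition cintegrable D f :=
  mu.-integrable D (EFin \o (Re \o f)) /\ mu.-integrable D (EFin \o (Im \o f)).

Lemma integrable_bound D (f g : R -> R) : measurable D -> measurable_fun D f ->
  (forall x, D x -> `|f x| <= g x) -> mu.-integrable D (EFin \o g) ->
  mu.-integrable D (EFin \o f).
Proof.
move=> mD mf fg Ig; apply: (@le_integrable _ _ _ mu _ mD _ _ _ _ Ig).
  exact/measurable_EFinP.
move=> x Dx /=; rewrite lee_fin (le_trans (fg _ Dx))//.
exact: ler_norm.
Qed.

Lemma integrableRD D (f g : R -> R) : measurable D -> mu.-integrable D (EFin \o f) ->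
  mu.-integrable D (EFin \o g) -> mu.-integrable D (EFin \o (fun x => f x + g x)).
Proof. by move=> mD If Ig; have := @integrableD _ _ _ mu _ mD _ _ If Ig; apply: eq_integrable. Qed.

Lemma integrableRZ (c : R) D (f : R -> R) : measurable D -> mu.-integrable D (EFin \o f) ->
  mu.-integrable D (EFin \o (fun x => c * f x)).
Proof. by move=> mD If; have := @integrableZl _ _ _ mu _ mD c _ If; apply: eq_integrable. Qed.

Lemma integrableRB D (f g : R -> R) : measurable D -> mu.-integrable D (EFin \o f) ->
  mu.-integrable D (EFin \o g) -> mu.-integrable D (EFin \o (fun x => f x - g x)).
Proof.
move=> mD If Ig; have := integrableRD mD If (integrableRZ (-1) mD Ig).
by apply: eq_integrable => // x _ /=; rewrite mulN1r.
Qed.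

Lemma integrableRnorm D (f : R -> R) : measurable D -> mu.-integrable D (EFin \o f) ->
  mu.-integrable D (EFin \o (fun x => `|f x|)).
Proof. by move=> mD If; have := @integrable_norm _ _ _ mu _ _ If; apply: eq_integrable. Qed.

Lemma cintegrable_bound D f (g : R -> R) : measurable D -> cmeas D f ->
  (forall x, D x -> cabs (f x) <= g x) -> mu.-integrable D (EFin \o g) ->
  cintegrable D f.
Proof.
move=> mD [mr mi] fg Ig; split; apply: (integrable_bound mD _ _ Ig) => // x Dx.
- exact: le_trans (normRe_le_cabs _) (fg _ Dx).
- exact: le_trans (normIm_le_cabs _) (fg _ Dx).
Qed.

Lemma measurable_sqrt_fun D (f : R -> R) : measurable_fun D f ->
  measurable_fun D (fun x => Num.sqrt (f x)).
Proof.
move=> mf; apply: (measurableT_comp _ mf).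
by apply: continuous_measurable_fun => x; exact: sqrt_continuous.
Qed.

Lemma cmeas_cabs D f : cmeas D f -> measurable_fun D (@cabs R \o f).
Proof.
move=> [mr mi].
have -> : @cabs R \o f = fun x => Num.sqrt (Re (f x) ^+ 2 + Im (f x) ^+ 2).
  by apply/funext => x; rewrite /= cabsE.
by apply: measurable_sqrt_fun; apply: measurable_funD;
  apply: measurable_funX.
Qed.

Lemma cintegrable_cmeas D f : cintegrable D f -> cmeas D f.
Proof. by move=> [/measurable_int/measurable_EFinP ? /measurable_int/measurable_EFinP ?]. Qed.

Lemma cintegrable_cabs D f : measurable D -> cintegrable D f ->
  mu.-integrable D (EFin \o (@cabs R \o f)).
Proof.
move=> mD If; have [Ir Ii] := If.
apply: (@integrable_bound _ _ (fun x => `|Re (f x)| + `|Im (f x)|)) => //.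
- by apply: cmeas_cabs; exact: cintegrable_cmeas.
- by move=> x _; rewrite ger0_norm ?cabs_ge0// cabs_le_normD.
- exact: (integrableRD mD (integrableRnorm mD Ir) (integrableRnorm mD Ii)).
Qed.

Lemma cintegrableS D D' f : measurable D -> measurable D' -> D' `<=` D ->
  cintegrable D f -> cintegrable D' f.
Proof. by move=> mD mD' sD [Ir Ii]; split; [exact: integrableS Ir|exact: integrableS Ii]. Qed.

Lemma eq_cint D f g : (forall x, D x -> f x = g x) -> cint D f = cint D g.
Proof.
move=> fg; congr (_ +i* _); apply: eq_Rintegral => x; rewrite inE => Dx;
  by rewrite fg.
Qed.

Lemma eq_cintegrable D f g : measurable D -> (forall x, D x -> f x = g x) ->
  cintegrable D f -> cintegrable D g.
Proof.
move=> mD fg [Ir Ii]; split.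
- by apply: eq_integrable Ir => // x; rewrite inE/= => /fg ->.
- by apply: eq_integrable Ii => // x; rewrite inE/= => /fg ->.
Qed.

Lemma cintegrableD D f g : measurable D -> cintegrable D f -> cintegrable D g ->
  cintegrable D (fun x => f x + g x).
Proof.
move=> mD [fr fi] [gr gi]; split.
- have -> : Re \o (fun x => f x + g x) = (fun x => (Re \o f) x + (Re \o g) x) by apply/funext => x; rewrite /= ReD.
  exact: integrableRD.
- have -> : Im \o (fun x => f x + g x) = (fun x => (Im \o f) x + (Im \o g) x) by apply/funext => x; rewrite /= ImD.
  exact: integrableRD.
Qed.

Lemma cintegrableN D f : measurable D -> cintegrable D f -> cintegrable D (fun x => - f x).
Proof.
move=> mD [fr fi]; split.
- have := integrableRZ (-1) mD fr; apply: eq_integrable => // x _ /=.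
  by rewrite ReN mulN1r.
- have := integrableRZ (-1) mD fi; apply: eq_integrable => // x _ /=.
  by rewrite ImN mulN1r.
Qed.

Lemma cintegrableZ D z f : measurable D -> cintegrable D f -> cintegrable D (fun x => z * f x).
Proof.
move=> mD If; have [mr mi] := cintegrable_cmeas If.
apply: (@cintegrable_bound _ _ (fun x => cabs z * cabs (f x))) => //.
- split.
  + have -> : Re \o (fun x => z * f x) = (fun x => Re z * Re (f x) - Im z * Im (f x)).
      by apply/funext => x; rewrite /= ReM.
    by apply: measurable_funB; apply: measurable_funM.
  + have -> : Im \o (fun x => z * f x) = (fun x => Re z * Im (f x) + Im z * Re (f x)).
      by apply/funext => x; rewrite /= ImM.
    by apply: measurable_funD; apply: measurable_funM.
- by move=> x _; rewrite cabsM.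
- exact: integrableRZ (cintegrable_cabs mD If).
Qed.

Lemma cintD D f g : measurable D -> cintegrable D f -> cintegrable D g ->
  cint D (fun x => f x + g x) = cint D f + cint D g.
Proof.
move=> mD [fr fi] [gr gi]; apply: complex_ext; rewrite /= -RintegralD//;
  by apply: eq_Rintegral => x _; rewrite ?ReD ?ImD.
Qed.

Lemma cintN D f : measurable D -> cintegrable D f ->
  cint D (fun x => - f x) = - cint D f.
Proof.
move=> mD [fr fi]; apply: complex_ext; rewrite /= -mulN1r -RintegralZl//;
  by apply: eq_Rintegral => x _; rewrite ?ReN ?ImN mulN1r.
Qed.

Lemma cintB D f g : measurable D -> cintegrable D f -> cintegrable D g ->
  cint D (fun x => f x - g x) = cint D f - cint D g.
Proof.
by move=> mD If Ig; rewrite cintD ?cintN//; exact: cintegrableN.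
Qed.

Lemma cintZ D z f : measurable D -> cintegrable D f ->
  cint D (fun x => z * f x) = z * cint D f.
Proof.
move=> mD [fr fi]; apply: complex_ext; rewrite /= ?ReM ?ImM/= -!RintegralZl//.
- rewrite -RintegralB//; try exact: integrableRZ.
  by apply: eq_Rintegral => x _; rewrite ReM.
- rewrite -RintegralD//; try exact: integrableRZ.
  by apply: eq_Rintegral => x _; rewrite ImM.
Qed.

(** In each direction the complex integral is the real integral of [c * Re f + d * Im f], and
    [cabs_dir_le] bounds the integrand. *)
Lemma le_cabs_cint D f : measurable D -> cintegrable D f ->
  cabs (cint D f) <= \int[mu]_(t in D) cabs (f t).
Proof.
move=> mD If; have [fr fi] := If; apply: cabs_dirP.
  by apply: Rintegral_ge0 => x _; exact: cabs_ge0.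
move=> c d cd1 /=; rewrite -!RintegralZl// -RintegralD//; try exact: integrableRZ.
apply: le_Rintegral => //.
- exact: (integrableRD mD (integrableRZ c mD fr) (integrableRZ d mD fi)).
- exact: cintegrable_cabs.
- by move=> x _; exact: cabs_dir_le.
Qed.

Lemma le_cabs_cint_bound D f (g : R -> R) : measurable D -> cmeas D f ->
  (forall x, D x -> cabs (f x) <= g x) -> mu.-integrable D (EFin \o g) ->
  cabs (cint D f) <= \int[mu]_(t in D) g t.
Proof.
move=> mD mf fg Ig; have If := cintegrable_bound mD mf fg Ig.
apply: le_trans (le_cabs_cint mD If) _; apply: le_Rintegral => //.
exact: cintegrable_cabs.
Qed.

End complex_integral.

(** * Measurability and Fubini's theorem on the plane *)

Section product_measurability.
Variable R : realType.
Local Notation mu := (@lebesgue_measure R).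
Local Notation MR := (measurableTypeR R).

(** The product sigma-algebra is generated by rectangles, so an open set has to be exhibited as a
    countable union of them: boxes with rational centres and radius [1 / (n + 1)], replaced by
    [set0] when they are not contained in [V]. *)
Lemma measurable_open_prod (V : set (R * R)) : open V ->
  measurable (V : set (MR * MR)).
Proof.
move=> oV.
pose B (a b : rat) (n : nat) : set (R * R) :=
  `](ratr a - n.+1%:R^-1), (ratr a + n.+1%:R^-1)[ `*` `](ratr b - n.+1%:R^-1), (ratr b + n.+1%:R^-1)[.
have -> : V = \bigcup_(a : rat) \bigcup_(b : rat) \bigcup_(n : nat)
    (if `[< B a b n `<=` V >] then B a b n else set0).
  apply/seteqP; split => [[x y] Vxy|[x y] [a _ [b _ [n _]]]]; last first.
    by case: ifPn => // /asboolP; apply.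
  have /nbhs_ballP[e /= e0 eV] : nbhs (x, y) V by apply: open_nbhs_nbhs; split.
  have [n ne] : exists n : nat, n.+1%:R^-1 < e / 2.
    have [n _ /(_ n) /= h] := near_infty_natSinv_lt (PosNum (divr_gt0 e0 (ltr0Sn R 1))).
    by exists n; apply: h => /=.
  have n0 : 0 < (n.+1%:R^-1 : R) by rewrite invr_gt0.
  have [a ax] : exists a : rat, x - n.+1%:R^-1 < ratr a < x + n.+1%:R^-1.
    have [] := @rat_in_itvoo R (x - n.+1%:R^-1) (x + n.+1%:R^-1).
      by rewrite ltrBlDr -addrA ltrDl addr_gt0.
    by move=> b; rewrite in_itv/=; exists b.
  have [b yb] : exists a : rat, y - n.+1%:R^-1 < ratr a < y + n.+1%:R^-1.
    have [] := @rat_in_itvoo R (y - n.+1%:R^-1) (y + n.+1%:R^-1).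
      by rewrite ltrBlDr -addrA ltrDl addr_gt0.
    by move=> b; rewrite in_itv/=; exists b.
  exists a => //; exists b => //; exists n => //.
  case: ifPn => [_|/asboolP[]].
    split; rewrite /= in_itv/=; move: (n.+1%:R^-1) n0 ne ax yb => k *; lra.
  move=> [u v] [/=]; rewrite !in_itv/= => /andP[u1 u2] /andP[v1 v2].
  move: (n.+1%:R^-1) n0 ne ax yb u1 u2 v1 v2 => k *.
  by apply: eV; split; rewrite /ball/= ltr_norml; lra.
apply: bigcupT_measurable_rat => a; apply: bigcupT_measurable_rat => b.
apply: bigcupT_measurable => n; case: ifPn => // _.
by apply: measurableX; exact: measurable_itv.
Qed.

Lemma measurable_fun_within_prod (D : set (R * R)) (f : R * R -> R) :
  measurable (D : set (MR * MR)) -> {within D, continuous f} ->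
  measurable_fun (D : set (MR * MR)) (f : MR * MR -> R).
Proof.
move=> mD /continuousP cf; apply: (measurability _ (RGenOpens.measurableE R)).
move=> _ [_ [a [b ->] <-]].
have /open_subspaceP[V oV VD] := cf _ (@interval_open R (BRight a) (BLeft b) isT isT).
rewrite setIC -VD; apply: measurableI => //; exact: measurable_open_prod.
Qed.

Lemma measurable_Rintegral_param (d : measure_display) (T : measurableType d)
    (F : T * MR -> R) : measurable_fun setT F ->
  measurable_fun setT (fun x => \int[mu]_t F (x, t)).
Proof.
move=> mF; rewrite /Rintegral.
apply: (measurableT_comp (@fine_measurable R setT measurableT)) => //.
have mEF : measurable_fun setT (EFin \o F) by exact/measurable_EFinP.
rewrite [X in measurable_fun _ X](_ : _ = fun x =>
  (\int[mu]_t (EFin \o F)^\+ (x, t) - \int[mu]_t (EFin \o F)^\- (x, t))%E); last first.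
  apply/funext => x; rewrite [LHS]integralE.
  by congr (_ - _)%E; apply: eq_integral => t _; rewrite ?funeposE ?funenegE.
apply: emeasurable_funB.
- apply: (@measurable_fun_fubini_tonelli_F _ _ _ _ _ mu) => //.
  exact: measurable_funepos.
- apply: (@measurable_fun_fubini_tonelli_F _ _ _ _ _ mu) => //.
  exact: measurable_funeneg.
Qed.

(** Domination by a product reduces integrability on the plane to that of [a] and [b] on the line;
    the double integrals below are dominated in this form. *)
Lemma Rintegral_swap (H : MR * MR -> R) (a b : R -> R) :
  measurable_fun setT H ->
  mu.-integrable setT (EFin \o a) -> mu.-integrable setT (EFin \o b) ->
  (forall s t, `|H (s, t)| <= a s * b t) ->
  \int[mu]_s \int[mu]_t H (s, t) = \int[mu]_t \int[mu]_s H (s, t).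
Proof.
move=> mH Ia Ib Hab.
have mEH : measurable_fun setT (EFin \o H) by exact/measurable_EFinP.
have mH1 s : measurable_fun setT (fun t => H (s, t)).
  by apply: (measurableT_comp mH); exact: pair1_measurable.
have mH2 t : measurable_fun setT (fun s => H (s, t)).
  by apply: (measurableT_comp mH); exact: pair2_measurable.
have I1 s : mu.-integrable setT (EFin \o (fun t => H (s, t))).
  apply: (@integrable_bound R setT _ (fun t => a s * b t)) => //; first exact: mH1.
  exact: integrableRZ.
have I2 t : mu.-integrable setT (EFin \o (fun s => H (s, t))).
  apply: (@integrable_bound R setT _ (fun s => b t * a s)) => //; first exact: mH2.
    by move=> s _; rewrite mulrC.
  exact: integrableRZ.
have Iprod : (mu \x mu)%E.-integrable setT (EFin \o H).
  apply/(integrable12ltyP _ _ mEH).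
  pose B := \int[mu]_t `|b t|.
  have leB s : (\int[mu]_t `|(EFin \o H) (s, t)| <= (`|a s| * B)%:E)%E.
    have -> : (`|a s| * B)%:E = (\int[mu]_t (`|a s| * `|b t|)%:E)%E.
      have := @RintegralZl _ _ _ mu setT (fun t => `|b t|) `|a s| measurableT
        (integrableRnorm measurableT Ib).
      rewrite -/B => <-; rewrite /Rintegral fineK//.
      apply: integrable_fin_num => //.
      exact: (integrableRZ `|a s| measurableT (integrableRnorm measurableT Ib)).
    apply: ge0_le_integral => //.
    - by apply: measurableT_comp => //; apply/measurable_EFinP; exact: mH1.
    - apply/measurable_EFinP; apply: measurable_funM => //.
      by have /measurable_int/measurable_EFinP := integrableRnorm measurableT Ib.
    - move=> t _ /=; rewrite lee_fin (le_trans (Hab _ _))// -normrM.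
      exact: ler_norm.
  apply: (@le_lt_trans _ _ (\int[mu]_s (`|a s| * B)%:E)%E).
    apply: ge0_le_integral => //.
    - by move=> s _; exact: integral_ge0.
    - apply: (@measurable_fun_fubini_tonelli_F _ _ _ _ _ mu (fun z => `|(EFin \o H) z|)%E) => //.
      exact: measurableT_comp.
    - apply/measurable_EFinP; apply: measurable_funM => //.
      by have /measurable_int/measurable_EFinP := integrableRnorm measurableT Ia.
  have : mu.-integrable setT (EFin \o (fun s => `|a s| * B)).
    have := integrableRZ B measurableT (integrableRnorm measurableT Ia).
    by apply: eq_integrable => // s _ /=; rewrite mulrC.
  move=> /integrableP[_]; apply: le_lt_trans.
  apply: ge0_le_integral => //.
  - by move=> s _; rewrite lee_fin mulr_ge0//; apply: Rintegral_ge0.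
  - apply/measurable_EFinP; apply: measurable_funM => //.
    by have /measurable_int/measurable_EFinP := integrableRnorm measurableT Ia.
  - apply: measurableT_comp => //.
    apply/measurable_EFinP; apply: measurable_funM => //.
    by have /measurable_int/measurable_EFinP := integrableRnorm measurableT Ia.
  - by move=> s _ /=; rewrite lee_fin; exact: ler_norm.
have := Fubini Iprod => /= E.
rewrite {1 3}/Rintegral; congr fine.
under eq_integral do rewrite /Rintegral fineK ?(integrable_fin_num _ (I1 _))//.
under [RHS]eq_integral do rewrite /Rintegral fineK ?(integrable_fin_num _ (I2 _))//.
exact: E.
Qed.

End product_measurability.

(** * Complex Fubini and differentiation under the integral sign *)

Section parametric_integrals.
Variable R : realType.
Local Notation mu := (@lebesgue_measure R).
Local Notation MR := (measurableTypeR R).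
Local Notation Re := (@complex.Re R).
Local Notation Im := (@complex.Im R).

Lemma cint_swap (H : MR * MR -> R[i]) (a b : R -> R) :
  measurable_fun setT (Re \o H) -> measurable_fun setT (Im \o H) ->
  mu.-integrable setT (EFin \o a) -> mu.-integrable setT (EFin \o b) ->
  (forall s t, cabs (H (s, t)) <= a s * b t) ->
  cint setT (fun s => cint setT (fun t => H (s, t))) =
  cint setT (fun t => cint setT (fun s => H (s, t))).
Proof.
move=> mr mi Ia Ib Hab; congr (_ +i* _).
- apply: (Rintegral_swap mr Ia Ib) => s t; exact: le_trans (normRe_le_cabs _) (Hab _ _).
- apply: (Rintegral_swap mi Ia Ib) => s t; exact: le_trans (normIm_le_cabs _) (Hab _ _).
Qed.

(** Dominated convergence along sequences on either side of [x]: the Lipschitz bound [g] dominates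
    all difference quotients. Existence of the limit is enough, because the derivative of [G2] is
    later bounded by a Lipschitz constant and never computed. *)
Lemma cvg_diff_quot_Rintegral (phi : R -> R -> R) (g : R -> R) (x : R) :
  (forall y, mu.-integrable setT (EFin \o phi y)) ->
  mu.-integrable setT (EFin \o g) ->
  (forall y y' s, `|phi y s - phi y' s| <= g s * `|y - y'|) ->
  {ae mu, forall s, cvg (diff_quot (phi ^~ s) x y @[y --> x^'])} ->
  cvg (diff_quot (fun y => \int[mu]_s phi y s) x y @[y --> x^']).
Proof.
move=> Iphi Ig phig [N [mN N0 subN]].
(* On [D] the quotients converge at every point, which makes [l] measurable as a pointwise limit. *)
pose D := setT `\` N.
have mD : measurable (D : set MR) by exact: measurableD.
pose l s := lim (diff_quot (phi ^~ s) x y @[y --> x^']).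
have lD s : D s -> diff_quot (phi ^~ s) x y @[y --> x^'] --> l s.
  by move=> [_ Ns]; apply: contrapT => h; apply: Ns; apply: subN => /=.
apply/cvg_ex; exists (\int[mu]_(s in D) l s).
have key (u : R^nat) : (forall n, u n != x) -> u n @[n --> \oo] --> x ->
    diff_quot (fun y => \int[mu]_s phi y s) x (u n) @[n --> \oo] --> \int[mu]_(s in D) l s.
  move=> ux cu.
  pose fn n s := diff_quot (phi ^~ s) x (u n).
  have Ifn n : mu.-integrable setT (EFin \o fn n).
    have := integrableRZ (u n - x)^-1 measurableT (integrableRB measurableT (Iphi (u n)) (Iphi x)).
    by apply: eq_integrable => // s _ /=; rewrite /fn /diff_quot mulrC.
  have fng n s : `|fn n s| <= g s.
    rewrite /fn /diff_quot normrM normfV ler_pdivrMr ?normr_gt0 ?subr_eq0//.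
  have fnl s : D s -> fn n s @[n --> \oo] --> l s.
    move=> Ds; apply: (cvg_comp _ (diff_quot (phi ^~ s) x) _ (lD s Ds)).
    move=> A; rewrite /dnbhs /within/= => /cu [n _ hn]; exists n => // m nm.
    by apply: hn => //=; exact: ux.
  have mfn n : measurable_fun (D : set MR) (fn n).
    apply: measurable_funTS.
    by have /measurable_int/measurable_EFinP := Ifn n.
  have IgD : mu.-integrable D (EFin \o g) by exact: integrable_subT.
  have IlD : mu.-integrable D (EFin \o l).
    apply: (@integrable_bound R D l g) => //.
      by apply: (measurable_fun_cvg mfn) => s; exact: fnl.
    move=> s Ds; have cl : `|fn n s| @[n --> \oo] --> `|l s| by apply: cvg_norm; exact: fnl.
    rewrite -(cvg_lim _ cl)//; apply: limr_le; first by apply/cvg_ex; eexists; exact: cl.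
    exact: nearW.
  have -> : (fun n => diff_quot (fun y => \int[mu]_s phi y s) x (u n)) =
      (fun n => fine (\int[mu]_(s in D) (fn n s)%:E)).
    apply/funext => n; rewrite /diff_quot -RintegralB// mulrC -RintegralZl//; last first.
      exact: integrableRB.
    rewrite /Rintegral; congr fine.
    rewrite (@negligible_integral _ _ _ mu setT N) -/D//; last first.
      exact: (integrableRZ (u n - x)^-1 measurableT (integrableRB measurableT (Iphi (u n)) (Iphi x))).
    by apply: eq_integral => s _; rewrite /fn /diff_quot mulrC.
  apply: fine_cvg; rewrite fineK; last exact: integrable_fin_num.
  apply: (@dominated_cvg _ _ _ mu D mD (fun n => EFin \o fn n) (EFin \o l) (EFin \o g)) => //.
  - by move=> n; apply/measurable_EFinP; exact: mfn.
  - by move=> s Ds; apply: cvg_EFin; [exact: nearW|exact: fnl].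
  - by move=> n s Ds /=; rewrite lee_fin.
set G := diff_quot _ _; set L := (X in _ --> X).
apply: (@cvg_at_right_left_dnbhs R R^o G x L).
- by apply/cvg_at_rightP => u [ux cu]; apply: key => // n; rewrite gt_eqF.
- by apply/cvg_at_leftP => u [ux cu]; apply: key => // n; rewrite lt_eqF.
Qed.

End parametric_integrals.

(** * Primitives of complex-valued functions *)

Section complex_primitive.
Variable R : realType.
Local Notation mu := (@lebesgue_measure R).
Local Notation MR := (measurableTypeR R).
Local Notation Re := (@complex.Re R).
Local Notation Im := (@complex.Im R).
Implicit Types (f : R -> R[i]).

(** Starting at [-oo] avoids any orientation convention. The functions integrated are extended by
    zero, so the primitive vanishes for [b <= 0]; this is what removes negative arguments in
    [kJ]. *)
Definition cprim f (b : R) : R[i] := cint `]-oo, b] f.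

Lemma cprimB f (a b : R) : cintegrable setT f -> a <= b ->
  cprim f b - cprim f a = cint `]a, b] f.
Proof.
move=> [Ir Ii] ab; apply: complex_ext; rewrite ?ReB ?ImB/=;
  apply: Rintegral_itvB; rewrite ?bnd_simp//; exact: integrable_subT.
Qed.

Lemma integrable_itvoo_cst (a b c : R) :
  mu.-integrable setT (EFin \o (fun t => c * \1_(`]a, b[) t)).
Proof.
apply: integrableRZ => //.
have -> : EFin \o (\1_(`]a, b[) : R -> R) = (EFin \o cst 1) \_ `]a, b[.
  by apply/funext => t; rewrite /= patchE indicE; case: (t \in _).
apply/integrable_restrict => //; rewrite setTI.
apply: measurable_bounded_integrable => //; last exact: bounded_cst.
by have := lebesgue_measure_itv `]a, b[; rewrite /= => ->; case: ifP => _;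
  rewrite ?ltry// -EFinB ltry.
Qed.

Section bounded_support.
Variables (f : R -> R[i]) (m s : R).
Hypothesis s0 : 0 <= s.
Hypothesis mf : cmeas setT f.
Hypothesis fm : forall t, cabs (f t) <= m.
Hypothesis fs : forall t, ~~ (0 < t < s) -> f t = 0.

Let m0 : 0 <= m. Proof. exact: le_trans (cabs_ge0 _) (fm 0). Qed.

Let fm1 t : cabs (f t) <= m * \1_(`]0, s[) t.
Proof.
rewrite indicE; case: (boolP (0 < t < s)) => h.
  by rewrite mem_set ?mulr1//= in_itv.
rewrite memNset ?mulr0 ?fs ?cabs0//= in_itv/=; exact/negP.
Qed.

Lemma cintegrable_supp : cintegrable setT f.
Proof.
apply: (cintegrable_bound _ mf (fun x _ => fm1 x)) => //.
exact: integrable_itvoo_cst.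
Qed.

Let cprim_le (D : set R) (g : R -> R) : measurable D ->
  (forall t, D t -> cabs (f t) <= g t) -> mu.-integrable D (EFin \o g) ->
  cabs (cint D f) <= \int[mu]_(t in D) g t.
Proof.
move=> mD fg Ig; apply: le_cabs_cint_bound => //.
by split; apply: measurable_funTS; case: mf.
Qed.

Lemma cprim_lip (a b : R) : cabs (cprim f a - cprim f b) <= m * `|a - b|.
Proof.
wlog ab : a b / b <= a.
  move=> H; case: (leP b a) => [|/ltW]; first exact: H.
  by rewrite -cabsN opprB distrC; exact: H.
rewrite cprimB//; last exact: cintegrable_supp.
apply: le_trans (@cprim_le _ (fun=> m) _ _ _) _ => //.
  apply: measurable_bounded_integrable => //; last exact: bounded_cst.
  by have := lebesgue_measure_itv `]b, a]; rewrite /= => ->; case: ifP => _;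
    rewrite ?ltry// -EFinB ltry.
by rewrite Rintegral_cst_oc// ger0_norm// subr_ge0.
Qed.

(** Every increment is bounded by the total mass, whatever the distance of [a] and [b]; [kJ_size]
    relies on this instead of the Lipschitz bound. *)
Lemma cprim_supp_le (a b : R) : cabs (cprim f a - cprim f b) <= m * s.
Proof.
wlog ab : a b / b <= a.
  move=> H; case: (leP b a) => [|/ltW]; first exact: H.
  by rewrite -cabsN opprB; exact: H.
rewrite cprimB//; last exact: cintegrable_supp.
apply: le_trans (@cprim_le _ (fun t => m * \1_(`]0, s[) t) _ _ _) _ => //.
  by apply: integrable_subT => //; exact: integrable_itvoo_cst.
apply: (@le_trans _ _ (\int[mu]_t (m * \1_(`]0, s[) t))).
  rewrite [leLHS]Rintegral_mkcond; apply: le_Rintegral => //.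
  - have -> : EFin \o ((fun t => m * \1_(`]0, s[) t) \_ `]b, a]) = (EFin \o (fun t => m * \1_(`]0, s[) t)) \_ `]b, a].
      by rewrite restrict_EFin.
    by apply/integrable_restrict => //; rewrite setTI; apply: integrable_subT => //; exact: integrable_itvoo_cst.
  - exact: integrable_itvoo_cst.
  - by move=> t _; rewrite patchE; case: ifP => // _; rewrite mulr_ge0.
rewrite RintegralZl//; last first.
  have := integrable_itvoo_cst 0 s 1; apply: eq_integrable => // t _ /=.
  by rewrite mul1r.
rewrite ler_wpM2l// /Rintegral integral_indic// setIT.
have := lebesgue_measure_itv `]0, s[; rewrite /= => ->.
by case: ifP => _ //=; rewrite ?subr0 ?oppr0 ?addr0.
Qed.

Lemma cprim_le0 (b : R) : b <= 0 -> cprim f b = 0.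
Proof.
move=> b0; rewrite /cprim (@eq_cint _ _ _ (fun=> 0)).
  by congr (_ +i* _); rewrite /= Rintegral_cst// mul0r.
move=> t /=; rewrite in_itv/= => tb; apply: fs; rewrite negb_and -leNgt.
by rewrite (le_trans tb b0).
Qed.

Lemma cprim_max_le (b : R) : cabs (cprim f b) <= m * Num.max b 0.
Proof.
have [b0|b0] := leP b 0; first by rewrite cprim_le0// cabs0 mulr0.
have := cprim_lip b 0; rewrite (cprim_le0 (lexx 0)) !subr0.
by rewrite gtr0_norm.
Qed.

Lemma cprim_derivable (b : R) :
  {for b, continuous (Re \o f)} -> {for b, continuous (Im \o f)} ->
  derivable (Re \o cprim f) b 1 /\ derivable (Im \o cprim f) b 1.
Proof.
have [Ir Ii] := cintegrable_supp.
have bb : b < b + 1 by rewrite ltrDl.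
move=> cr ci; split.
- by have [] := @continuous_FTC1 R (Re \o f) -oo%O b _ bb (integrable_subT (measurable_itv _) Ir) (ltNyr _) cr.
- by have [] := @continuous_FTC1 R (Im \o f) -oo%O b _ bb (integrable_subT (measurable_itv _) Ii) (ltNyr _) ci.
Qed.

End bounded_support.

Lemma measurable_fun_ite (d : measure_display) (T : measurableType d) (a b f : T -> R) :
  measurable_fun setT a -> measurable_fun setT b -> measurable_fun setT f ->
  measurable_fun setT (fun x => if a x <= b x then f x else 0).
Proof.
move=> ma mb mf; apply: measurable_fun_ifT => //.
exact: measurable_fun_ler.
Qed.

(** The moving end of the range becomes a condition in the integrand, which reduces measurability in
    a parameter to [measurable_Rintegral_param]. *)
Lemma cprimE_if f (b : R) :
  cprim f b = (\int[mu]_t (if t <= b then Re (f t) else 0)) +i*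
              (\int[mu]_t (if t <= b then Im (f t) else 0)).
Proof.
rewrite /cprim /cint; congr (_ +i* _); rewrite Rintegral_mkcond;
  apply: eq_Rintegral => t _; rewrite patchE;
  rewrite (_ : (t \in _) = (t <= b))//; by rewrite mem_setE in_itv.
Qed.

Lemma measurable_cprim (F : R -> R -> R[i]) (d : measure_display) (T : measurableType d)
    (sg b : T -> R) :
  measurable_fun setT (fun z : MR * MR => Re (F z.1 z.2)) ->
  measurable_fun setT (fun z : MR * MR => Im (F z.1 z.2)) ->
  measurable_fun setT sg -> measurable_fun setT b ->
  measurable_fun setT (fun x => Re (cprim (F (sg x)) (b x))) /\
  measurable_fun setT (fun x => Im (cprim (F (sg x)) (b x))).
Proof.
move=> mr mi msg mb.
have mp : measurable_fun setT (fun z : T * MR => (sg z.1, z.2) : MR * MR).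
  apply: measurable_fun_pair => //.
  exact: (measurableT_comp msg measurable_fst).
split; under eq_fun do rewrite cprimE_if/=.
- apply: (@measurable_Rintegral_param R _ _ (fun z => if z.2 <= b z.1 then Re (F (sg z.1) z.2) else 0)).
  apply: measurable_fun_ite => //; first exact: (measurableT_comp mb measurable_fst).
  exact: (measurableT_comp mr mp).
- apply: (@measurable_Rintegral_param R _ _ (fun z => if z.2 <= b z.1 then Im (F (sg z.1) z.2) else 0)).
  apply: measurable_fun_ite => //; first exact: (measurableT_comp mb measurable_fst).
  exact: (measurableT_comp mi mp).
Qed.

End complex_primitive.

(** * Uniqueness of trigonometric moments *)

Section trigonometric_uniqueness.
Variable R : realType.
Local Notation mu := (@lebesgue_measure R).
Local Notation MR := (measurableTypeR R).
Variable x : R.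
Hypothesis x0 : 0 < x.
Local Notation D := (`]0, x[%classic : set R).

Let muDlty : (mu `]0%R, x[%classic < +oo)%E.
Proof.
by have := lebesgue_measure_itv `]0, x[; rewrite /= lte_fin x0 => ->; rewrite -EFinB ltry.
Qed.

Lemma Rintegral_cst_oo (C : R) : \int[mu]_(t in D) C = C * x.
Proof.
rewrite Rintegral_cst//; congr (_ * _).
by have := lebesgue_measure_itv `]0, x[; rewrite /= lte_fin x0 => ->; rewrite /= subr0.
Qed.

Lemma integrable_bounded_itv (f : R -> R) (C : R) : measurable_fun D f ->
  (forall t, D t -> `|f t| <= C) -> mu.-integrable D (EFin \o f).
Proof.
move=> mf fC; apply: measurable_bounded_integrable => //.
exists C; split; first exact: num_real.
by move=> y Cy t Dt; exact: le_trans (fC _ Dt) (ltW Cy).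
Qed.

Section peak.
Variables (G c : R -> R) (M : R).
Hypothesis mG : measurable_fun D G.
Hypothesis GM : forall t, D t -> `|G t| <= M.
Hypothesis cc : continuous c.
Hypothesis c1 : forall t, `|c t| <= 1.
Hypothesis cdecr : forall s t, 0 <= s -> s < t -> t <= x -> c t < c s.
Hypothesis Gc0 : forall n, \int[mu]_(t in D) (G t * c t ^+ n) = 0.

Let mc : measurable_fun D c.
Proof. by apply: measurable_funTS; exact: continuous_measurable_fun. Qed.

Let M0 : 0 <= M.
Proof.
have h : D (x / 2) by rewrite /= in_itv/= divr_gt0//= ltr_pdivrMr// ltr_pMr// ltr1n.
exact: le_trans (normr_ge0 _) (GM h).
Qed.

Variable t0 : R.
Hypothesis Dt0 : 0 < t0 < x.

(** The divisor 4 keeps [p] in [[0, 1]], as [c] is bounded by 1. Since [c] is strictly decreasing on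
    [[0, x]], the value 1 is taken there at [t0] only. *)
Let p t := 1 - (c t - c t0) ^+ 2 / 4.

Let p01 t : 0 <= p t <= 1.
Proof.
have : `|c t - c t0| <= 2.
  by apply: le_trans (ler_normB _ _) _; have := c1 t; have := c1 t0; lra.
rewrite /p -(real_normK (num_real (c t - c t0))).
have := normr_ge0 (c t - c t0); set u := `|_|; move=> u0 u2.
have : 0 <= u ^+ 2 <= 4 by rewrite sqr_ge0/= expr2; nra.
lra.
Qed.

Let cp : continuous p.
Proof.
move=> t; rewrite /p; apply: cvgB; first exact: cvg_cst.
apply: cvgM; last exact: cvg_cst.
by rewrite /= expr2; under eq_fun do rewrite expr2; apply: cvgM; apply: cvgB;
  try exact: cc; exact: cvg_cst.
Qed.

Let mp : measurable_fun D p.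
Proof. by apply: measurable_funTS; exact: continuous_measurable_fun. Qed.

Let IGcp k n : mu.-integrable D (EFin \o (fun t => G t * c t ^+ k * p t ^+ n)).
Proof.
apply: (@integrable_bounded_itv _ M).
  by apply: measurable_funM; [apply: measurable_funM => //|]; apply: measurable_funX.
move=> t Dt; rewrite !normrM -[leRHS]mulr1 -[M]mulr1 !normrX.
apply: ler_pM.
- by rewrite mulr_ge0// exprn_ge0.
- by rewrite exprn_ge0.
- apply: ler_pM; [by [] | by rewrite exprn_ge0 | exact: GM | exact: exprn_ile1].
have /andP[? ?] := p01 t.
by apply: exprn_ile1; rewrite ?ger0_norm.
Qed.

(** One factor [p] is a quadratic polynomial in [c]: raising [n] by one raises the exponent of [c]
    by at most two, hence an induction for all [k] at once. *)
Let Gcp0 n k : \int[mu]_(t in D) (G t * c t ^+ k * p t ^+ n) = 0.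
Proof.
elim: n k => [|n IH] k.
  by rewrite -[RHS](Gc0 k); apply: eq_Rintegral => t _; rewrite expr0 mulr1.
transitivity (\int[mu]_(t in D) ((1 - c t0 ^+ 2 / 4) * (G t * c t ^+ k * p t ^+ n)
  + (c t0 / 2 * (G t * c t ^+ k.+1 * p t ^+ n) + (- 1 / 4) * (G t * c t ^+ k.+2 * p t ^+ n)))).
  apply: eq_Rintegral => t _; rewrite [p t ^+ n.+1]exprS.
  have -> : p t * p t ^+ n =
      (1 - c t0 ^+ 2 / 4 + c t0 / 2 * c t - c t ^+ 2 / 4) * p t ^+ n.
    by congr (_ * _); rewrite /p; field.
  by rewrite !exprS; field.
rewrite RintegralD//; last 2 first.
- exact: (@integrableRZ R _ D _ _ (IGcp k n)).
- apply: integrableRD => //; exact: (@integrableRZ R _ D).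
rewrite RintegralD//; try exact: (@integrableRZ R _ D).
rewrite !RintegralZl//; rewrite !IH; ring.
Qed.

(* The weights [p ^+ n] are polynomials in [c] that peak at [t0], so the vanishing moments of [G]
   localize there. *)
Lemma peak_le0 : {for t0, continuous G} -> G t0 <= 0.
Proof.
move=> cG; rewrite leNgt; apply/negP => G0.
pose k := G t0 / 2.
have k0 : 0 < k by rewrite divr_gt0.
have [t00 t0x] := andP Dt0.
have [e e0 He] : exists2 e : R, 0 < e & forall t, `|t - t0| < e -> D t /\ k <= G t.
  have : \forall t \near t0, D t /\ k <= G t.
    apply: filterI.
      apply: open_nbhs_nbhs; split; last by rewrite /= in_itv/=.
      exact: (@interval_open R (BRight 0) (BLeft x)).
    move/cvgrPdist_lt : cG => /(_ _ k0); apply: filterS => t.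
    rewrite ltr_norml /k; lra.
  move=> /nbhs_ballP[e /= e0 He]; exists e => // t te; apply: He.
  by rewrite /ball/= distrC.
pose e1 := e / 2.
have e10 : 0 < e1 by rewrite divr_gt0.
have e1e : e1 < e by rewrite /e1; lra.
have [Dl _] : D (t0 - e1) /\ k <= G (t0 - e1).
  by apply: He; rewrite addrAC subrr add0r normrN gtr0_norm.
have [Dr _] : D (t0 + e1) /\ k <= G (t0 + e1).
  by apply: He; rewrite addrAC subrr add0r gtr0_norm.
move: Dl Dr; rewrite /= !in_itv/= => /andP[l1 l2] /andP[r1 r2].
have cl : c t0 < c (t0 - e1) by apply: cdecr; lra.
have cr : c (t0 + e1) < c t0 by apply: cdecr; lra.
(* By monotonicity of [c], at distance at least [e1] from [t0] the loss [1 - p] is no less than its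
   value [dl] or [dr] at the point at distance [e1] on the same side; [b] is the smaller of these
   two. *)
pose dl := (c (t0 - e1) - c t0) ^+ 2 / 4.
pose dr := (c t0 - c (t0 + e1)) ^+ 2 / 4.
pose b := Num.min dl dr.
have b0 : 0 < b by rewrite lt_min !divr_gt0 ?exprn_gt0 ?subr_gt0.
have b1 : b <= 1.
  apply: (@le_trans _ _ dl); first by rewrite ge_min lexx.
  by have := p01 (t0 - e1); rewrite /p /dl; lra.
have pout t : D t -> e1 <= `|t - t0| -> p t <= 1 - b.
  rewrite /= in_itv/= => /andP[t_0 tx]; case: (ltP t t0) => tt0.
    rewrite ltr0_norm ?subr_lt0// => te.
    have ct : c (t0 - e1) <= c t.
      have [->//|tne] := eqVneq t (t0 - e1).
      by apply/ltW/cdecr; rewrite ?lt_neqAle ?tne/=; lra.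
    have : dl <= (c t - c t0) ^+ 2 / 4.
      by rewrite ler_pM2r// ler_sqr ?nnegrE; lra.
    have : b <= dl by rewrite ge_min lexx.
    by rewrite /p; lra.
  rewrite ger0_norm ?subr_ge0// => te.
  have ct : c t <= c (t0 + e1).
    have [->//|tne] := eqVneq t (t0 + e1).
    by apply/ltW/cdecr; rewrite ?lt_neqAle 1?eq_sym ?tne/=; lra.
  have : dr <= (c t - c t0) ^+ 2 / 4.
    by rewrite ler_pM2r// -[leRHS]sqrrN opprB ler_sqr ?nnegrE; lra.
  have : b <= dr by rewrite ge_min lexx orbT.
  by rewrite /p; lra.
have pt0 : p t0 = 1 by rewrite /p subrr expr0n mul0r subr0.
(* Within [e2] of [t0] at most half of the loss [b] occurs, so [(1 - b / 2) ^ n] eventually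
   outweighs [(1 - b) ^ n]. *)
have [e2 e20 [e21 He2]] : exists2 e2 : R, 0 < e2 & e2 <= e1 /\ forall t, `|t - t0| < e2 -> 1 - b / 2 <= p t.
  have : {for t0, continuous p} by exact: cp.
  move/cvgrPdist_lt => /(_ _ (divr_gt0 b0 (ltr0Sn R 1))).
  move=> /nbhs_ballP[e' /= e'0 He']; exists (Num.min e' e1).
    by rewrite lt_min e'0.
  split; first by rewrite ge_min lexx orbT.
  move=> t; rewrite lt_min => /andP[te _]; have := He' t.
  by rewrite /ball/= distrC => /(_ te); rewrite pt0 ltr_norml; lra.
pose E := (`](t0 - e2), (t0 + e2)[%classic : set R).
have ED : E `<=` D.
  by move=> t; rewrite /E /= !in_itv/= => /andP[h1 h2]; apply/andP; split; lra.
(* Three zones: on [E] the integrand is at least [k * (1 - b / 2) ^ n]; outside [E] but within [e]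
   of [t0] it is nonnegative; farther away it is at least [- M * (1 - b) ^ n]. The total is zero. *)
have ineq n : k * (1 - b / 2) ^+ n * (2 * e2) <= M * (1 - b) ^+ n * x.
  have IE : mu.-integrable D (EFin \o (\1_E : R -> R)).
    apply: (@integrable_bounded_itv _ 1); first by apply: measurable_indic; exact: measurable_itv.
    by move=> t _; rewrite indicE; case: (_ \in _); rewrite ?normr1 ?normr0.
  have Icst : mu.-integrable D (EFin \o (fun=> M * (1 - b) ^+ n)).
    by apply: (@integrable_bounded_itv _ `|M * (1 - b) ^+ n|).
  have : \int[mu]_(t in D) (k * (1 - b / 2) ^+ n * \1_E t - M * (1 - b) ^+ n) <=
         \int[mu]_(t in D) (G t * c t ^+ 0 * p t ^+ n).
    apply: le_Rintegral => //.
    - by apply: (@integrableRB R D) => //; exact: (@integrableRZ R _ D).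
    - move=> t Dt; rewrite expr0 mulr1; have /andP[p0 p1] := p01 t.
      have Mb : 0 <= M * (1 - b) ^+ n by rewrite mulr_ge0// exprn_ge0// subr_ge0.
      rewrite indicE; case: (boolP (t \in E)) => [|tE].
        rewrite inE /E/= in_itv/= => tE.
        have te2 : `|t - t0| < e2 by rewrite ltr_norml; lra.
        rewrite mulr1; apply: (@le_trans _ _ (k * (1 - b / 2) ^+ n)); first by rewrite gerBl.
        apply: ler_pM; [exact: ltW|apply: exprn_ge0; lra| |].
          by have [] := He t; [lra|].
        by apply: lerXn2r; rewrite ?nnegrE; [lra| |exact: He2].
      rewrite mulr0 add0r.
      have [te|te] := ltP `|t - t0| e.
        have [_ kG] := He t te.
        apply: (@le_trans _ _ 0); first by rewrite oppr_le0.
        by rewrite mulr_ge0 ?exprn_ge0//; lra.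
      have pb := pout t Dt (le_trans (ltW e1e) te).
      rewrite lerNl; apply: (@le_trans _ _ (`|G t * p t ^+ n|)).
        by rewrite -normrN; exact: ler_norm.
      rewrite normrM (ger0_norm (exprn_ge0 _ _))//; apply: ler_pM => //.
      - exact: exprn_ge0.
      - exact: GM.
      - by apply: lerXn2r; rewrite ?nnegrE//; lra.
  rewrite Gcp0 RintegralB//; last exact: (@integrableRZ R _ D).
  rewrite RintegralZl// Rintegral_cst_oo subr_le0.
  have -> : \int[mu]_(t in D) \1_E t = 2 * e2.
    rewrite /Rintegral integral_indic//; last exact: measurable_itv.
    have -> : E `&` D = E by exact: setIidl.
    have := lebesgue_measure_itv `](t0 - e2), (t0 + e2)[; rewrite /= lte_fin => ->.
    have -> : t0 - e2 < t0 + e2 by lra.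
    by rewrite -EFinB/=; ring.
  by [].
have b12 : 0 < 1 - b / 2 by lra.
pose r := (1 - b) / (1 - b / 2).
have r01 : `|r| < 1.
  by rewrite ger0_norm ?divr_ge0 ?ltr_pdivrMr; lra.
have M1 : 0 < M * x + 1 by rewrite ltr_wpDl// mulr_ge0// ltW.
have e3 : 0 < k * (2 * e2) / (M * x + 1) by rewrite divr_gt0// !mulr_gt0.
have /cvgrPdist_lt /(_ _ e3) [n _ /(_ n (leqnn n))] := cvg_expr r01.
rewrite /= sub0r normrN normrX ger0_norm; last by rewrite divr_ge0; lra.
rewrite expr_div_n ltr_pdivrMr ?exprn_gt0// mulrAC ltr_pdivlMr//.
have := ineq n.
have : 0 <= (1 - b) ^+ n by rewrite exprn_ge0// subr_ge0.
have : 0 < (1 - b / 2) ^+ n by rewrite exprn_gt0.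
move: ((1 - b) ^+ n) ((1 - b / 2) ^+ n) => A B; nra.
Qed.
End peak.

(** Multiplication by [cos (w * t)] shifts the frequency of [psi] by [w] and [- w], so the moments
    against all [psi r] give those against [psi r * c ^ n]. With [w = pi / x] the cosine is strictly
    decreasing on [[0, x]], and [peak_le0] applies to [g * psi r0] and to its opposite. Only real
    frequencies occur, and one proof serves both sines and cosines. *)
Lemma trig_unique (g : R -> R) (M : R) (psi : R -> R -> R) (r0 : R) :
  measurable_fun D g -> (forall t, D t -> `|g t| <= M) ->
  (forall t, 0 < t < x -> {for t, continuous g}) ->
  (forall r, continuous (psi r)) -> (forall r t, `|psi r t| <= 1) ->
  (forall r w t, psi r t * cos (w * t) = (psi (r + w) t + psi (r - w) t) / 2) ->
  (forall t, 0 < t < x -> 0 < psi r0 t) ->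
  (forall r, \int[mu]_(t in D) (g t * psi r t) = 0) ->
  forall t, 0 < t < x -> g t = 0.
Proof.
move=> mg gM cg cpsi psi1 psiM psi0 gpsi.
pose w := pi / x; pose c t := cos (w * t).
have w0 : 0 < w by rewrite divr_gt0// pi_gt0.
have cc : continuous c.
  move=> t; apply: continuous_comp; last exact: continuous_cos.
  by apply: cvgM; [exact: cvg_cst|exact: cvg_id].
have mc : measurable_fun D c by apply: measurable_funTS; exact: continuous_measurable_fun.
have mpsi r : measurable_fun D (psi r) by apply: measurable_funTS; exact: continuous_measurable_fun.
have c1 t : `|c t| <= 1 by exact: cos_max.
have cdecr s t : 0 <= s -> s < t -> t <= x -> c t < c s.
  move=> s0 st tx; have wx : w * x = pi by rewrite /w mulfVK ?gt_eqF.
  have win u : 0 <= u -> u <= x -> w * u \in `[0, pi].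
    by move=> u0 ux; rewrite in_itv/= mulr_ge0 ?(ltW w0)//= -wx ler_pM2l.
  have wt : w * t \in `[0, pi] by apply: win => //; exact: le_trans s0 (ltW st).
  have ws : w * s \in `[0, pi] by apply: win => //; exact: le_trans (ltW st) tx.
  by rewrite /c ltr_cos ?ltr_pM2l.
have I0 n r : mu.-integrable D (EFin \o (fun t => g t * psi r t * c t ^+ n)).
  apply: (@integrable_bounded_itv _ M).
    apply: measurable_funM; [apply: measurable_funM; [exact: mg|exact: mpsi]|].
    by apply: measurable_funX.
  move=> t Dt; rewrite !normrM -[leRHS]mulr1 -[M]mulr1 normrX.
  apply: ler_pM; [by rewrite mulr_ge0|by rewrite exprn_ge0| |exact: exprn_ile1].
  by apply: ler_pM => //; exact: gM.
have g0 n r : \int[mu]_(t in D) (g t * psi r t * c t ^+ n) = 0.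
  elim: n r => [|n IH] r.
    by rewrite -[RHS](gpsi r); apply: eq_Rintegral => t _; rewrite expr0 mulr1.
  transitivity (\int[mu]_(t in D) (2^-1 * (g t * psi (r + w) t * c t ^+ n) +
     2^-1 * (g t * psi (r - w) t * c t ^+ n))).
    apply: eq_Rintegral => t _; rewrite exprS mulrA -(mulrA (g t)) /c psiM; ring.
  rewrite RintegralD//; try exact: (@integrableRZ R _ D).
  by rewrite !RintegralZl// !IH !mulr0 addr0.
move=> t0 Dt0.
have mGpsi : measurable_fun D (fun t => g t * psi r0 t) by apply: measurable_funM; [exact: mg|exact: mpsi].
have bG (t : R) : D t -> `|g t * psi r0 t| <= M.
  by move=> Dt; rewrite normrM -[leRHS]mulr1; apply: ler_pM => //; exact: gM.
have cG : {for t0, continuous (fun t => g t * psi r0 t)}.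
  by apply: cvgM; [exact: cg|exact: cpsi].
have le1 : g t0 * psi r0 t0 <= 0.
  by apply: (@peak_le0 (fun t => g t * psi r0 t) c M).
have le2 : - (g t0 * psi r0 t0) <= 0.
  apply: (@peak_le0 (fun t => - (g t * psi r0 t)) c M) => //.
  - exact: (measurable_funN mGpsi).
  - by move=> t Dt; rewrite normrN; exact: bG.
  - move=> n; transitivity (-1 * \int[mu]_(t in D) (g t * psi r0 t * c t ^+ n)).
      rewrite -RintegralZl//.
      by apply: eq_Rintegral => t _; rewrite mulN1r mulNr.
    by rewrite g0 mulr0.
  - by apply: cvgN.
have /eqP : g t0 * psi r0 t0 = 0 by apply/eqP; rewrite eq_le le1 -oppr_le0.
by rewrite mulf_eq0 (gt_eqF (psi0 _ Dt0)) orbF => /eqP.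
Qed.
End trigonometric_uniqueness.

(** * Variation of constants *)

Section ac_calculus.
Variable R : realType.
Local Notation mu := (@lebesgue_measure R).
Implicit Types (f g : R -> R).

Lemma cvg_within_interior (A : set R) (x l : R) f : nbhs x A ->
  f y @[y --> within A x^'] --> l -> f y @[y --> x^'] --> l.
Proof.
move=> xA cf; apply: cvg_trans cf => P /=; rewrite /fmap/= /within/= => H.
have xA' : x^' A by apply: filterS xA => y Ay _.
by apply: filterS2 xA' H => y Ay h; exact: h.
Qed.

Lemma nbhs_itvcc (a b x : R) : a < x < b -> nbhs x (`[a, b]%classic : set R).
Proof.
move=> axb; apply: (@filterS _ _ _ `]a, b[%classic); first exact: subset_itv_oo_cc.
by apply: open_nbhs_nbhs; split; [exact: interval_open|rewrite /= in_itv].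
Qed.

(** Near its tag the difference quotient is within 1 of the derivative, and [cousin] adds up the
    local bounds. The slack 1 is harmless, since the result only feeds [ac_fun_lipschitz]. *)
Lemma lipschitz_within_derive (a b M : R) f f' : a <= b ->
  (forall x, a <= x <= b -> diff_quot f x y @[y --> within `[a, b] x^'] --> f' x) ->
  (forall x, a <= x <= b -> `|f' x| <= M) ->
  forall u v, a <= u -> u <= v -> v <= b -> `|f v - f u| <= (M + 1) * (v - u).
Proof.
move=> ab df f'M u v au uv vb.
apply: (@cousin R (fun u v => `|f v - f u| <= (M + 1) * (v - u)) u v uv).
  move=> p m r up pm mr rv h1 h2.
  have -> : f r - f p = (f r - f m) + (f m - f p) by ring.
  apply: le_trans (ler_normD _ _) _; lra.
move=> x /andP[ux xv].
have axb : a <= x <= b by rewrite (le_trans au ux) (le_trans xv vb).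
have := df x axb => /cvgrPdist_lt /(_ 1 ltr01); rewrite near_withinE near_withinE.
move=> /nbhs_ballP[d /= d0 Hd].
have fx y : a <= y <= b -> `|y - x| < d -> `|f y - f x| <= (M + 1) * `|y - x|.
  move=> ayb yxd; have [->|yx] := eqVneq y x; first by rewrite !subrr normr0 mulr0.
  have := Hd y; rewrite /ball/= distrC => /(_ yxd yx).
  rewrite in_itv/= => /(_ ayb) h.
  have : `|diff_quot f x y| <= M + 1.
    have -> : diff_quot f x y = f' x - (f' x - diff_quot f x y) by ring.
    by apply: le_trans (ler_normB _ _) _; apply: lerD; [exact: f'M|exact: ltW].
  by rewrite /diff_quot normrM normfV ler_pdivrMr// normr_gt0 subr_eq0.
exists d => // p r up px xr rv prd.
have -> : f r - f p = (f r - f x) - (f p - f x) by ring.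
apply: le_trans (ler_normB _ _) _.
have h1 : `|f r - f x| <= (M + 1) * `|r - x|.
  apply: fx; first by rewrite (le_trans _ xr) ?(le_trans au ux)//= (le_trans rv vb).
  rewrite ger0_norm; lra.
have h2 : `|f p - f x| <= (M + 1) * `|p - x|.
  apply: fx; first by rewrite (le_trans au up)/= (le_trans px)// (le_trans xv vb).
  rewrite ler0_norm; lra.
move: h1 h2; rewrite (ger0_norm (_ : 0 <= r - x)) ?subr_ge0//.
by rewrite (ler0_norm (_ : p - x <= 0)) ?subr_le0//; lra.
Qed.

Lemma ac_fun_lipschitz (a b L : R) f :
  (forall u v, a <= u -> u <= v -> v <= b -> `|f v - f u| <= L * (v - u)) ->
  ac_fun a b f.
Proof.
move=> fL e e0; pose L' := `|L| + 1.
have L'0 : 0 < L' by rewrite ltr_wpDl.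
exists (e / L'); first by rewrite divr_gt0.
move=> n u v uv _; rewrite ltr_pdivlMr// => S.
apply: le_lt_trans S; rewrite mulr_suml; apply: ler_sum => i _.
have [au [uvi vb]] := uv i.
apply: le_trans (fL _ _ au uvi vb) _; rewrite mulrC ler_wpM2l ?subr_ge0//.
by apply: le_trans (ler_norm _) _; rewrite lerDl.
Qed.

Lemma ac_funD (a b : R) f g : ac_fun a b f -> ac_fun a b g ->
  ac_fun a b (fun x => f x + g x).
Proof.
move=> acf acg e e0; have e20 : 0 < e / 2 by rewrite divr_gt0.
have [d1 d10 H1] := acf _ e20; have [d2 d20 H2] := acg _ e20.
exists (Num.min d1 d2); first by rewrite lt_min d10.
move=> n u v uv tr; rewrite lt_min => /andP[S1 S2].
have := H1 n u v uv tr S1; have := H2 n u v uv tr S2.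
have : \sum_(i < n) `|f (v i) + g (v i) - (f (u i) + g (u i))| <=
   \sum_(i < n) `|f (v i) - f (u i)| + \sum_(i < n) `|g (v i) - g (u i)|.
  rewrite -big_split/=; apply: ler_sum => i _.
  have -> : f (v i) + g (v i) - (f (u i) + g (u i)) =
    (f (v i) - f (u i)) + (g (v i) - g (u i)) by ring.
  exact: ler_normD.
lra.
Qed.

Lemma ac_funM (a b Bf Bg : R) f g : ac_fun a b f -> ac_fun a b g ->
  (forall x, a <= x <= b -> `|f x| <= Bf) -> (forall x, a <= x <= b -> `|g x| <= Bg) ->
  ac_fun a b (fun x => f x * g x).
Proof.
move=> acf acg fB gB e e0.
pose B := `|Bf| + `|Bg| + 1.
have B0 : 0 < B by rewrite ltr_wpDl ?addr_ge0.
have e20 : 0 < e / 2 / B by rewrite !divr_gt0.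
have [d1 d10 H1] := acf _ e20; have [d2 d20 H2] := acg _ e20.
exists (Num.min d1 d2); first by rewrite lt_min d10.
move=> n u v uv tr; rewrite lt_min => /andP[S1 S2].
have := H1 n u v uv tr S1; have := H2 n u v uv tr S2.
rewrite !ltr_pdivlMr//.
have : \sum_(i < n) `|f (v i) * g (v i) - (f (u i) * g (u i))| <=
   (\sum_(i < n) `|f (v i) - f (u i)|) * B + (\sum_(i < n) `|g (v i) - g (u i)|) * B.
  rewrite !mulr_suml -big_split/=; apply: ler_sum => i _.
  have [au [uvi vb]] := uv i.
  have -> : f (v i) * g (v i) - (f (u i) * g (u i)) =
    (f (v i) - f (u i)) * g (v i) + (g (v i) - g (u i)) * f (u i) by ring.
  apply: le_trans (ler_normD _ _) _; rewrite !normrM; apply: lerD; apply: ler_wpM2l => //.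
  - apply: le_trans (gB _ _) _; first by rewrite (le_trans au uvi).
    by apply: le_trans (ler_norm _) _; rewrite /B -addrA addrCA lerDl addr_ge0.
  - apply: le_trans (fB _ _) _; first by rewrite au (le_trans uvi vb).
    by apply: le_trans (ler_norm _) _; rewrite /B -addrA lerDl addr_ge0.
lra.
Qed.

Lemma ac_fun_sub (a b a' b' : R) f : a <= a' -> b' <= b -> ac_fun a b f -> ac_fun a' b' f.
Proof.
move=> aa bb acf e /acf[d d0 H]; exists d => // n u v uv; apply: H => i.
have [au [uvi vb]] := uv i; split; first exact: le_trans au.
by split => //; exact: le_trans bb.
Qed.

Lemma ac_fun_near (a b : R) f : ac_fun a b f -> forall e, 0 < e -> exists2 d, 0 < d &
  forall u v, a <= u -> u <= v -> v <= b -> v - u < d -> `|f v - f u| < e.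
Proof.
move=> acf e /acf[d d0 H]; exists d => // u v au uv vb uvd.
have := H 1%N (fun=> u) (fun=> v); rewrite !big_ord_recl !big_ord0 !addr0; apply => //.
by move=> i j _ _ _; rewrite !ord1.
Qed.

Lemma ac_fun_bounded (a b : R) f : a <= b -> ac_fun a b f ->
  exists B, forall x, a <= x <= b -> `|f x| <= B.
Proof.
move=> ab acf.
apply: (@cousin R (fun u v => exists B, forall x, u <= x <= v -> `|f x| <= B) a b ab).
  move=> u m v au um mv vb [B1 H1] [B2 H2]; exists (Num.max B1 B2) => x /andP[ux xv].
  have [xm|/ltW mx] := leP x m.
    by rewrite le_max H1// ux.
  by rewrite le_max H2 ?orbT// mx.
move=> x /andP[ax xb]; have [d d0 H] := ac_fun_near acf ltr01.
exists d => // u v au ux xv vb uvd; exists (`|f x| + 1) => y /andP[uy yv].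
have -> : f y = f x + (f y - f x) by ring.
apply: le_trans (ler_normD _ _) _; rewrite lerD2l; apply/ltW.
have [xy|/ltW yx] := leP x y.
  by apply: H => //; [exact: le_trans yv vb|lra].
by rewrite distrC; apply: H => //; [exact: le_trans au uy|lra].
Qed.

End ac_calculus.

Section variation_of_constants.
Variable R : realType.
Local Notation mu := (@lebesgue_measure R).

(** The real counterpart of [csin_div]. Together with [cos (r * t)] it is the fundamental system of
    [v'' = - r ^ 2 v], including [r = 0]. *)
Definition sn (r t : R) : R := if r == 0 then t else sin (r * t) / r.

Lemma sn0 r : sn r 0 = 0.
Proof. by rewrite /sn; case: ifP => // _; rewrite mulr0 sin0 mul0r. Qed.

Lemma is_derive_mull (r t : R) : is_derive t 1 (fun s : R => r * s) r.
Proof.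
have := @is_deriveZ R R^o R^o id r t 1 1 (is_derive_id _ _).
by rewrite -[X in is_derive _ _ _ X]/(r * 1) mulr1.
Qed.

Lemma is_derive_scale (k df t : R) (f : R -> R) : is_derive t 1 f df ->
  is_derive t 1 (fun s => k * f s) (k * df).
Proof. by move=> fd; exact: (@is_deriveZ R R^o R^o f k t 1 df fd). Qed.

Lemma is_derive_cosr (r t : R) : is_derive t 1 (fun s => cos (r * s)) (- (r ^+ 2 * sn r t)).
Proof.
have h := @is_derive1_comp R cos (fun s => r * s) t _ _ (is_derive_cos _) (is_derive_mull r t).
apply: is_derive_eq; rewrite /sn mulNr; congr (- _); case: eqVneq => [->|r0].
  by rewrite mulr0 expr0n mul0r.
by field.
Qed.

Lemma is_derive_sn (r t : R) : is_derive t 1 (sn r) (cos (r * t)).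
Proof.
rewrite /sn; case: eqVneq => [->|r0].
  by rewrite mul0r cos0; exact: is_derive_id.
have h := @is_derive1_comp R sin (fun s => r * s) t _ _ (is_derive_sin _) (is_derive_mull r t).
have := is_derive_scale r^-1 h.
have -> : (fun s => r^-1 * (sin \o (fun s => r * s)) s) = (fun t => sin (r * t) / r).
  by apply/funext => s /=; rewrite mulrC.
by move=> h'; apply: is_derive_eq; field.
Qed.

Lemma is_derive_refl (x t df : R) (f : R -> R) : is_derive (x - t) 1 f df ->
  is_derive t 1 (fun s => f (x - s)) (- df).
Proof.
move=> fd.
have h : is_derive t 1 (fun s : R => x - s) (-1).
  have := @is_deriveB R R^o R^o (cst x) id t 1 0 1 (is_derive_cst _ _ _) (is_derive_id _ _).
  by rewrite sub0r.
have := @is_derive1_comp R f (fun s => x - s) t _ _ fd h.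
by rewrite mulrN1.
Qed.

Lemma ac_fun_derive (a b M : R) (f f' : R -> R) : a <= b ->
  (forall x : R, is_derive x 1 f (f' x)) -> (forall x, a <= x <= b -> `|f' x| <= M) ->
  ac_fun a b f.
Proof.
move=> ab df f'M; apply: (@ac_fun_lipschitz R a b (M + 1)).
apply: (@lipschitz_within_derive R a b M f f') => // x _.
by apply: cvg_within_filter; apply/diff_quot_cvgP.
Qed.

Lemma ac_fun_sn_refl (r x a b : R) : a <= b -> ac_fun a b (fun s => sn r (x - s)).
Proof.
move=> ab; apply: (@ac_fun_derive a b 1 _ (fun s => - cos (r * (x - s)))) => //.
  by move=> s; apply: is_derive_refl; exact: is_derive_sn.
by move=> s _; rewrite normrN cos_max.
Qed.

Lemma ac_fun_cos_refl (r x a b : R) : a <= b -> ac_fun a b (fun s => cos (r * (x - s))).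
Proof.
move=> ab; have [B HB] := ac_fun_bounded ab (ac_fun_sn_refl r x ab).
apply: (@ac_fun_derive a b (r ^+ 2 * B) _ (fun s => - - (r ^+ 2 * sn r (x - s)))) => //.
  move=> s; apply: (@is_derive_refl x s _ (fun s => cos (r * s))).
  exact: is_derive_cosr.
move=> s sab; rewrite opprK normrM ger0_norm ?sqr_ge0// ler_wpM2l ?sqr_ge0//.
exact: HB.
Qed.

Lemma continuous_sn r : continuous (sn r).
Proof.
by move=> t; apply: differentiable_continuous; apply/derivable1_diffP;
  have [] := is_derive_sn r t.
Qed.

(** The function [W] pairs the solution with the fundamental system centred at [x]: [W x = v x],
    [W 0] carries the initial values, and the derivative of [W] is [sn r (x - s) * k s] almost
    everywhere, the terms in [r ^ 2] cancelling. Since [v1] is differentiable only almost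
    everywhere, recovering [W] from its derivative goes through [ac_fun_ftc]. *)
Lemma variation_of_constants (r x : R) (v v1 k : R -> R) : 0 < x <= pi ->
  (forall s, 0 <= s <= pi -> diff_quot v s y @[y --> within `[0, pi] s^'] --> v1 s) ->
  ac_fun 0 pi v1 ->
  {ae mu, forall s, 0 < s < pi -> diff_quot v1 s y @[y --> s^'] --> k s - r ^+ 2 * v s} ->
  mu.-integrable `]0, pi[ (EFin \o k) ->
  v x = v 0 * cos (r * x) + v1 0 * sn r x + \int[mu]_(s in `]0, x[) (sn r (x - s) * k s).
Proof.
move=> /andP[x0 xpi] dv acv1 aev1 Ik.
have pi0 : 0 <= pi :> R by exact: pi_ge0.
have [B1 HB1] := ac_fun_bounded pi0 acv1.
have acv : ac_fun 0 pi v.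
  apply: (@ac_fun_lipschitz R 0 pi (B1 + 1)).
  exact: (@lipschitz_within_derive R 0 pi B1 v v1).
have [B HB] := ac_fun_bounded pi0 acv.
have x0' := ltW x0.
have acs := ac_fun_sn_refl r x x0'; have acc := ac_fun_cos_refl r x x0'.
have [Bs HBs] := ac_fun_bounded x0' acs.
have [Bc HBc] := ac_fun_bounded x0' acc.
have sub s : 0 <= s <= x -> 0 <= s <= pi by move=> /andP[-> /le_trans ->].
pose W s := v1 s * sn r (x - s) + v s * cos (r * (x - s)).
have acW : ac_fun 0 x W.
  apply: ac_funD.
    apply: (@ac_funM R 0 x B1 Bs) => //; first exact: ac_fun_sub acv1.
    by move=> s /sub; exact: HB1.
  apply: (@ac_funM R 0 x B Bc) => //; first exact: ac_fun_sub acv.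
  by move=> s /sub; exact: HB.
pose h : R -> R := (fun s => sn r (x - s) * k s) \_ `]0, x[.
have sxpi : (`]0, x[ `<=` `]0, (pi : R)[)%classic.
  by apply: subset_itvl; rewrite bnd_simp.
have Ik' : mu.-integrable `]0, x[ (EFin \o k) by exact: integrableS Ik.
have Ih : mu.-integrable setT (EFin \o h).
  have -> : EFin \o h = (EFin \o (fun s => sn r (x - s) * k s)) \_ `]0, x[.
    by rewrite restrict_EFin.
  apply/integrable_restrict => //; rewrite setTI.
  apply: (@integrable_bound R `]0, x[ _ (fun s => Bs * `|k s|)) => //.
  - apply: measurable_funM.
      apply: measurable_funTS; apply: continuous_measurable_fun => s.
      apply: (@continuous_comp _ _ _ (fun s => x - s)); last exact: continuous_sn.
      by apply: cvgB; [exact: cvg_cst|exact: cvg_id].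
    by have /measurable_int/measurable_EFinP := Ik'.
  - move=> s /=; rewrite in_itv/= => /andP[s0 sx]; rewrite normrM ler_wpM2r//.
    by apply: HBs; rewrite !ltW.
  - exact: (integrableRZ Bs _ (integrableRnorm _ Ik')).
have := @ac_fun_ftc R 0 x W h x0' acW Ih.
have -> : W x = v x by rewrite /W !subrr sn0 mulr0 add0r mulr0 cos0 mulr1.
have -> : W 0 = v 0 * cos (r * x) + v1 0 * sn r x by rewrite /W subr0 addrC.
move=> Wh; have : v x - (v 0 * cos (r * x) + v1 0 * sn r x) = \int[mu]_(t in `]0, x]) h t.
  apply: Wh; move: aev1; apply: aeS => s Hs /andP[s0 sx].
  have spi : s < pi by exact: lt_le_trans sx xpi.
  have v1s : is_derive s 1 v1 (k s - r ^+ 2 * v s).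
    by apply/diff_quot_cvgP; apply: Hs; rewrite s0.
  have vs : is_derive s 1 v (v1 s).
    apply/diff_quot_cvgP; apply: (@cvg_within_interior R `[0, pi]).
      by apply: nbhs_itvcc; rewrite s0.
    by apply: dv; rewrite !ltW.
  apply/diff_quot_cvgP.
  have sns : is_derive s 1 (fun s => sn r (x - s)) (- cos (r * (x - s))).
    by apply: is_derive_refl; exact: is_derive_sn.
  have coss : is_derive s 1 (fun s => cos (r * (x - s))) (- - (r ^+ 2 * sn r (x - s))).
    by apply: (@is_derive_refl x s _ (fun s => cos (r * s))); exact: is_derive_cosr.
  have := @is_deriveD R R^o R^o _ _ s 1 _ _ (@is_deriveM R R^o _ _ s 1 _ _ v1s sns)
    (@is_deriveM R R^o _ _ s 1 _ _ vs coss).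
  move=> D; apply: is_derive_eq.
  rewrite /h patchE mem_set/=; last by rewrite in_itv/= s0.
  rewrite opprK.
  rewrite -[X in X + _ + _]/(v1 s * _).
  by rewrite /GRing.scale/=; ring.
move=> /eqP; rewrite subr_eq => /eqP ->; rewrite addrC; congr (_ + _).
rewrite -(@Rintegral_itv_bndo_bndc R (BRight 0) x h); last exact: integrable_subT.
by apply: eq_Rintegral => s sx; rewrite /h patchE sx.
Qed.

End variation_of_constants.

(** * Kernels on the triangle, extended by zero *)

Section triangle_kernels.
Variable R : realType.
Local Notation mu := (@lebesgue_measure R).
Local Notation MR := (measurableTypeR R).
Local Notation Re := (@complex.Re R).
Local Notation Im := (@complex.Im R).

Definition cutq (q : R -> R[i]) (s : R) : R[i] := if 0 < s < pi then q s else 0.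

Definition cutK (K : R -> R -> R[i]) (s t : R) : R[i] :=
  if (0 < t < s) && (s <= pi) then K s t else 0.

(** What is used later of a kernel after cut-off: joint measurability for Fubini, a bound, the
    support, and continuity in [t] away from 0 and [s], the two points where the extension by zero
    may jump. *)
Definition kernel_reg (F : R -> R -> R[i]) (M : R) : Prop :=
  [/\ measurable_fun setT (fun z : MR * MR => Re (F z.1 z.2)),
      measurable_fun setT (fun z : MR * MR => Im (F z.1 z.2)),
      forall s t, cabs (F s t) <= M,
      forall s t, ~~ ((0 < t < s) && (s <= pi)) -> F s t = 0 &
      forall s t, t != 0 -> t != s ->
        {for t, continuous (Re \o F s)} /\ {for t, continuous (Im \o F s)}].

Let Tri := [set xt : R * R | 0 <= xt.2 <= xt.1 /\ xt.1 <= pi].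

Let closed_Tri : closed Tri.
Proof.
have -> : Tri = [set z : R * R | 0 <= z.2] `&` [set z | 0 <= z.1 - z.2] `&` [set z | 0 <= pi - z.1].
  apply/seteqP; split => -[a b] /=.
    by move=> [/andP[-> ba] ap]; rewrite !subr_ge0.
  move=> [[b0 ba] ap]; split; last by rewrite -subr_ge0.
  by apply/andP; split=> //; rewrite -subr_ge0.
have cl (f : R * R -> R) : continuous f -> closed [set z | 0 <= f z].
  move=> cf; apply: (@closed_comp _ _ f [set y | 0 <= y]); last exact: closed_ge.
  by move=> z _; exact: cf.
apply: closedI; first apply: closedI; apply: cl => z.
- exact: cvg_snd.
- by apply: cvgB; [exact: cvg_fst|exact: cvg_snd].
- by apply: cvgB; [exact: cvg_cst|exact: cvg_fst].
Qed.

Let compact_Tri : compact Tri.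
Proof.
apply: (@subclosed_compact _ _ (`[0, pi]%classic `*` `[0, pi]%classic)) => //.
  by apply: compact_setX; exact: segment_compact.
move=> [a b] /= [/andP[b0 ba] ap]; rewrite !in_itv/=.
by rewrite b0 (le_trans b0 ba) ap (le_trans ba ap).
Qed.

Let mTri : measurable (Tri : set (MR * MR)).
Proof.
rewrite -[Tri]setCK; apply: measurableC; apply: measurable_open_prod.
by rewrite openC.
Qed.

(** The triangle is compact and Borel, which turns continuity into a bound and into measurability of
    the cut-off function. *)
Let cut_real (f : R * R -> R) : {within Tri, continuous f} ->
  [/\ measurable_fun setT (fun z : MR * MR => if (0 < z.2 < z.1) && (z.1 <= pi) then f z else 0),
      (exists M, forall z, Tri z -> `|f z| <= M) &
      forall s t, 0 < t < s -> s <= pi -> {for t, continuous (fun t => f (s, t))}].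
Proof.
move=> cf; split.
- have m1 : measurable_fun setT (fun z : MR * MR => (z.1 : R)) by exact: measurable_fst.
  have m2 : measurable_fun setT (fun z : MR * MR => (z.2 : R)) by exact: measurable_snd.
  have mf : measurable_fun setT ((f \_ Tri) : MR * MR -> R).
    apply/(measurable_restrictT _ _).1 => //; exact: measurable_fun_within_prod.
  have -> : (fun z : MR * MR => if (0 < z.2 < z.1) && (z.1 <= pi) then f z else 0) =
    (fun z => if (0 < z.2) && (z.2 < z.1) && (z.1 <= pi) then (f \_ Tri) z else 0).
    apply/funext => -[a b] /=; case: ifPn => // /andP[/andP[b0 ba] ap].
    by rewrite patchE mem_set// /Tri/= (ltW b0) (ltW ba).
  apply: measurable_fun_ifT => //.
  apply: measurable_and; first apply: measurable_and.
  + exact: measurable_fun_ltr.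
  + exact: measurable_fun_ltr.
  + exact: measurable_fun_ler.
- have /compact_bounded[M [_ HM]] := continuous_compact cf compact_Tri.
  exists (M + 1) => z Tz.
  have MM : M < M + 1 by rewrite ltrDl.
  by apply: (HM _ MM); exists z.
- move=> s t ts sp.
  have Tst : Tri (s, t) by case/andP: (ts) => a b; split; rewrite //= !ltW.
  have /subspace_continuousP /(_ _ Tst) cfst := cf.
  apply: (cvg_comp (fun t => (s, t)) f _ cfst).
  move=> P /=; rewrite /within/= => nP.
  have nT : \forall t' \near t, Tri (s, t').
    have : nbhs t (`[0, s]%classic : set R) by exact: nbhs_itvcc.
    by apply: filterS => t' /=; rewrite in_itv.
  have nP' : \forall t' \near t, Tri (s, t') -> P (s, t').
    move/nbhs_ballP : nP => [e /= e0 He]; apply/nbhs_ballP; exists e => //= t' tt'.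
    by apply: He; split => //=; exact: ballxx.
  by apply: filterS2 nP' nT => t' h; exact: h.
Qed.

Lemma continuous_on_triangle_reg (K : R -> R -> R[i]) :
  continuous_on_triangle K -> exists M, kernel_reg (cutK K) M.
Proof.
move=> [cr ci].
have [mr [Mr HMr] fr] := cut_real cr; have [mi [Mi HMi] fi] := cut_real ci.
have Fsupp s t : ~~ ((0 < t < s) && (s <= pi)) -> cutK K s t = 0.
  by rewrite /cutK => /negPf ->.
exists (Num.max (Mr + Mi) 0); split => //.
- apply: eq_measurable_fun mr => z _; by rewrite /cutK; case: ifP.
- apply: eq_measurable_fun mi => z _; by rewrite /cutK; case: ifP.
- move=> s t; case: (boolP ((0 < t < s) && (s <= pi))) => [h|/Fsupp ->]; last first.
    by rewrite cabs0 le_max lexx orbT.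
  rewrite /cutK h le_max; apply/orP; left; apply: le_trans (cabs_le_normD _) _.
  have Tst : Tri (s, t) by move: h => /andP[/andP[? ?] ?]; split; rewrite //= !ltW.
  by apply: lerD; [exact: (HMr _ Tst)|exact: (HMi _ Tst)].
- move=> s t t0 ts.
  case: (boolP ((0 < t < s) && (s <= pi))) => [/andP[h sp]|h].
    have near_eq : \forall t' \near t, cutK K s t' = K s t'.
      have : nbhs t (`]0, s[%classic : set R).
        by apply: open_nbhs_nbhs; split; [exact: interval_open|rewrite /= in_itv].
      by apply: filterS => t' /=; rewrite in_itv/= /cutK sp => ->.
    have hst : cutK K s t = K s t by rewrite /cutK h sp.
    split; rewrite /prop_for /continuous_at /= hst.
    + apply: cvg_trans (fr s t h sp); apply: near_eq_cvg.
      by apply: filterS near_eq => t' /= ->.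
    + apply: cvg_trans (fi s t h sp); apply: near_eq_cvg.
      by apply: filterS near_eq => t' /= ->.
  have near_eq : \forall t' \near t, cutK K s t' = 0.
    have [sp|sp] := leP s pi; last first.
      have : nbhs t (setT : set R) by exact: filterT.
      apply: filterS => t' _; apply: Fsupp.
      by rewrite negb_and -ltNge sp orbT.
    have [tneg|tpos] := ltP t 0.
      have nt : \forall t' \near t, t' < 0 by exact: lt_nbhsl.
      apply: filterS nt => t' t'0; apply: Fsupp.
      by rewrite !negb_and -!leNgt (ltW t'0).
    have tgs : s < t.
      rewrite lt_neqAle eq_sym ts/= leNgt; apply: contra h => tlts.
      by rewrite tlts sp !andbT lt_neqAle eq_sym t0 tpos.
    have nt : \forall t' \near t, s < t' by exact: lt_nbhsr.
    apply: filterS nt => t' t's; apply: Fsupp.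
    by rewrite !negb_and -!leNgt (ltW t's) orbT.
  have hst : cutK K s t = 0 by exact: Fsupp.
  split; rewrite /prop_for /continuous_at /= hst /=.
  + by apply/cvgrPdist_lt => e e0; apply: filterS near_eq => t' /= ->; rewrite subrr normr0.
  + by apply/cvgrPdist_lt => e e0; apply: filterS near_eq => t' /= ->; rewrite subrr normr0.
Qed.

End triangle_kernels.

(** * The Volterra equation of a solution *)

Section volterra.
Variable R : realType.
Local Notation mu := (@lebesgue_measure R).
Local Notation MR := (measurableTypeR R).
Local Notation Re := (@complex.Re R).
Local Notation Im := (@complex.Im R).

Lemma ReZ (a : R) (z : R[i]) : Re (a%:C * z) = a * Re z.
Proof. by rewrite ReM/= mul0r subr0. Qed.

Lemma ImZ (a : R) (z : R[i]) : Im (a%:C * z) = a * Im z.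
Proof. by rewrite ImM/= mul0r addr0. Qed.

Lemma cmeasM D (f g : R -> R[i]) : cmeas D f -> cmeas D g -> cmeas D (fun x => f x * g x).
Proof.
move=> [fr fi] [gr gi]; split.
- apply: (eq_measurable_fun (fun x => Re (f x) * Re (g x) - Im (f x) * Im (g x))).
    by move=> x _; rewrite /= ReM.
  by apply: measurable_funB; apply: measurable_funM.
- apply: (eq_measurable_fun (fun x => Re (f x) * Im (g x) + Im (f x) * Re (g x))).
    by move=> x _; rewrite /= ImM.
  by apply: measurable_funD; apply: measurable_funM.
Qed.

(** For the real parameter [r ^+ 2] the real and the imaginary part of [y] each satisfy a real
    equation [v'' = k - r ^ 2 v], coupled only through [k], the corresponding part of [q * y]. *)
Lemma ivp_volterra (q y : R -> R[i]) (r : R) (y0 y1 : R[i]) (x : R) :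
  cintegrable `]0, pi[ q -> ivp_solution q (r ^+ 2)%:C y0 y1 y -> 0 < x <= pi ->
  y x = (cos (r * x))%:C * y0 + (sn r x)%:C * y1 +
        cint `]0, x[ (fun s => (sn r (x - s))%:C * (q s * y s)).
Proof.
move=> Iq [dy acy aey <- <-] hx.
have [mqr mqi] := cintegrable_cmeas Iq.
set y' := derive_in `[0, pi] y in acy aey *.
have pi0 : 0 <= pi :> R by exact: pi_ge0.
have dyr s : 0 <= s <= pi ->
    diff_quot (Re \o y) s t @[t --> within `[0, pi] s^'] --> (Re \o y') s.
  by move=> hs; have [] := dy s; first by rewrite /= in_itv.
have dyi s : 0 <= s <= pi ->
    diff_quot (Im \o y) s t @[t --> within `[0, pi] s^'] --> (Im \o y') s.
  by move=> hs; have [] := dy s; first by rewrite /= in_itv.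
have acr : ac_fun 0 pi (Re \o y').
  move=> e /acy[d d0 H]; exists d => // n u v uv tr S.
  apply: le_lt_trans (H n u v uv tr S); apply: ler_sum => i _.
  by have := normRe_le_cabs (y' (v i) - y' (u i)); rewrite ReB.
have aci : ac_fun 0 pi (Im \o y').
  move=> e /acy[d d0 H]; exists d => // n u v uv tr S.
  apply: le_lt_trans (H n u v uv tr S); apply: ler_sum => i _.
  by have := normIm_le_cabs (y' (v i) - y' (u i)); rewrite ImB.
have lip (v v1 : R -> R) : (forall s, 0 <= s <= pi ->
    diff_quot v s t @[t --> within `[0, pi] s^'] --> v1 s) -> ac_fun 0 pi v1 ->
    (exists B, forall s, 0 <= s <= pi -> `|v s| <= B) /\ measurable_fun `]0, pi[ v.
  move=> dv acv1; split.
    apply: (ac_fun_bounded pi0).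
    have [B1 HB1] := ac_fun_bounded pi0 acv1.
    apply: (@ac_fun_lipschitz R 0 pi (B1 + 1)).
    exact: (@lipschitz_within_derive R 0 pi B1 v v1).
  apply: open_continuous_measurable_fun; first exact: interval_open.
  move=> s; rewrite inE/= in_itv/= => /andP[s0 spi].
  have vs : is_derive s 1 v (v1 s).
    apply/diff_quot_cvgP; apply: (@cvg_within_interior R `[0, pi]).
      by apply: nbhs_itvcc; rewrite s0.
    by apply: dv; rewrite !ltW.
  by apply: differentiable_continuous; apply/derivable1_diffP; case: vs.
have [[Br HBr] myr] := lip _ _ dyr acr.
have [[Bi HBi] myi] := lip _ _ dyi aci.
have Iqy : cintegrable `]0, pi[ (fun s => q s * y s).
  apply: (@cintegrable_bound R _ _ (fun s => (Br + Bi) * cabs (q s))) => //.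
  - by apply: cmeasM; split.
  - move=> s /=; rewrite in_itv/= => /andP[s0 spi].
    rewrite cabsM mulrC ler_wpM2r ?cabs_ge0//.
    apply: le_trans (cabs_le_normD _) _; apply: lerD.
      by apply: HBr; rewrite !ltW.
    by apply: HBi; rewrite !ltW.
  - exact: (integrableRZ _ _ (cintegrable_cabs _ Iq)).
have eqr : {ae mu, forall s, 0 < s < pi ->
    diff_quot (Re \o y') s t @[t --> s^'] --> Re (q s * y s) - r ^+ 2 * Re (y s)}.
  move: aey; apply: aeS => s H hs; have [[h _] E] := H hs.
  apply: (@cvg_within_interior R `[0, pi]); first exact: nbhs_itvcc.
  have <- : Re (derive_in `[0, pi] y' s) = Re (q s * y s) - r ^+ 2 * Re (y s).
    by rewrite -ReZ -E ReD ReN; ring.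
  exact: h.
have eqi : {ae mu, forall s, 0 < s < pi ->
    diff_quot (Im \o y') s t @[t --> s^'] --> Im (q s * y s) - r ^+ 2 * Im (y s)}.
  move: aey; apply: aeS => s H hs; have [[_ h] E] := H hs.
  apply: (@cvg_within_interior R `[0, pi]); first exact: nbhs_itvcc.
  have <- : Im (derive_in `[0, pi] y' s) = Im (q s * y s) - r ^+ 2 * Im (y s).
    by rewrite -ImZ -E ImD ImN; ring.
  exact: h.
have [Ir Ii] := Iqy.
apply: complex_ext.
- have /= -> := @variation_of_constants R r x _ _ (fun s => Re (q s * y s)) hx dyr acr eqr Ir.
  rewrite !ReD !ReZ /= mulrC [X in _ + X + _]mulrC; congr (_ + _).
  by apply: eq_Rintegral => s _; rewrite ReZ.
- have /= -> := @variation_of_constants R r x _ _ (fun s => Im (q s * y s)) hx dyi aci eqi Ii.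
  rewrite !ImD !ImZ /= mulrC [X in _ + X + _]mulrC; congr (_ + _).
  by apply: eq_Rintegral => s _; rewrite ImZ.
Qed.

End volterra.

(** * From the integral representations to the integral equation *)

Section transforms.
Variable R : realType.
Local Notation mu := (@lebesgue_measure R).
Local Notation MR := (measurableTypeR R).
Local Notation Re := (@complex.Re R).
Local Notation Im := (@complex.Im R).

Lemma Rintegral_ae (D : set R) (f g : R -> R) : measurable D -> measurable_fun D f ->
  measurable_fun D g -> {ae mu, forall x, D x -> f x = g x} ->
  \int[mu]_(x in D) f x = \int[mu]_(x in D) g x.
Proof.
move=> mD mf mg fg; rewrite /Rintegral; congr fine; apply: ae_eq_integral => //.
- exact/measurable_EFinP.
- exact/measurable_EFinP.
- by move: fg; apply: aeS => x + Dx => ->.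
Qed.

Lemma Rintegral_indicM (D : set R) (f : R -> R) :
  \int[mu]_t (\1_D t * f t) = \int[mu]_(t in D) f t.
Proof.
rewrite [RHS]Rintegral_mkcond; apply: eq_Rintegral => t _.
by rewrite patchE indicE; case: ifP; rewrite ?mul1r ?mul0r.
Qed.

Lemma Rintegral_half (f g : R -> R) : mu.-integrable setT (EFin \o f) ->
  (forall t, f t = 2^-1 * g t) -> \int[mu]_t f t = 2^-1 * \int[mu]_t g t.
Proof.
move=> If fg; have g2 t : g t = 2 * f t by rewrite fg mulVKf.
rewrite (@eq_Rintegral _ _ _ mu setT (fun t => 2 * f t) g); last by move=> t _; exact: g2.
by rewrite RintegralZl// mulKf.
Qed.

Lemma Rintegral0 (D : set R) : measurable D -> \int[mu]_(t in D) 0 = 0 :> R.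
Proof. by move=> mD; rewrite Rintegral_cst// mul0r. Qed.

Lemma cint0 (D : set R) (f : R -> R[i]) : measurable D ->
  (forall t, D t -> f t = 0) -> cint D f = 0.
Proof.
by move=> mD f0; rewrite (@eq_cint _ _ _ (fun=> 0))//; congr (_ +i* _); exact: Rintegral0.
Qed.

Lemma cmeas_real (D : set R) (f : R -> R) : measurable_fun D f ->
  cmeas D (fun t => (f t)%:C).
Proof. by move=> mf; split => //=; exact: measurable_cst. Qed.

(** A primitive is an integral over the whole line against [step], so that Fubini's theorem can
    exchange the end of a range with another variable. *)
Definition step (a b : R) : R := if a <= b then 1 else 0.

Lemma step_le1 a b : `|step a b| <= 1.
Proof. by rewrite /step; case: ifP; rewrite ?normr1 ?normr0. Qed.

Lemma step1 a b : a <= b -> step a b = 1.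
Proof. by rewrite /step => ->. Qed.

Lemma step0 a b : b < a -> step a b = 0.
Proof. by rewrite /step leNgt => ->. Qed.

Lemma cabs_step_le a b (z : R[i]) : cabs ((step a b)%:C * z) <= cabs z.
Proof. by rewrite cabsM cabsR -[leRHS]mul1r ler_wpM2r ?cabs_ge0// step_le1. Qed.

Lemma indic_oo1 (a b t : R) : a < t -> t < b -> \1_(`]a, b[%classic) t = 1 :> R.
Proof. by move=> ha hb; rewrite indicE mem_set//= in_itv/= ha hb. Qed.

Lemma indic_oo0 (a b t : R) : b <= t -> \1_(`]a, b[%classic) t = 0 :> R.
Proof.
move=> hb; rewrite indicE memNset//= in_itv/= => /andP[_].
by rewrite ltNge hb.
Qed.

Lemma measurable_step (d : measure_display) (T : measurableType d) (a b : T -> R) :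
  measurable_fun setT a -> measurable_fun setT b ->
  measurable_fun setT (fun x => step (a x) (b x)).
Proof. by move=> ma mb; apply: measurable_fun_ite. Qed.

Lemma cint_step (f : R -> R[i]) (b : R) :
  cint setT (fun t => (step t b)%:C * f t) = cprim f b.
Proof.
rewrite cprimE_if; congr (_ +i* _); apply: eq_Rintegral => t _;
  by rewrite ?ReZ ?ImZ /step; case: ifP; rewrite ?mul1r ?mul0r.
Qed.

Lemma cint_mkcond (D : set R) (f : R -> R[i]) :
  cint D f = cint setT (fun t => (\1_D t)%:C * f t).
Proof.
congr (_ +i* _); rewrite Rintegral_mkcond; apply: eq_Rintegral => t _;
  by rewrite ?ReZ ?ImZ patchE indicE; case: ifP; rewrite ?mul1r ?mul0r.
Qed.

Lemma cint_realZ (g : R -> R) (z : R[i]) : mu.-integrable setT (EFin \o g) ->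
  cint setT (fun t => (g t)%:C * z) = (\int[mu]_t g t)%:C * z.
Proof.
move=> Ig; apply: complex_ext; rewrite ?ReZ ?ImZ /=; rewrite -RintegralZr//;
  by apply: eq_Rintegral => t _; rewrite ?ReZ ?ImZ.
Qed.

Lemma half_mul3_le (b c d e : R) : 0 <= b -> b <= e -> 0 <= c -> c <= 3 -> 0 <= d ->
  2^-1 * (d * b * c) <= 2 * e * d.
Proof.
move=> b0 be c0 c3 d0.
have h1 : d * b <= d * e by exact: ler_wpM2l.
have h2 : d * b * c <= d * e * 3 by apply: ler_pM => //; rewrite !mulr_ge0.
have : 0 <= d * e by rewrite mulr_ge0// (le_trans b0).
by lra.
Qed.

Lemma half_mul1_le (b c d e : R) : 0 <= b -> b <= e -> 0 <= c -> c <= 1 -> 0 <= d ->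
  2^-1 * (c * (d * b)) <= e * d.
Proof.
move=> b0 be c0 c1 d0.
have h1 : d * b <= d * e by exact: ler_wpM2l.
have h2 : c * (d * b) <= 1 * (d * e) by apply: ler_pM => //; rewrite mulr_ge0.
have : 0 <= d * e by rewrite mulr_ge0// (le_trans b0).
by lra.
Qed.

(* The kernel of the d'Alembert average over [tau - h, tau + h], folded onto
   t > 0 with parity eps. *)
Definition kk (eps tau t h : R) : R :=
  step t (tau + h) - step t (tau - h) + eps * step t (h - tau).

(** For [t = s] and [h = x - s] the conditions [s <= tau + (x - s)] and [s <= (x - s) - tau] read
    [s <= (x + tau) / 2] and [s <= (x - tau) / 2]: the arguments of [Q] in the first
    approximation. *)
Lemma kk_diag (eps tau s x : R) : tau < x ->
  kk eps tau s (x - s) = step s ((x + tau) / 2) + eps * step s ((x - tau) / 2).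
Proof.
move=> tx; rewrite /kk (@step0 s (tau - (x - s))) ?subr0; last lra.
have -> : step s (tau + (x - s)) = step s ((x + tau) / 2).
  have [h|h] := leP s ((x + tau) / 2); first by rewrite !step1//; lra.
  by rewrite !step0//; lra.
have -> // : step s (x - s - tau) = step s ((x - tau) / 2).
have [h|h] := leP s ((x - tau) / 2); first by rewrite !step1//; lra.
by rewrite !step0//; lra.
Qed.

Lemma step_diag0 (eps tau s x : R) : 0 < tau -> tau < x -> x <= s ->
  step s ((x + tau) / 2) + eps * step s ((x - tau) / 2) = 0.
Proof.
move=> t0 tx xs; rewrite (@step0 s ((x + tau) / 2)); last lra.
by rewrite (@step0 s ((x - tau) / 2)); [rewrite mulr0 addr0|lra].
Qed.

Lemma measurable_kk (eps : R) (d : measure_display) (T : measurableType d) (tau t h : T -> R) :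
  measurable_fun setT tau -> measurable_fun setT t -> measurable_fun setT h ->
  measurable_fun setT (fun z => kk eps (tau z) (t z) (h z)).
Proof.
move=> mtau mt mh; apply: measurable_funD.
  apply: measurable_funB; apply: measurable_step => //.
    exact: measurable_funD.
  exact: measurable_funB.
apply: measurable_funM => //; apply: measurable_step => //.
exact: measurable_funB.
Qed.

(** The integral of [kk eps tau t h] against [F s t] (see [cint_kk]): [F s] over the window of
    radius [h] around [tau], plus [eps] times its integral over the reflection of the part of the
    window below 0. As [F s] vanishes on the negative axis, one of the last two primitives is always
    zero. *)
Definition kJ (eps : R) (F : R -> R -> R[i]) (s tau h : R) : R[i] :=
  cprim (F s) (tau + h) - cprim (F s) (tau - h) + eps%:C * cprim (F s) (h - tau).

(* [G1 + G2] is the right-hand side of the integral equation of the kernels: [eps = 1] for the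
   cosine kernel, [eps = -1] for the sine kernel. *)
Definition G1 (eps : R) (q : R -> R[i]) (x tau : R) : R[i] :=
  (2^-1)%:C * (cprim q ((x + tau) / 2) + eps%:C * cprim q ((x - tau) / 2)).

Definition G2 (eps : R) (q : R -> R[i]) (F : R -> R -> R[i]) (x tau : R) : R[i] :=
  (2^-1)%:C * cint setT (fun s => q s * kJ eps F s tau (Num.max (x - s) 0)).

Section kernel_facts.
Variables (F : R -> R -> R[i]) (M : R).
Hypothesis regF : kernel_reg F M.

Lemma kernel_reg_ge0 : 0 <= M.
Proof. by have [_ _ FM _ _] := regF; exact: le_trans (cabs_ge0 _) (FM 0 0). Qed.

Lemma kernel_reg_cmeas s : cmeas setT (F s).
Proof.
have [mFr mFi _ _ _] := regF.
by split; [exact: (measurableT_comp mFr (@pair1_measurable _ _ MR MR s))|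
           exact: (measurableT_comp mFi (@pair1_measurable _ _ MR MR s))].
Qed.

Lemma kernel_reg_supp s t : ~~ (0 < t < pi) -> F s t = 0.
Proof.
have [_ _ _ Fsupp _] := regF; move=> h; apply: Fsupp.
by apply: contra h => /andP[/andP[-> ts] sp]; rewrite (lt_le_trans ts sp).
Qed.

Lemma kernel_reg_cintegrable s : cintegrable setT (F s).
Proof.
have [_ _ FM _ _] := regF.
by apply: (@cintegrable_supp R (F s) M pi) => //; [exact: kernel_reg_cmeas|exact: kernel_reg_supp].
Qed.

Lemma kJ_le (eps s tau h : R) : `|eps| <= 1 -> cabs (kJ eps F s tau h) <= 3 * (M * pi).
Proof.
have [_ _ FM _ _] := regF => eps1.
have b b1 b2 : cabs (cprim (F s) b1 - cprim (F s) b2) <= M * pi.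
  apply: cprim_supp_le => //; [exact: pi_ge0|exact: kernel_reg_cmeas|exact: kernel_reg_supp].
have c b1 : cabs (cprim (F s) b1) <= M * pi.
  have <- : cprim (F s) b1 - cprim (F s) 0 = cprim (F s) b1; last exact: b.
  by rewrite (@cprim_le0 R (F s) pi (kernel_reg_supp s) 0 (lexx 0)) subr0.
rewrite /kJ; apply: le_trans (cabsD _ _) _.
have -> : 3 * (M * pi) = M * pi + M * pi + M * pi by ring.
apply: lerD; first by apply: le_trans (cabsB _ _) _; apply: lerD; exact: c.
rewrite cabsM cabsR -[leRHS]mul1r; apply: ler_pM => //; exact: cabs_ge0.
Qed.

Lemma cint_kk (eps s tau h : R) :
  cintegrable setT (fun t => (kk eps tau t h)%:C * F s t) /\
  cint setT (fun t => (kk eps tau t h)%:C * F s t) = kJ eps F s tau h.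
Proof.
have Istep b : cintegrable setT (fun t => (step t b)%:C * F s t).
  apply: (@cintegrable_bound R setT _ _ measurableT _ _ (cintegrable_cabs measurableT (kernel_reg_cintegrable s))).
    by apply: cmeasM (kernel_reg_cmeas s); apply: cmeas_real; apply: measurable_step.
  by move=> t _; exact: cabs_step_le.
have E t : (step t (tau + h))%:C * F s t - (step t (tau - h))%:C * F s t +
    eps%:C * ((step t (h - tau))%:C * F s t) = (kk eps tau t h)%:C * F s t.
  by rewrite /kk rmorphD rmorphB rmorphM/=; ring.
have I12 : cintegrable setT (fun t => (step t (tau + h))%:C * F s t - (step t (tau - h))%:C * F s t).
  exact: (cintegrableD measurableT (Istep _) (cintegrableN measurableT (Istep _))).
have I3 : cintegrable setT (fun t => eps%:C * ((step t (h - tau))%:C * F s t)).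
  exact: (cintegrableZ _ measurableT (Istep _)).
split.
  by apply: (eq_cintegrable measurableT _ (cintegrableD measurableT I12 I3)) => t _; exact: E.
rewrite /kJ -!cint_step -(cintZ _ measurableT (Istep (h - tau))).
rewrite -(cintB measurableT (Istep (tau + h)) (Istep (tau - h))) -(cintD measurableT I12 I3).
by apply: eq_cint => t _; rewrite -E.
Qed.

Lemma measurable_kJ (eps : R) (d : measure_display) (T : measurableType d) (sg tau h : T -> R) :
  measurable_fun setT sg -> measurable_fun setT tau -> measurable_fun setT h ->
  measurable_fun setT (fun z => Re (kJ eps F (sg z) (tau z) (h z))) /\
  measurable_fun setT (fun z => Im (kJ eps F (sg z) (tau z) (h z))).
Proof.
have [mFr mFi _ _ _] := regF => msg mtau mh.
have [p1r p1i] := measurable_cprim mFr mFi msg (measurable_funD mtau mh).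
have [p2r p2i] := measurable_cprim mFr mFi msg (measurable_funB mtau mh).
have [p3r p3i] := measurable_cprim mFr mFi msg (measurable_funB mh mtau).
split; rewrite /kJ.
- apply: (eq_measurable_fun (fun z => Re (cprim (F (sg z)) (tau z + h z)) -
     Re (cprim (F (sg z)) (tau z - h z)) + eps * Re (cprim (F (sg z)) (h z - tau z)))).
    by move=> z _; rewrite ReD ReB ReZ.
  by apply: measurable_funD; [exact: measurable_funB|exact: measurable_funM].
- apply: (eq_measurable_fun (fun z => Im (cprim (F (sg z)) (tau z + h z)) -
     Im (cprim (F (sg z)) (tau z - h z)) + eps * Im (cprim (F (sg z)) (h z - tau z)))).
    by move=> z _; rewrite ImD ImB ImZ.
  by apply: measurable_funD; [exact: measurable_funB|exact: measurable_funM].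
Qed.

End kernel_facts.

(** The purpose of [Num.max (x - s) 0] in [G2]: the integrand vanishes for [s >= x], so the integral
    over [s < x] is taken over a fixed domain and is Lipschitz in [x]. *)
Lemma kJ0 (eps s tau : R) (F : R -> R -> R[i]) (M : R) : kernel_reg F M -> 0 <= tau ->
  kJ eps F s tau 0 = 0.
Proof.
move=> regF t0; rewrite /kJ addr0 subr0 subrr !add0r.
by rewrite (@cprim_le0 R (F s) pi (kernel_reg_supp regF s)) ?mulr0// oppr_le0.
Qed.

Lemma cintegrable_q_kJ (eps x tau : R) (q : R -> R[i]) (F : R -> R -> R[i]) (M : R) :
  `|eps| <= 1 -> cintegrable setT q -> kernel_reg F M ->
  cintegrable setT (fun s => q s * kJ eps F s tau (Num.max (x - s) 0)).
Proof.
move=> eps1 Iq regF.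
apply: (@cintegrable_bound R setT _ _ measurableT _ _
  (integrableRZ (3 * (M * pi)) measurableT (cintegrable_cabs measurableT Iq))).
  apply: cmeasM; first exact: cintegrable_cmeas.
  have mid : measurable_fun setT (id : R -> R) by exact: measurable_id.
  have mmax : measurable_fun setT (fun s : R => Num.max (x - s) 0).
    by apply: measurable_maxr => //; apply: measurable_funB.
  have [] := @measurable_kJ F M regF eps _ MR id (fun=> tau) _ mid (measurable_cst _) mmax.
  by split.
move=> s _; rewrite cabsM mulrC; apply: ler_wpM2r; first exact: cabs_ge0.
by apply: (kJ_le regF).
Qed.

Section transform.
Variables (eps r x C : R) (phi Phi : R -> R).
Hypothesis eps1 : `|eps| <= 1.
Hypothesis hx : 0 < x <= pi.
Hypothesis cphi : continuous phi.
Hypothesis phiC : forall t, `|phi t| <= C.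
Hypothesis dPhi : forall t : R, is_derive t 1 Phi (phi t).
Hypothesis Phi0 : Phi 0 = 0.
Hypothesis PhiN : forall t, Phi (- t) = - (eps * Phi t).
Hypothesis PhiD : forall t h, Phi (t + h) - Phi (t - h) = 2 * (sn r h * phi t).
Local Notation D := (`]0, x[%classic : set R).

Let x0 : 0 < x. Proof. by case/andP: hx. Qed.
Let mphi : measurable_fun setT phi. Proof. exact: continuous_measurable_fun. Qed.
Let C0 : 0 <= C. Proof. exact: le_trans (normr_ge0 _) (phiC 0). Qed.

Let Rint_phi (b : R) : 0 <= b -> \int[mu]_(t in `]0, b]) phi t = Phi b.
Proof.
move=> b0.
have Ih : mu.-integrable setT (EFin \o (phi \_ `]0, b])).
  rewrite -restrict_EFin; apply/integrable_restrict => //; rewrite setTI.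
  apply: measurable_bounded_integrable => //.
  - by have := lebesgue_measure_itv `]0, b]; rewrite /= => ->; case: ifP => _;
      rewrite ?ltry// -EFinB ltry.
  - exact: measurable_funTS.
  - exists C; split; first exact: num_real.
    by move=> y Cy t _; exact: le_trans (phiC _) (ltW Cy).
have -> : \int[mu]_(t in `]0, b]) phi t = \int[mu]_(t in `]0, b]) (phi \_ `]0, b]) t.
  by apply: eq_Rintegral => t tb; rewrite patchE tb.
rewrite -(@ac_fun_ftc R 0 b Phi _ b0 _ Ih) ?Phi0 ?subr0//.
- by apply: (@ac_fun_derive R 0 b C Phi phi).
- apply: (@aeS _ (fun=> True)); last exact: aeW.
  move=> t _ /andP[t0 tb]; rewrite patchE mem_set; last by rewrite /= in_itv/= t0 ltW.
  exact/diff_quot_cvgP.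
Qed.

Let Iphi_step (c : R) : mu.-integrable D (EFin \o (fun t => phi t * step t c)).
Proof.
apply: (@integrable_bounded_itv R x x0 _ C).
  by apply: measurable_funTS; apply: measurable_funM => //; exact: measurable_step.
by move=> t _; rewrite normrM -[leRHS]mulr1 ler_pM// step_le1.
Qed.

Let Iphi_step' (c : R) : mu.-integrable D (EFin \o (fun t => phi t * step c t)).
Proof.
apply: (@integrable_bounded_itv R x x0 _ C).
  by apply: measurable_funTS; apply: measurable_funM => //; exact: measurable_step.
by move=> t _; rewrite normrM -[leRHS]mulr1 ler_pM// step_le1.
Qed.

Let Iphi : mu.-integrable D (EFin \o phi).
Proof.
apply: (@integrable_bounded_itv R x x0 _ C) => //; exact: measurable_funTS.
Qed.

Let Rint_step (c : R) : c <= x -> \int[mu]_(t in D) (phi t * step t c) = Phi (Num.max c 0).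
Proof.
move=> cx; rewrite -Rint_phi; last by rewrite le_max lexx orbT.
rewrite [LHS](@Rintegral_itv_bndo_bndc R (BRight 0) x)// ?Iphi_step//.
rewrite Rintegral_mkcond [RHS]Rintegral_mkcond; apply: eq_Rintegral => t _.
rewrite !patchE !mem_setE !in_itv/= /step le_max.
case: (ltP 0 t) => t0 //=; case: (leP t c) => tc /=.
  by rewrite (le_trans tc cx) mulr1.
by rewrite mulr0 if_same.
Qed.

Let Rint_step' (c : R) : c <= x ->
  \int[mu]_(t in D) (phi t * step c t) = Phi x - Phi (Num.max c 0).
Proof.
move=> cx; rewrite -(Rint_step cx).
have -> : Phi x = Phi (Num.max x 0) by congr Phi; apply/esym/max_idPl; exact: ltW.
rewrite -(Rint_step (lexx x)) -RintegralB//.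
(* On [D], [step c t] and [step t x - step t c] differ at [t = c] only. *)
apply: Rintegral_ae => //.
- by apply: measurable_funTS; apply: measurable_funM => //; exact: measurable_step.
- by apply: measurable_funTS; apply: measurable_funB; apply: measurable_funM => //; exact: measurable_step.
- exists [set c]; split; first exact: measurable_set1.
    exact: lebesgue_measure_set1.
  move=> t /= H; apply: contrapT => tc; apply: H; rewrite /= in_itv/= => /andP[t0 tx].
  rewrite /step (ltW tx) mulr1; case: (ltgtP c t) => [ct|ct|ctE].
  + by rewrite mulr1 mulr0 subr0.
  + by rewrite mulr1 mulr0 subrr.
  + by case: tc.
Qed.

(** [PhiD] makes [sn r h * phi t] an increment of [Phi], that is an integral of [phi] over
    [[t - h, t + h]], and [PhiN] folds a negative end back with the sign [eps]; [t + h <= x] keeps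
    the window below [x]. The instances are [cos (r * t)] with primitive [sn r] for [eps = 1], and
    [sn r] with primitive [(1 - cos (r * t)) / r ^ 2] for [eps = -1]. *)
Let Rint_kk t h : 0 < t -> 0 < h -> t + h <= x ->
  \int[mu]_(tau in D) (phi tau * kk eps tau t h) = 2 * (sn r h * phi t).
Proof.
move=> t0 h0 thx.
transitivity (\int[mu]_(tau in D) ((phi tau * step (t - h) tau - phi tau * step (t + h) tau)
   + eps * (phi tau * step tau (h - t)))).
  apply: eq_Rintegral => tau _; rewrite /kk.
  have -> : step t (tau + h) = step (t - h) tau by rewrite /step lerBlDr.
  have -> : step t (tau - h) = step (t + h) tau by rewrite /step lerBrDr.
  have -> : step t (h - tau) = step tau (h - t) by rewrite /step !lerBrDr addrC.
  by ring.
rewrite RintegralD//; last 2 first.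
- exact: (@integrableRB R D).
- exact: (@integrableRZ R eps D).
rewrite RintegralB// RintegralZl// Rint_step'//; last lra.
rewrite Rint_step'// Rint_step; last lra.
have -> : Num.max (t + h) 0 = t + h by apply/max_idPl; lra.
rewrite -PhiD.
have [th|th] := leP 0 (t - h).
  rewrite (_ : Num.max (h - t) 0 = 0); last by apply/max_idPr; lra.
  by rewrite Phi0; ring.
rewrite (_ : Num.max (h - t) 0 = h - t); last by apply/max_idPl; lra.
by rewrite Phi0 -[t - h]opprB PhiN; ring.
Qed.

Let kk3 tau t h : `|kk eps tau t h| <= 3.
Proof.
rewrite /kk; apply: le_trans (ler_normD _ _) _.
have -> : 3 = (1 + 1) + 1 :> R by ring.
apply: lerD; last by rewrite normrM -[leRHS]mulr1 ler_pM// step_le1.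
by apply: le_trans (ler_normB _ _) _; apply: lerD; exact: step_le1.
Qed.

Let indic_le1 (t : R) : `|\1_D t : R| <= 1.
Proof. by rewrite indicE; case: (_ \in _); rewrite ?normr1 ?normr0. Qed.

Let half_ge0 : 0 <= 2^-1 :> R. Proof. by rewrite invr_ge0. Qed.

Let indic_ge0 (t : R) : 0 <= \1_D t :> R. Proof. by rewrite indicE. Qed.

Let mindic : measurable_fun setT (\1_D : R -> R).
Proof. by apply: measurable_indic; exact: measurable_itv. Qed.

Variables (q : R -> R[i]) (F : R -> R -> R[i]) (M : R).
Hypothesis Iq : cintegrable setT q.
Hypothesis qsupp : forall s, ~~ (0 < s < pi) -> q s = 0.
Hypothesis regF : kernel_reg F M.

(** The contribution of the free term. [Rint_kk] with [t = s], [h = x - s] makes the left side a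
    double integral of [kk] and [q]; after Fubini, [kk_diag] turns the inner integral over [s] into
    primitives of [q]. *)
Lemma transform1 :
  cint D (fun s => (sn r (x - s) * phi s)%:C * q s) =
  cint D (fun tau => (phi tau)%:C * G1 eps q x tau).
Proof.
have [mqr mqi] := cintegrable_cmeas Iq.
pose k (s tau : R) : R := 2^-1 * (\1_D s * (\1_D tau * phi tau) * kk eps tau s (x - s)).
pose H (z : MR * MR) := (k z.1 z.2)%:C * q z.1.
have mk : measurable_fun setT (fun z : MR * MR => k z.1 z.2).
  have m1 : measurable_fun setT (fun z : MR * MR => (z.1 : R)) by exact: measurable_fst.
  have m2 : measurable_fun setT (fun z : MR * MR => (z.2 : R)) by exact: measurable_snd.
  have mx1 : measurable_fun setT (fun z : MR * MR => x - z.1 : R) by exact: measurable_funB.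
  apply: measurable_funM => //; apply: measurable_funM.
    apply: measurable_funM; first exact: (measurableT_comp mindic m1).
    by apply: measurable_funM; [exact: (measurableT_comp mindic m2)|exact: (measurableT_comp mphi m2)].
  apply: measurable_funD.
    by apply: measurable_funB; apply: measurable_step => //;
      [exact: measurable_funD|exact: measurable_funB].
  by apply: measurable_funM => //; apply: measurable_step => //; exact: measurable_funB.
have mHr : measurable_fun setT (Re \o H).
  apply: (eq_measurable_fun (fun z : MR * MR => k z.1 z.2 * Re (q z.1))).
    by move=> z _; rewrite /= ReZ.
  by apply: measurable_funM => //; exact: (measurableT_comp mqr (@measurable_fst _ _ MR MR)).
have mHi : measurable_fun setT (Im \o H).
  apply: (eq_measurable_fun (fun z : MR * MR => k z.1 z.2 * Im (q z.1))).
    by move=> z _; rewrite /= ImZ.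
  by apply: measurable_funM => //; exact: (measurableT_comp mqi (@measurable_fst _ _ MR MR)).
have kb s tau : `|k s tau| <= 2 * C * \1_D tau.
  rewrite /k !normrM (ger0_norm half_ge0) (ger0_norm (indic_ge0 tau)).
  have := indic_le1 s; have := phiC tau; have := kk3 tau s (x - s).
  have : 0 <= \1_D tau :> R by rewrite indicE.
  have := normr_ge0 (\1_D s : R); have := normr_ge0 (phi tau); have := normr_ge0 (kk eps tau s (x - s)).
  move: (`|\1_D s|) (`|phi tau|) (`|kk eps tau s (x - s)|) (\1_D tau) => a b c d c0 b0 a0 d0 c3 bC a1.
  have h1 : a * (d * b) <= 1 * (d * C) by apply: ler_pM => //; [exact: mulr_ge0|exact: ler_wpM2l].
  have h2 : a * (d * b) * c <= 1 * (d * C) * 3 by apply: ler_pM => //; rewrite !mulr_ge0.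
  have := mulr_ge0 d0 C0; lra.
have E := @cint_swap R H (fun s => cabs (q s)) (fun tau => 2 * C * \1_D tau) mHr mHi
  (cintegrable_cabs measurableT Iq) (integrable_itvoo_cst 0 x (2 * C)).
transitivity (cint setT (fun s => cint setT (fun t => H (s, t)))).
  have Ik s : mu.-integrable setT (EFin \o k s).
    apply: (@integrable_bound R setT _ _ measurableT _ _ (integrable_itvoo_cst 0 x (2 * C))).
      exact: (measurableT_comp mk (@pair1_measurable _ _ MR MR s)).
    by move=> t _; exact: kb.
  rewrite cint_mkcond; apply: eq_cint => s _; rewrite /H /= (cint_realZ _ (Ik s)).
  rewrite mulrA -rmorphM/=; congr (_%:C * _).
  have -> : \int[mu]_t k s t = 2^-1 * \int[mu]_t (\1_D s * (\1_D t * phi t) * kk eps t s (x - s)).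
    by apply: (Rintegral_half (Ik s)).
  case: (boolP (s \in D)) => sD; last first.
    have Ds0 : \1_D s = 0 :> R by rewrite indicE (negPf sD).
    rewrite (@eq_Rintegral _ _ _ mu setT (fun=> 0)); last first.
      by move=> t _; rewrite Ds0 !mul0r.
    by rewrite (Rintegral0 measurableT) Ds0 mul0r mulr0.
  have Ds1 : \1_D s = 1 :> R by rewrite indicE sD.
  rewrite (@eq_Rintegral _ _ _ mu setT (fun t => \1_D t * (phi t * kk eps t s (x - s)))); last first.
    by move=> t _; rewrite Ds1 mul1r -mulrA.
  rewrite Rintegral_indicM Ds1.
  move: sD; rewrite inE/= in_itv/= => /andP[s0 sx].
  have xs0 : 0 < x - s by rewrite subr_gt0.
  have sxs : s + (x - s) <= x by rewrite addrC subrK.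
  by rewrite (Rint_kk s0 xs0 sxs) mul1r mulKf.
rewrite E; last first.
  by move=> s t; rewrite /H cabsM cabsR mulrC ler_wpM2l ?cabs_ge0//; exact: kb.
rewrite [RHS]cint_mkcond; apply: eq_cint => tau _.
case: (boolP (tau \in D)) => tD; last first.
  have Dt0 : \1_D tau = 0 :> R by rewrite indicE (negPf tD).
  rewrite Dt0 mul0r; apply: (cint0 measurableT) => s _.
  by rewrite /H /k/= Dt0 mul0r mulr0 mul0r mulr0 mul0r.
have tD1 : \1_D tau = 1 :> R by rewrite indicE tD.
rewrite tD1 mul1r /G1.
move: tD; rewrite inE/= in_itv/= => /andP[t0 tx].
rewrite -!cint_step.
have Istep b : cintegrable setT (fun t => (step t b)%:C * q t).
  apply: (@cintegrable_bound R setT _ _ measurableT _ _ (cintegrable_cabs measurableT Iq)).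
    apply: cmeasM; last exact: cintegrable_cmeas.
    by apply: cmeas_real; apply: measurable_step.
  by move=> t _; exact: cabs_step_le.
have IZ := cintegrableZ eps%:C measurableT (Istep ((x - tau) / 2)).
rewrite -(cintZ _ measurableT (Istep ((x - tau) / 2))).
rewrite -(cintD measurableT (Istep _) IZ).
rewrite mulrA -rmorphM/= -(cintZ _ measurableT (cintegrableD measurableT (Istep _) IZ)).
apply: eq_cint => s _; rewrite /H /k /=.
case: (boolP (0 < s < pi)) => [/andP[s0 spi]|/qsupp ->]; last by rewrite !mulr0 addr0 mulr0.
rewrite tD1 mul1r mulrA -mulrDl mulrA -rmorphM -rmorphD -rmorphM/=; congr (_%:C * _).
rewrite (kk_diag _ _ tx).
have [sx|xs] := ltP s x; first by rewrite (indic_oo1 s0 sx); ring.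
by rewrite (indic_oo0 _ xs) (step_diag0 _ t0 tx xs); ring.
Qed.

(** The outer exchange of [s] and [tau], once the transform at fixed [s] has been rewritten by the
    last hypothesis. *)
Let transform2_swap :
  measurable_fun setT (fun z : MR * MR => 2^-1 * (\1_D z.1 * (\1_D z.2 * phi z.2)) : R) ->
  (forall s tau, `|2^-1 * (\1_D s * (\1_D tau * phi tau))| <= C * \1_D tau) ->
  (forall s, D s -> (sn r (x - s))%:C * cint setT (fun t => (phi t)%:C * F s t) =
    cint setT (fun tau => (2^-1 * (\1_D tau * phi tau))%:C * kJ eps F s tau (x - s))) ->
  cint D (fun s => (sn r (x - s))%:C * (q s * cint setT (fun t => (phi t)%:C * F s t))) =
  cint D (fun tau => (phi tau)%:C * G2 eps q F x tau).
Proof.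
pose k (s tau : R) : R := 2^-1 * (\1_D s * (\1_D tau * phi tau)).
rewrite -/(k _ _) => mk kb inner.
have [mqr mqi] := cintegrable_cmeas Iq.
pose B : R := 3 * (M * pi).
have B0 : 0 <= B by rewrite !mulr_ge0// ?(kernel_reg_ge0 regF)// pi_ge0.
have kJB s tau h : cabs (kJ eps F s tau h) <= B by exact: (kJ_le regF).
pose H (z : MR * MR) := (k z.1 z.2)%:C * (q z.1 * kJ eps F z.1 z.2 (x - z.1)).
have m1 : measurable_fun setT (fun z : MR * MR => (z.1 : R)) by exact: measurable_fst.
have m2 : measurable_fun setT (fun z : MR * MR => (z.2 : R)) by exact: measurable_snd.
have mx1 : measurable_fun setT (fun z : MR * MR => x - z.1 : R).
  by apply: measurable_funB => //; exact: measurable_cst.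
have [mJr mJi] := @measurable_kJ F M regF eps _ _ _ _ _ m1 m2 mx1.
have mq1 : measurable_fun setT (fun z : MR * MR => Re (q z.1)) by exact: (measurableT_comp mqr m1).
have mq2 : measurable_fun setT (fun z : MR * MR => Im (q z.1)) by exact: (measurableT_comp mqi m1).
have mHr : measurable_fun setT (Re \o H).
  apply: (eq_measurable_fun (fun z : MR * MR => k z.1 z.2 *
     (Re (q z.1) * Re (kJ eps F z.1 z.2 (x - z.1)) - Im (q z.1) * Im (kJ eps F z.1 z.2 (x - z.1))))).
    by move=> z _; rewrite /= ReZ ReM.
  apply: measurable_funM; first exact: mk.
  by apply: measurable_funB; apply: measurable_funM.
have mHi : measurable_fun setT (Im \o H).
  apply: (eq_measurable_fun (fun z : MR * MR => k z.1 z.2 *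
     (Re (q z.1) * Im (kJ eps F z.1 z.2 (x - z.1)) + Im (q z.1) * Re (kJ eps F z.1 z.2 (x - z.1))))).
    by move=> z _; rewrite /= ImZ ImM.
  apply: measurable_funM; first exact: mk.
  by apply: measurable_funD; apply: measurable_funM.
have Hb s tau : cabs (H (s, tau)) <= cabs (q s) * (B * C * \1_D tau).
  rewrite -[H _]/((k s tau)%:C * (q s * kJ eps F s tau (x - s))) !cabsM cabsR mulrCA; apply: ler_wpM2l; first exact: cabs_ge0.
  rewrite [leLHS]mulrC -[leRHS]mulrA; apply: ler_pM; [exact: cabs_ge0|exact: normr_ge0|exact: kJB|exact: kb].
have E := @cint_swap R H (fun s => cabs (q s)) (fun tau => B * C * \1_D tau) mHr mHi
  (cintegrable_cabs measurableT Iq) (integrable_itvoo_cst 0 x (B * C)) Hb.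
transitivity (cint setT (fun s => cint setT (fun t => H (s, t)))).
  rewrite cint_mkcond; apply: eq_cint => s _.
  case: (boolP (s \in D)) => sD; last first.
    have Ds0 : \1_D s = 0 :> R by rewrite indicE (negPf sD).
    rewrite Ds0 mul0r; apply/esym/(cint0 measurableT) => tau _.
    by rewrite /H /k/= Ds0 mul0r mulr0 mul0r.
  have Ds1 : \1_D s = 1 :> R by rewrite indicE sD.
  rewrite Ds1 mul1r mulrCA inner; last by rewrite inE in sD.
  rewrite -cintZ; last 2 first.
  - exact: measurableT.
  - apply: (@cintegrable_bound R setT _ _ measurableT _ _ (integrable_itvoo_cst 0 x (B * C))).
      apply: cmeasM.
        apply: cmeas_real; apply: measurable_funM; first exact: measurable_cst.
        by apply: measurable_funM => //; exact: mindic.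
      by split; [exact: (measurableT_comp mJr (@pair1_measurable _ _ MR MR s))|
          exact: (measurableT_comp mJi (@pair1_measurable _ _ MR MR s))].
    move=> tau _; rewrite cabsM cabsR [leLHS]mulrC -[leRHS]mulrA.
    apply: ler_pM; [exact: cabs_ge0|exact: normr_ge0|exact: kJB|].
    by have := kb s tau; rewrite /k Ds1 mul1r.
  by apply: eq_cint => tau _; rewrite /H /k /= Ds1 mul1r mulrCA.
rewrite E [RHS]cint_mkcond; apply: eq_cint => tau _.
case: (boolP (tau \in D)) => tD; last first.
  have Dt0 : \1_D tau = 0 :> R by rewrite indicE (negPf tD).
  rewrite Dt0 mul0r; apply: (cint0 measurableT) => s _.
  by rewrite /H /k/= Dt0 mul0r !mulr0 mul0r.
have tD1 : \1_D tau = 1 :> R by rewrite indicE tD.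
rewrite tD1 mul1r /G2 mulrA -rmorphM/=.
move: tD; rewrite inE/= in_itv/= => /andP[t0 tx].
rewrite -(cintZ _ measurableT (cintegrable_q_kJ x tau eps1 Iq regF)).
apply: eq_cint => s _; rewrite /H /k /= tD1 mul1r.
case: (boolP (0 < s < pi)) => [/andP[s0 spi]|/qsupp ->]; last by rewrite !mul0r !mulr0.
have [sx|xs] := ltP s x.
  rewrite (indic_oo1 s0 sx) mul1r; have -> : Num.max (x - s) 0 = x - s.
    by apply/max_idPl; rewrite subr_ge0 ltW.
  by congr (_%:C * _); rewrite mulrC.
rewrite (indic_oo0 _ xs) mul0r mulr0 mul0r; have -> : Num.max (x - s) 0 = 0.
  by apply/max_idPr; rewrite subr_le0.
by rewrite (kJ0 _ _ regF (ltW t0)) !mulr0.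
Qed.

(** Two exchanges: at fixed [s], [Rint_kk] with [h = x - s] and Fubini in [t] and [tau] produce
    [kJ]; then [transform2_swap] exchanges [s] and [tau]. The condition [t + h <= x] holds because
    [F s t] vanishes unless [t < s]. *)
Lemma transform2 :
  cint D (fun s => (sn r (x - s))%:C * (q s * cint setT (fun t => (phi t)%:C * F s t))) =
  cint D (fun tau => (phi tau)%:C * G2 eps q F x tau).
Proof.
have [mFr mFi FM Fsupp _] := regF.
have [mqr mqi] := cintegrable_cmeas Iq.
have M0 := kernel_reg_ge0 regF.
have m1 : measurable_fun setT (fun z : MR * MR => (z.1 : R)) by exact: measurable_fst.
have m2 : measurable_fun setT (fun z : MR * MR => (z.2 : R)) by exact: measurable_snd.
have mF := kernel_reg_cmeas regF.
have IF := kernel_reg_cintegrable regF.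
have Fs s t : ~~ (0 < t < s) -> F s t = 0.
  by move=> h; apply: Fsupp; rewrite negb_and h.
pose g (tau t h : R) : R := 2^-1 * (\1_D tau * phi tau * kk eps tau t h).
have gb tau t h : `|g tau t h| <= 2 * C * \1_D tau.
  rewrite /g !normrM (ger0_norm half_ge0) (ger0_norm (indic_ge0 tau)).
  apply: half_mul3_le; [exact: normr_ge0|exact: phiC|exact: normr_ge0|exact: kk3|by rewrite indicE].
have mg (h : R) : measurable_fun setT (fun z : MR * MR => g z.2 z.1 h).
  apply: measurable_funM; first exact: measurable_cst.
  apply: measurable_funM; last exact: (measurable_kk _ m2 m1 (measurable_cst _)).
  by apply: measurable_funM; [exact: (measurableT_comp mindic m2)|exact: (measurableT_comp mphi m2)].
have kkJ s tau h := (cint_kk regF eps s tau h).2.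
have Ikk s tau h := (cint_kk regF eps s tau h).1.
have inner s : D s ->
    (sn r (x - s))%:C * cint setT (fun t => (phi t)%:C * F s t) =
    cint setT (fun tau => (2^-1 * (\1_D tau * phi tau))%:C * kJ eps F s tau (x - s)).
  rewrite /= in_itv/= => /andP[s0 sx].
  pose H (z : MR * MR) := (g z.2 z.1 (x - s))%:C * F s z.1.
  have mHr : measurable_fun setT (Re \o H).
    apply: (eq_measurable_fun (fun z : MR * MR => g z.2 z.1 (x - s) * Re (F s z.1))).
      by move=> z _; rewrite /= ReZ.
    by apply: measurable_funM; [exact: mg|exact: (measurableT_comp (mF s).1 (@measurable_fst _ _ MR MR))].
  have mHi : measurable_fun setT (Im \o H).
    apply: (eq_measurable_fun (fun z : MR * MR => g z.2 z.1 (x - s) * Im (F s z.1))).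
      by move=> z _; rewrite /= ImZ.
    by apply: measurable_funM; [exact: mg|exact: (measurableT_comp (mF s).2 (@measurable_fst _ _ MR MR))].
  have E := @cint_swap R H (fun t => cabs (F s t)) (fun tau => 2 * C * \1_D tau) mHr mHi
    (cintegrable_cabs measurableT (IF s)) (integrable_itvoo_cst 0 x (2 * C)).
  have Iphi' : cintegrable setT (fun t => (phi t)%:C * F s t).
    apply: (@cintegrable_bound R setT _ _ measurableT _ _ (integrableRZ C measurableT (cintegrable_cabs measurableT (IF s)))).
      exact: (cmeasM (cmeas_real mphi) (mF s)).
    by move=> t _; rewrite cabsM cabsR ler_wpM2r ?cabs_ge0.
  rewrite -(cintZ _ measurableT Iphi').
  transitivity (cint setT (fun t => cint setT (fun tau => H (t, tau)))).
    apply: eq_cint => t _; rewrite /H /=.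
    have Ig : mu.-integrable setT (EFin \o (fun tau => g tau t (x - s))).
      apply: (@integrable_bound R setT _ _ measurableT _ _ (integrable_itvoo_cst 0 x (2 * C))).
        exact: (measurableT_comp (mg (x - s)) (@pair1_measurable _ _ MR MR t)).
      by move=> tau _; exact: gb.
    rewrite (cint_realZ _ Ig).
    rewrite mulrA -rmorphM/=.
    case: (boolP (0 < t < s)) => [/andP[t0 ts]|/Fs ->]; last by rewrite !mulr0.
    congr (_%:C * _).
    have -> : \int[mu]_tau g tau t (x - s) = 2^-1 * \int[mu]_tau (\1_D tau * phi tau * kk eps tau t (x - s)).
      by apply: (Rintegral_half Ig).
    rewrite (@eq_Rintegral _ _ _ mu setT (fun tau => \1_D tau * (phi tau * kk eps tau t (x - s)))); last first.
      by move=> tau _; rewrite -mulrA.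
    have xs0 : 0 < x - s by rewrite subr_gt0.
    have sxs : t + (x - s) <= x by lra.
    by rewrite Rintegral_indicM (Rint_kk t0 xs0 sxs) mulKf.
  rewrite E; last first.
    by move=> t tau; rewrite /H cabsM cabsR mulrC ler_wpM2l ?cabs_ge0//; exact: gb.
  apply: eq_cint => tau _; rewrite /H /= -kkJ -(cintZ _ measurableT (Ikk s tau (x - s))).
  apply: eq_cint => t _; rewrite mulrA -rmorphM/= /g; congr (_%:C * _); ring.
have kb s tau : `|2^-1 * (\1_D s * (\1_D tau * phi tau))| <= C * \1_D tau.
  rewrite !normrM (ger0_norm half_ge0) (ger0_norm (indic_ge0 tau)).
  apply: half_mul1_le; [exact: normr_ge0|exact: phiC|exact: normr_ge0|exact: indic_le1|by rewrite indicE].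
have mkr : measurable_fun setT (fun z : MR * MR => 2^-1 * (\1_D z.1 * (\1_D z.2 * phi z.2)) : R).
  apply: measurable_funM; first exact: measurable_cst.
  apply: measurable_funM; first exact: (measurableT_comp mindic m1).
  by apply: measurable_funM; [exact: (measurableT_comp mindic m2)|exact: (measurableT_comp mphi m2)].
exact: (transform2_swap mkr kb inner).
Qed.

End transform.
End transforms.

(** * Continuity and size of [G1] and [G2] *)

Section integral_equation.
Variable R : realType.
Local Notation mu := (@lebesgue_measure R).
Local Notation MR := (measurableTypeR R).
Local Notation Re := (@complex.Re R).
Local Notation Im := (@complex.Im R).

(** An integrable [f] gives no Lipschitz bound; continuity of the primitive comes from absolute
    continuity of the integral. *)
Lemma cprim_near (f : R -> R[i]) (b e : R) : cintegrable setT f -> 0 < e ->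
  exists2 d, 0 < d & forall b', `|b' - b| < d -> cabs (cprim f b' - cprim f b) < e.
Proof.
move=> If e0; have Ia := cintegrable_cabs measurableT If.
have [d [d0 Hd]] := integral_normr_continuous Ia e0.
exists d => //.
have key a c : a <= c -> c - a < d -> cabs (cprim f c - cprim f a) < e.
  move=> ac cad; rewrite cprimB//.
  apply: le_lt_trans (le_cabs_cint _ _) _ => //.
    exact: (cintegrableS measurableT _ (@subsetT _ _) If).
  rewrite (@eq_Rintegral _ _ _ mu `]a, c]%classic (fun t => `|(@cabs R \o f) t|)); last first.
    by move=> t _; rewrite /= ger0_norm ?cabs_ge0.
  apply: Hd => //.
  have := lebesgue_measure_itv `]a, c]; rewrite /= lte_fin => ->.
  by case: ifP => _; rewrite ?lte_fin// -EFinB lte_fin.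
move=> b' b'd; have [bb|/ltW bb] := leP b b'.
  by apply: key => //; apply: le_lt_trans b'd; exact: ler_norm.
rewrite -cabsN opprB; apply: key => //.
by apply: le_lt_trans b'd; rewrite distrC; exact: ler_norm.
Qed.

Lemma cabs_continuous (f : R -> R[i]) (t : R) :
  (forall e, 0 < e -> exists2 d, 0 < d & forall t', `|t' - t| < d -> cabs (f t' - f t) < e) ->
  {for t, continuous (Re \o f)} /\ {for t, continuous (Im \o f)}.
Proof.
move=> H; split; apply/cvgrPdist_lt => e /H[d d0 Hd]; apply/nbhs_ballP; exists d => //= t';
  rewrite /ball/= distrC => /Hd; apply: le_lt_trans; rewrite distrC.
- by rewrite -ReB; exact: normRe_le_cabs.
- by rewrite -ImB; exact: normIm_le_cabs.
Qed.

Lemma cabs_subDD (a b c d : R[i]) :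
  cabs (a + b - (c + d)) <= cabs (a - c) + cabs (b - d).
Proof. by rewrite opprD addrACA; exact: cabsD. Qed.

Lemma cprim_abs_le (f : R -> R[i]) (b : R) : cintegrable setT f ->
  cabs (cprim f b) <= \int[mu]_t cabs (f t).
Proof.
move=> If; have Ia := cintegrable_cabs measurableT If.
apply: le_trans (le_cabs_cint _ _) _ => //.
  exact: (cintegrableS measurableT _ (@subsetT _ _) If).
rewrite Rintegral_mkcond; apply: le_Rintegral => //.
- have := Ia; rewrite -restrict_EFin => ?; apply/integrable_restrict => //; rewrite setTI.
  exact: integrable_subT.
- by move=> t _; rewrite patchE; case: ifP => // _; exact: cabs_ge0.
Qed.

Section kernel_estimates.
Variables (F : R -> R -> R[i]) (M : R).
Hypothesis regF : kernel_reg F M.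
Variables (eps s m : R).
Hypothesis eps1 : `|eps| <= 1.
Hypothesis Fm : forall t, cabs (F s t) <= m.

Let m0 : 0 <= m. Proof. exact: le_trans (cabs_ge0 _) (Fm 0). Qed.

Let lip (a b : R) : cabs (cprim (F s) a - cprim (F s) b) <= m * `|a - b|.
Proof. exact: (cprim_lip (kernel_reg_cmeas regF s) Fm (kernel_reg_supp regF s)). Qed.

(** Three primitives with Lipschitz constant [m], each at an argument that moves by at most the two
    displacements together: hence [3 * m]. *)
Lemma kJ_lip (tau tau' h h' : R) :
  cabs (kJ eps F s tau h - kJ eps F s tau' h') <= 3 * m * (`|tau - tau'| + `|h - h'|).
Proof.
rewrite /kJ.
have -> : cprim (F s) (tau + h) - cprim (F s) (tau - h) + eps%:C * cprim (F s) (h - tau) -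
   (cprim (F s) (tau' + h') - cprim (F s) (tau' - h') + eps%:C * cprim (F s) (h' - tau')) =
  (cprim (F s) (tau + h) - cprim (F s) (tau' + h')) - (cprim (F s) (tau - h) - cprim (F s) (tau' - h'))
  + eps%:C * (cprim (F s) (h - tau) - cprim (F s) (h' - tau')) by ring.
set L := m * (`|tau - tau'| + `|h - h'|).
have b1 : cabs (cprim (F s) (tau + h) - cprim (F s) (tau' + h')) <= L.
  apply: le_trans (lip _ _) _; apply: ler_wpM2l => //.
  by rewrite opprD addrACA ler_normD.
have b2 : cabs (cprim (F s) (tau - h) - cprim (F s) (tau' - h')) <= L.
  apply: le_trans (lip _ _) _; apply: ler_wpM2l => //.
  rewrite (_ : tau - h - (tau' - h') = (tau - tau') - (h - h')); last by ring.
  exact: ler_normB.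
have b3 : cabs (cprim (F s) (h - tau) - cprim (F s) (h' - tau')) <= L.
  apply: le_trans (lip _ _) _; apply: ler_wpM2l => //.
  rewrite (_ : h - tau - (h' - tau') = (h - h') - (tau - tau')); last by ring.
  by apply: le_trans (ler_normB _ _) _; rewrite addrC.
have b4 : cabs (eps%:C * (cprim (F s) (h - tau) - cprim (F s) (h' - tau'))) <= L.
  rewrite cabsM cabsR -[leRHS]mul1r; apply: ler_pM => //; exact: cabs_ge0.
apply: le_trans (cabsD _ _) _; apply: le_trans (lerD (cabsB _ _) b4) _.
rewrite (_ : 3 * m * _ = L + L + L); last by rewrite /L; ring.
by rewrite lerD2r lerD.
Qed.

(** The difference of primitives is at most the mass [m * s], the folded one at most [m * h]. For
    [h = x - s] the sum is [m * x], which makes [pi / 2] the rate in Gronwall's lemma; the crude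
    bound [kJ_le] would give a larger one. *)
Lemma kJ_size (tau h : R) : 0 <= s -> 0 <= tau -> 0 <= h ->
  cabs (kJ eps F s tau h) <= m * (s + h).
Proof.
move=> s0 t0 h0; have [_ _ _ Fsupp _] := regF.
have Fs t : ~~ (0 < t < s) -> F s t = 0.
  by move=> hh; apply: Fsupp; rewrite negb_and hh.
rewrite /kJ mulrDr; apply: le_trans (cabsD _ _) _; apply: lerD.
  exact: (cprim_supp_le s0 (kernel_reg_cmeas regF s) Fm Fs).
rewrite cabsM cabsR -[leRHS]mul1r; apply: ler_pM => //; first exact: cabs_ge0.
apply: le_trans (cprim_max_le (kernel_reg_cmeas regF s) Fm Fs _) _.
by apply: ler_wpM2l => //; rewrite ge_max h0 andbT gerBl.
Qed.

End kernel_estimates.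

Lemma norm_max0 (a b : R) : `|Num.max a 0 - Num.max b 0| <= `|a - b|.
Proof.
case: (leP a 0) => a0; case: (leP b 0) => b0; rewrite ?subrr ?normr0//.
- by rewrite sub0r normrN gtr0_norm// distrC; apply: le_trans (ler_norm _); lra.
- by rewrite subr0 gtr0_norm//; apply: le_trans (ler_norm _); lra.
Qed.

Section equation.
Variables (eps : R) (q : R -> R[i]) (F : R -> R -> R[i]) (M : R).
Hypothesis eps1 : `|eps| <= 1.
Hypothesis Iq : cintegrable setT q.
Hypothesis regF : kernel_reg F M.
Let N1 := \int[mu]_t cabs (q t).
Let N10 : 0 <= N1. Proof. by apply: Rintegral_ge0 => t _; exact: cabs_ge0. Qed.
Let M0 : 0 <= M. Proof. exact: kernel_reg_ge0 regF. Qed.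

Lemma G1_le (x tau : R) : cabs (G1 eps q x tau) <= N1.
Proof.
rewrite /G1 cabsM cabsR ger0_norm ?invr_ge0//.
rewrite ler_pdivrMl//; apply: le_trans (cabsD _ _) _.
rewrite mulr_natl mulr2n; apply: lerD; first exact: cprim_abs_le.
rewrite cabsM cabsR -[leRHS]mul1r; apply: ler_pM => //; first exact: cabs_ge0.
exact: cprim_abs_le.
Qed.

Lemma G1_near (x tau e : R) : 0 < e -> exists2 d, 0 < d &
  forall tau', `|tau' - tau| < d -> cabs (G1 eps q x tau' - G1 eps q x tau) < e.
Proof.
move=> e0.
have [d1 d10 H1] := cprim_near ((x + tau) / 2) Iq e0.
have [d2 d20 H2] := cprim_near ((x - tau) / 2) Iq e0.
exists (Num.min d1 d2); first by rewrite lt_min d10.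
move=> t'; rewrite lt_min => /andP[td1 td2].
have h1 : cabs (cprim q ((x + t') / 2) - cprim q ((x + tau) / 2)) < e.
  apply: H1; rewrite (_ : (x + t') / 2 - (x + tau) / 2 = (t' - tau) / 2); last by field.
  rewrite normrM (ger0_norm (_ : 0 <= 2^-1)) ?invr_ge0//; have := normr_ge0 (t' - tau); lra.
have h2 : cabs (cprim q ((x - t') / 2) - cprim q ((x - tau) / 2)) < e.
  apply: H2; rewrite (_ : (x - t') / 2 - (x - tau) / 2 = - ((t' - tau) / 2)); last by field.
  rewrite normrN normrM (ger0_norm (_ : 0 <= 2^-1)) ?invr_ge0//; have := normr_ge0 (t' - tau); lra.
rewrite /G1 -mulrBr cabsM cabsR ger0_norm ?invr_ge0// ltr_pdivrMl//.
apply: le_lt_trans (cabs_subDD _ _ _ _) _; rewrite mulr_natl mulr2n; apply: ltr_leD => //.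
rewrite -mulrBr cabsM cabsR; apply/ltW; apply: le_lt_trans h2.
by rewrite -[leRHS]mul1r; apply: ler_pM => //; exact: cabs_ge0.
Qed.

Lemma G2_lip (x tau x' tau' : R) :
  cabs (G2 eps q F x tau - G2 eps q F x' tau') <= 2^-1 * (3 * M * (`|tau - tau'| + `|x - x'|)) * N1.
Proof.
rewrite /G2 -mulrBr cabsM cabsR ger0_norm ?invr_ge0// -mulrA ler_pM2l ?invr_gt0//.
have [_ _ FM _ _] := regF.
rewrite -(cintB measurableT (cintegrable_q_kJ x tau eps1 Iq regF) (cintegrable_q_kJ x' tau' eps1 Iq regF)).
rewrite -(@RintegralZl _ _ _ mu setT (fun t => cabs (q t)) _ measurableT (cintegrable_cabs measurableT Iq)).
apply: le_cabs_cint_bound => //.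
- apply: cintegrable_cmeas; apply: (cintegrableD measurableT (cintegrable_q_kJ x tau eps1 Iq regF)).
  exact: (cintegrableN measurableT (cintegrable_q_kJ x' tau' eps1 Iq regF)).
- move=> s _; rewrite -mulrBr cabsM mulrC; apply: ler_wpM2r; first exact: cabs_ge0.
  apply: le_trans (kJ_lip regF eps1 (FM s) _ _ _ _) _.
  apply: ler_wpM2l; first by rewrite mulr_ge0.
  rewrite lerD2l; apply: le_trans (norm_max0 _ _) _.
  by rewrite opprD addrACA subrr addr0.
- exact: (integrableRZ _ measurableT (cintegrable_cabs measurableT Iq)).
Qed.

Lemma G2_le (x tau : R) : cabs (G2 eps q F x tau) <= 2^-1 * (3 * (M * pi)) * N1.
Proof.
rewrite /G2 cabsM cabsR ger0_norm ?invr_ge0// -mulrA ler_pM2l ?invr_gt0//.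
rewrite -(@RintegralZl _ _ _ mu setT (fun t => cabs (q t)) _ measurableT (cintegrable_cabs measurableT Iq)).
apply: le_cabs_cint_bound => //.
- exact: (cintegrable_cmeas (cintegrable_q_kJ x tau eps1 Iq regF)).
- move=> s _; rewrite cabsM mulrC; apply: ler_wpM2r; first exact: cabs_ge0.
  exact: (kJ_le regF).
- exact: (integrableRZ _ measurableT (cintegrable_cabs measurableT Iq)).
Qed.

Lemma G2_near (x tau e : R) : 0 < e -> exists2 d, 0 < d &
  forall tau', `|tau' - tau| < d -> cabs (G2 eps q F x tau' - G2 eps q F x tau) < e.
Proof.
move=> e0; pose L := 2^-1 * (3 * M) * N1 + 1.
have L0 : 0 < L by rewrite ltr_wpDl// !mulr_ge0// invr_ge0.
exists (e / L); first by rewrite divr_gt0.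
move=> t'; rewrite ltr_pdivlMr// => h; apply: le_lt_trans (G2_lip _ _ _ _) _.
rewrite subrr normr0 addr0; apply: le_lt_trans h.
rewrite /L mulrDr mulr1 [leLHS](_ : _ = `|t' - tau| * (2^-1 * (3 * M) * N1)); last by ring.
by rewrite lerDl.
Qed.

Lemma G_continuous (x tau : R) :
  {for tau, continuous (fun t => Re (G1 eps q x t + G2 eps q F x t))} /\
  {for tau, continuous (fun t => Im (G1 eps q x t + G2 eps q F x t))}.
Proof.
apply: (@cabs_continuous (fun t => G1 eps q x t + G2 eps q F x t)) => e e0.
have e20 : 0 < e / 2 by rewrite divr_gt0.
have [d1 d10 H1] := G1_near x tau e20; have [d2 d20 H2] := G2_near x tau e20.
exists (Num.min d1 d2); first by rewrite lt_min d10.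
move=> t'; rewrite lt_min => /andP[/H1 h1 /H2 h2].
apply: le_lt_trans (cabs_subDD _ _ _ _) _.
by rewrite (splitr e); exact: ltrD.
Qed.

End equation.
End integral_equation.

(** * From vanishing moments to the Goursat equation *)

Section kernel_equation.
Variable R : realType.
Local Notation mu := (@lebesgue_measure R).
Local Notation MR := (measurableTypeR R).
Local Notation Re := (@complex.Re R).
Local Notation Im := (@complex.Im R).

Lemma cintegrable_bounded_itv (x B : R) (f : R -> R[i]) : 0 < x -> cmeas `]0, x[ f ->
  (forall t, cabs (f t) <= B) -> cintegrable `]0, x[ f.
Proof.
move=> x0 [mr mi] fB; split; apply: (@integrable_bounded_itv R x x0 _ B) => // t _.
- exact: le_trans (normRe_le_cabs _) (fB _).
- exact: le_trans (normIm_le_cabs _) (fB _).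
Qed.

Lemma cmeas_sub (D : set R) (f : R -> R[i]) : cmeas setT f -> cmeas D f.
Proof. by move=> [mr mi]; split; exact: measurable_funTS. Qed.

Lemma cutq_cintegrable (q : R -> R[i]) : cintegrable `]0, pi[ q -> cintegrable setT (cutq q).
Proof.
move=> [Ir Ii]; split.
- have -> : EFin \o (Re \o cutq q) = (EFin \o (Re \o q)) \_ `]0, pi[.
    apply/funext => t /=; rewrite patchE mem_setE in_itv/= /cutq.
    by case: ifP.
  by apply/integrable_restrict => //; rewrite setTI.
- have -> : EFin \o (Im \o cutq q) = (EFin \o (Im \o q)) \_ `]0, pi[.
    apply/funext => t /=; rewrite patchE mem_setE in_itv/= /cutq.
    by case: ifP.
  by apply/integrable_restrict => //; rewrite setTI.
Qed.

Lemma cutq_supp (q : R -> R[i]) s : ~~ (0 < s < pi) -> cutq q s = 0.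
Proof. by rewrite /cutq => /negPf ->. Qed.

Lemma cint_cutK (phi : R -> R) (K : R -> R -> R[i]) (s : R) : s <= pi ->
  cintegral 0 s (fun t => K s t * (phi t)%:C) =
  cint setT (fun t => (phi t)%:C * cutK K s t).
Proof.
move=> sp; rewrite -[LHS]/(cint `]0, s[ (fun t => K s t * (phi t)%:C)) cint_mkcond.
apply: eq_cint => t _; rewrite /cutK sp andbT indicE mem_setE in_itv/=.
by case: ifP => _; rewrite ?mul1r ?mul0r ?mulr0// mulrC.
Qed.

Section moment.
Variables (eps r x C : R) (phi Phi : R -> R).
Hypothesis eps1 : `|eps| <= 1.
Hypothesis hx : 0 < x <= pi.
Hypothesis cphi : continuous phi.
Hypothesis phiC : forall t, `|phi t| <= C.
Hypothesis dPhi : forall t : R, is_derive t 1 Phi (phi t).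
Hypothesis Phi0 : Phi 0 = 0.
Hypothesis PhiN : forall t, Phi (- t) = - (eps * Phi t).
Hypothesis PhiD : forall t h, Phi (t + h) - Phi (t - h) = 2 * (sn r h * phi t).
Variables (q : R -> R[i]) (K : R -> R -> R[i]) (M : R) (y : R -> R[i]) (y0 y1 : R[i]).
Hypothesis Iq : cintegrable `]0, pi[ q.
Hypothesis regK : kernel_reg (cutK K) M.
Hypothesis ivp : ivp_solution q (r ^+ 2)%:C y0 y1 y.
Hypothesis phiE : forall s, (cos (r * s))%:C * y0 + (sn r s)%:C * y1 = (phi s)%:C.
Hypothesis yE : forall s, 0 <= s <= pi ->
  y s = (phi s)%:C + cintegral 0 s (fun t => K s t * (phi t)%:C).
Local Notation D := (`]0, x[%classic : set R).
Let F := cutK K.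
Let x0 : 0 < x. Proof. by case/andP: hx. Qed.
Let mphi : measurable_fun setT phi. Proof. exact: continuous_measurable_fun. Qed.
Let C0 : 0 <= C. Proof. exact: le_trans (normr_ge0 _) (phiC 0). Qed.

Let T s := cint setT (fun t => (phi t)%:C * F s t).

Let T_cmeas : cmeas setT T.
Proof.
have [mFr mFi _ _ _] := regK.
have m2 : measurable_fun setT (fun z : MR * MR => phi z.2).
  exact: (measurableT_comp mphi (@measurable_snd _ _ MR MR)).
split.
- apply: (@measurable_Rintegral_param R _ MR (fun z => Re ((phi z.2)%:C * F z.1 z.2))).
  apply: (eq_measurable_fun (fun z : MR * MR => phi z.2 * Re (F z.1 z.2))).
    by move=> z _; rewrite ReZ.
  by apply: measurable_funM; [exact: m2|exact: mFr].
- apply: (@measurable_Rintegral_param R _ MR (fun z => Im ((phi z.2)%:C * F z.1 z.2))).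
  apply: (eq_measurable_fun (fun z : MR * MR => phi z.2 * Im (F z.1 z.2))).
    by move=> z _; rewrite ImZ.
  by apply: measurable_funM; [exact: m2|exact: mFi].
Qed.

Let T_le s : cabs (T s) <= C * (M * pi).
Proof.
have [_ _ FM _ _] := regK.
have M0 := kernel_reg_ge0 regK.
have b t : cabs ((phi t)%:C * F s t) <= (C * M) * \1_(`]0, pi[) t.
  rewrite cabsM cabsR indicE; case: (boolP (0 < t < pi)) => h.
    rewrite mem_set ?mulr1; last by rewrite /= in_itv.
    by apply: ler_pM; [exact: normr_ge0|exact: cabs_ge0|exact: phiC|exact: FM].
  by rewrite /F (kernel_reg_supp regK s h) cabs0 mulr0 !mulr_ge0.
have mm : cmeas setT (fun t => (phi t)%:C * F s t).
  exact: (cmeasM (cmeas_real mphi) (kernel_reg_cmeas regK s)).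
apply: le_trans (le_cabs_cint_bound measurableT mm (fun t _ => b t) (integrable_itvoo_cst 0 pi (C * M))) _.
rewrite mulrA; under eq_Rintegral do rewrite mulrC.
rewrite Rintegral_indicM Rintegral_cst//.
by have := lebesgue_measure_itv `]0, (pi : R)[; rewrite /= lte_fin pi_gt0 => ->; rewrite /= subr0.
Qed.

Let IqT : cintegrable setT (cutq q). Proof. exact: cutq_cintegrable. Qed.

(** With [y = phi + T] on both sides of the Volterra equation the free term [phi x] cancels. What
    remains equates the moment of [F x] with the two integrals that [transform1] and [transform2]
    rewrite as moments of [G1] and [G2]. *)
Lemma kernel_moment :
  cintegrable D (fun tau => (phi tau)%:C *
     (F x tau - (G1 eps (cutq q) x tau + G2 eps (cutq q) F x tau))) /\
  cint D (fun tau => (phi tau)%:C *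
     (F x tau - (G1 eps (cutq q) x tau + G2 eps (cutq q) F x tau))) = 0.
Proof.
have [x0' xpi] := andP hx.
have vol := ivp_volterra Iq ivp hx.
rewrite phiE in vol.
have xx : 0 <= x <= pi by rewrite ltW.
have : cint setT (fun t => (phi t)%:C * F x t) =
    cint D (fun s => (sn r (x - s))%:C * (q s * y s)).
  have := yE xx; rewrite vol cint_cutK// => /addrI; exact: esym.
have [Bs HBs] := ac_fun_bounded (ltW x0) (ac_fun_sn_refl r x (ltW x0)).
have Bs0 : 0 <= Bs by apply: le_trans (normr_ge0 _) (HBs 0 _); rewrite lexx ltW.
have msn : measurable_fun setT (fun s : R => sn r (x - s)).
  apply: continuous_measurable_fun => s.
  apply: (@continuous_comp _ _ _ (fun s : R => x - s)); last exact: continuous_sn.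
  by apply: cvgB; [exact: cvg_cst|exact: cvg_id].
have IqD : cintegrable D (cutq q) by exact: (cintegrableS measurableT _ (@subsetT _ _) IqT).
have IaD := cintegrable_cabs (measurable_itv _) IqD.
have HBsD s : D s -> `|sn r (x - s)| <= Bs.
  by rewrite /= in_itv/= => /andP[? ?]; apply: HBs; rewrite !ltW.
have I1 : cintegrable D (fun s => (sn r (x - s) * phi s)%:C * cutq q s).
  apply: (@cintegrable_bound R D _ _ (measurable_itv _) _ _ (integrableRZ (Bs * C) (measurable_itv _) IaD)).
    apply: cmeasM; last exact: cintegrable_cmeas.
    by apply: cmeas_sub; apply: cmeas_real; apply: measurable_funM.
  move=> s Ds; rewrite cabsM cabsR /=; apply: ler_wpM2r; first exact: cabs_ge0.
  by rewrite normrM; apply: ler_pM => //; exact: HBsD.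
have I2 : cintegrable D (fun s => (sn r (x - s))%:C * (cutq q s * T s)).
  apply: (@cintegrable_bound R D _ _ (measurable_itv _) _ _ (integrableRZ (Bs * (C * (M * pi))) (measurable_itv _) IaD)).
    apply: cmeasM; first by apply: cmeas_sub; exact: cmeas_real.
    by apply: cmeasM; [exact: cintegrable_cmeas|exact: cmeas_sub].
  move=> s Ds; rewrite !cabsM cabsR.
  have h : `|sn r (x - s)| * cabs (T s) <= Bs * (C * (M * pi)).
    by apply: ler_pM; [exact: normr_ge0|exact: cabs_ge0|exact: HBsD|exact: T_le].
  rewrite mulrCA mulrC; exact: (ler_wpM2r (cabs_ge0 _) h).
have -> : cint D (fun s => (sn r (x - s))%:C * (q s * y s)) =
    cint D (fun s => (sn r (x - s) * phi s)%:C * cutq q s + (sn r (x - s))%:C * (cutq q s * T s)).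
  apply: eq_cint => s; rewrite /= in_itv/= => /andP[s0 sx].
  have spi : s < pi by exact: lt_le_trans sx xpi.
  rewrite yE; last by rewrite !ltW.
  rewrite cint_cutK; last exact: ltW.
  rewrite -/F -/(T s) /cutq s0 spi /= rmorphM/=; ring.
rewrite (cintD (measurable_itv _) I1 I2).
rewrite (transform1 eps1 hx cphi phiC dPhi Phi0 PhiN PhiD IqT (@cutq_supp q)).
rewrite (transform2 eps1 hx cphi phiC dPhi Phi0 PhiN PhiD IqT (@cutq_supp q) regK).
have [_ _ FM _ _] := regK.
have cm (G : R -> R[i]) : (forall tau e, 0 < e -> exists2 d, 0 < d &
    forall tau', `|tau' - tau| < d -> cabs (G tau' - G tau) < e) -> cmeas setT G.
  move=> HG; split; apply: continuous_measurable_fun => t.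
    by have [] := cabs_continuous (HG t).
  by have [] := cabs_continuous (HG t).
have IphiZ (G : R -> R[i]) B : cmeas setT G -> (forall t, cabs (G t) <= B) ->
    cintegrable D (fun t => (phi t)%:C * G t).
  move=> mG GB; apply: (@cintegrable_bounded_itv x (C * B)) => //.
    by apply: cmeas_sub; apply: cmeasM => //; exact: cmeas_real.
  by move=> t; rewrite cabsM cabsR; apply: ler_pM; [exact: normr_ge0|exact: cabs_ge0|exact: phiC|exact: GB].
have IF := IphiZ _ _ (kernel_reg_cmeas regK x) (FM x).
have J1 := IphiZ _ _ (cm _ (G1_near eps1 IqT x)) (G1_le eps1 IqT x).
have J2 := IphiZ _ _ (cm _ (G2_near eps1 IqT regK x)) (G2_le eps1 IqT regK x).
rewrite -(cintD (measurable_itv _) J1 J2) => E.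
have J12 := cintegrableD (measurable_itv _) J1 J2.
split.
  apply: (eq_cintegrable (measurable_itv _) _ (cintegrableD (measurable_itv _) IF (cintegrableN (measurable_itv _) J12))).
  by move=> t _; rewrite mulrBr mulrDr.
rewrite (@eq_cint R D _ (fun t => (phi t)%:C * F x t -
   ((phi t)%:C * G1 eps (cutq q) x t + (phi t)%:C * G2 eps (cutq q) F x t))); last first.
  by move=> t _; rewrite mulrBr mulrDr.
rewrite (cintB (measurable_itv _) IF J12) -E cint_mkcond.
rewrite (@eq_cint R setT (fun t => (\1_D t)%:C * ((phi t)%:C * F x t)) (fun t => (phi t)%:C * F x t)) ?subrr// => t _.
case: (boolP (0 < t < x)) => [/andP[t0 tx]|h].
  by rewrite (indic_oo1 t0 tx) mul1r.
by rewrite /F /cutK (negPf h) /= !mulr0.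
Qed.

End moment.
(** The open triangle only: outside it the cut-off kernel is 0 and the equation is not expected. *)
Definition solves_eq (eps : R) (q : R -> R[i]) (F : R -> R -> R[i]) : Prop :=
  forall x tau, 0 < tau -> tau < x -> x <= pi -> F x tau = G1 eps q x tau + G2 eps q F x tau.

(** The defect [Z] is bounded and, in [t], continuous on the open interval, so vanishing moments
    force it to vanish pointwise and not just almost everywhere. Here the continuity of the kernel
    selects the representative. *)
Lemma solves_eq_of_moments (eps M : R) (q : R -> R[i]) (F : R -> R -> R[i])
    (psi : R -> R -> R) (r0 : R -> R) :
  `|eps| <= 1 -> cintegrable setT q -> kernel_reg F M ->
  (forall r, continuous (psi r)) -> (forall r t, `|psi r t| <= 1) ->
  (forall r w t, psi r t * cos (w * t) = (psi (r + w) t + psi (r - w) t) / 2) ->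
  (forall x t, 0 < t < x -> 0 < psi (r0 x) t) ->
  (forall x r, 0 < x <= pi -> cint `]0, x[ (fun t => (psi r t)%:C *
     (F x t - (G1 eps q x t + G2 eps q F x t))) = 0) ->
  solves_eq eps q F.
Proof.
move=> eps1 Iq regF cpsi psi1 psiM psi0 mom x tau t0 tx xpi.
have x0 : 0 < x by exact: lt_trans tx.
have hx : 0 < x <= pi by rewrite x0.
have [_ _ FM _ cF] := regF.
pose Z t := F x t - (G1 eps q x t + G2 eps q F x t).
have [B ZB] : exists B, forall t, cabs (Z t) <= B.
  exists (M + (\int[mu]_t cabs (q t) + 2^-1 * (3 * (M * pi)) * \int[mu]_t cabs (q t))) => t.
  apply: le_trans (cabsB _ _) _; apply: lerD; first exact: FM.
  by apply: le_trans (cabsD _ _) _; apply: lerD; [exact: G1_le|exact: G2_le].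
have cmG : cmeas setT (fun t => G1 eps q x t + G2 eps q F x t).
  split; apply: continuous_measurable_fun => t.
    by have [] := G_continuous eps1 Iq regF x t.
  by have [] := G_continuous eps1 Iq regF x t.
have [mFr mFi] := kernel_reg_cmeas regF x.
have tau0x : 0 < tau < x by rewrite t0.
have cZr t : 0 < t < x -> {for t, continuous (Re \o Z)}.
  move=> /andP[t_0 t_x]; have [cr _] := cF x t (lt0r_neq0 t_0) (negbT (lt_eqF t_x)).
  have [Gr _] := G_continuous eps1 Iq regF x t.
  have -> : Re \o Z = (fun t => (Re \o F x) t - Re (G1 eps q x t + G2 eps q F x t)).
    by apply/funext => u; rewrite /= ReB.
  exact: (cvgB cr Gr).
have cZi t : 0 < t < x -> {for t, continuous (Im \o Z)}.
  move=> /andP[t_0 t_x]; have [_ ci] := cF x t (lt0r_neq0 t_0) (negbT (lt_eqF t_x)).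
  have [_ Gi] := G_continuous eps1 Iq regF x t.
  have -> : Im \o Z = (fun t => (Im \o F x) t - Im (G1 eps q x t + G2 eps q F x t)).
    by apply/funext => u; rewrite /= ImB.
  exact: (cvgB ci Gi).
have mZr : measurable_fun `]0, x[ (Re \o Z).
  apply: (eq_measurable_fun (fun t => (Re \o F x) t - Re (G1 eps q x t + G2 eps q F x t))).
    by move=> u _; rewrite /= ReB.
  by apply: measurable_funTS; apply: measurable_funB => //; exact: cmG.1.
have mZi : measurable_fun `]0, x[ (Im \o Z).
  apply: (eq_measurable_fun (fun t => (Im \o F x) t - Im (G1 eps q x t + G2 eps q F x t))).
    by move=> u _; rewrite /= ImB.
  by apply: measurable_funTS; apply: measurable_funB => //; exact: cmG.2.
have Zr : (Re \o Z) tau = 0.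
  apply: (@trig_unique R x x0 (Re \o Z) B psi (r0 x)) => //.
  - by move=> t _; exact: le_trans (normRe_le_cabs _) (ZB _).
  - by move=> t; exact: psi0.
  - move=> r; have /(congr1 Re)/= E := mom x r hx; rewrite -[RHS]E.
    by apply: eq_Rintegral => t _; rewrite ReZ mulrC.
have Zi : (Im \o Z) tau = 0.
  apply: (@trig_unique R x x0 (Im \o Z) B psi (r0 x)) => //.
  - by move=> t _; exact: le_trans (normIm_le_cabs _) (ZB _).
  - by move=> t; exact: psi0.
  - move=> r; have /(congr1 Im)/= E := mom x r hx; rewrite -[RHS]E.
    by apply: eq_Rintegral => t _; rewrite ImZ mulrC.
have : Z tau = 0 by apply: complex_ext.
by rewrite /Z => /eqP; rewrite subr_eq0 => /eqP.
Qed.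

Lemma cexp_i (a : R) : cexp ('i%C * a%:C) = cos a +i* sin a.
Proof.
rewrite /cexp; have -> : 'i%C * a%:C = 0 +i* a :> R[i].
  by apply: complex_ext; rewrite ?ReM ?ImM /=; ring.
by rewrite /= expR0; apply: complex_ext; rewrite ?ReM ?ImM /=; ring.
Qed.

Lemma ccos_real (r t : R) : ccos (r%:C * t%:C) = (cos (r * t))%:C.
Proof.
rewrite /ccos -rmorphM/= cexp_i -mulrN -rmorphN/= cexp_i cosN sinN.
have -> : (cos (r * t) +i* sin (r * t)) + (cos (r * t) +i* (- sin (r * t))) = (cos (r * t))%:C * 2 :> R[i].
  by apply: complex_ext; rewrite ?ReD ?ImD ?ReM ?ImM /=; ring.
by rewrite mulfK// pnatr_eq0.
Qed.

Lemma csin_real (r t : R) : csin (r%:C * t%:C) = (sin (r * t))%:C.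
Proof.
rewrite /csin -rmorphM/= cexp_i -[- ('i%C * _)]mulrN -rmorphN/= cexp_i cosN sinN.
have -> : (cos (r * t) +i* sin (r * t)) - (cos (r * t) +i* (- sin (r * t))) =
    (sin (r * t))%:C * (2 * 'i%C) :> R[i].
  by apply: complex_ext; rewrite ?ReB ?ImB ?ReM ?ImM /=; ring.
rewrite mulfK// mulf_neq0 ?pnatr_eq0//.
by apply/eqP => /(congr1 Im)/= /eqP; rewrite oner_eq0.
Qed.

Lemma csin_div_real (r t : R) : r != 0 -> csin_div r%:C t = (sn r t)%:C.
Proof.
move=> r0; rewrite /csin_div /sn (negPf r0).
have -> : (r%:C == 0) = false.
  by apply/negP => /eqP/(congr1 Re)/= /eqP; rewrite (negPf r0).
by rewrite csin_real -[X in _ / X]/(r%:C) -fmorphV -rmorphM.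
Qed.

(** The positive member of the family is [cos (0 * t) = 1], hence [r0 = 0]. *)
Lemma cosine_kernel_solves (q : R -> R[i]) (K : R -> R -> R[i]) :
  cintegrable `]0, pi[ q -> cosine_kernel q K ->
  exists2 M, kernel_reg (cutK K) M & solves_eq 1 (cutq q) (cutK K).
Proof.
move=> Iq [cK [Cs ivp rep]]; have [M regK] := continuous_on_triangle_reg cK.
exists M => //; have IqT := cutq_cintegrable Iq.
apply: (@solves_eq_of_moments 1 M _ _ (fun r t => cos (r * t)) (fun=> 0)) => //.
- by rewrite normr1.
- move=> r t; apply: (@continuous_comp _ _ _ (fun t : R => r * t)); last exact: continuous_cos.
  by apply: cvgM; [exact: cvg_cst|exact: cvg_id].
- by move=> r t; exact: cos_max.
- by move=> r w t; rewrite (mulrDl r w) (mulrBl t r w) (cosD (r * t)) cosB; field.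
- by move=> x t _; rewrite mul0r cos0.
move=> x r hx.
suff [] : cintegrable `]0, x[ (fun t => (cos (r * t))%:C *
     (cutK K x t - (G1 1 (cutq q) x t + G2 1 (cutq q) (cutK K) x t))) /\
  cint `]0, x[ (fun t => (cos (r * t))%:C *
     (cutK K x t - (G1 1 (cutq q) x t + G2 1 (cutq q) (cutK K) x t))) = 0 by [].
apply: (@kernel_moment 1 r x 1 (fun t => cos (r * t)) (sn r) _ hx _ _ _ _ _ _ q K M (Cs^~ ((r%:C) ^+ 2)) 1 0) => //.
- by rewrite normr1.
- move=> t; apply: (@continuous_comp _ _ _ (fun t : R => r * t)); last exact: continuous_cos.
  by apply: cvgM; [exact: cvg_cst|exact: cvg_id].
- by move=> t; exact: cos_max.
- by move=> t; exact: is_derive_sn.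
- exact: sn0.
- by move=> t; rewrite mul1r /sn; case: ifP => // _; rewrite mulrN sinN mulNr.
- move=> t h; rewrite /sn; case: eqVneq => [->|r0]; first by rewrite mul0r cos0; ring.
  by rewrite !mulrDr mulrN sinD sinB; field.
- by rewrite rmorphXn/=; exact: ivp.
- by move=> s; rewrite mulr1 mulr0 addr0.
- move=> s hs; rewrite rep// ccos_real; congr (_ + _).
  by congr (_ +i* _); apply: eq_Rintegral => t _; rewrite ccos_real.
Qed.

(** The representation yields moments against [sn r], while uniqueness is applied to the family
    [sin (r * t) = r * sn r t], bounded by 1 for all [r]; at [r = 0] the moment is trivially zero.
    The positive member on []0, x[] has [r = pi / x]. *)
Lemma sine_kernel_solves (q : R -> R[i]) (P : R -> R -> R[i]) :
  cintegrable `]0, pi[ q -> sine_kernel q P ->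
  exists2 M, kernel_reg (cutK P) M & solves_eq (-1) (cutq q) (cutK P).
Proof.
move=> Iq [cK [S ivp rep]]; have [M regK] := continuous_on_triangle_reg cK.
exists M => //; have IqT := cutq_cintegrable Iq.
have e1 : `|-1 : R| <= 1 by rewrite normrN normr1.
have cts r : continuous (fun t : R => r * t).
  by move=> t; apply: cvgM; [exact: cvg_cst|exact: cvg_id].
apply: (@solves_eq_of_moments (-1) M _ _ (fun r t => sin (r * t)) (fun x => pi / x)) => //.
- move=> r t; apply: (@continuous_comp _ _ _ (fun t : R => r * t)); last exact: continuous_sin.
  exact: cts.
- by move=> r t; exact: sin_max.
- by move=> r w t; rewrite (mulrDl r w) (mulrBl t r w) (sinD (r * t)) sinB; field.
- move=> x t /andP[t0 tx]; have x0 : 0 < x by exact: lt_trans tx.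
  apply: sin_gt0_pi; rewrite mulr_gt0 ?divr_gt0 ?pi_gt0//=.
  by rewrite mulrAC ltr_pdivrMr// ltr_pM2l ?pi_gt0.
move=> x r hx; have [->|r0] := eqVneq r 0.
  by apply: cint0 => // t _; rewrite mul0r sin0 mul0r.
have [I0 E] : cintegrable `]0, x[ (fun tau => (sn r tau)%:C *
     (cutK P x tau - (G1 (-1) (cutq q) x tau + G2 (-1) (cutq q) (cutK P) x tau))) /\
   cint `]0, x[ (fun tau => (sn r tau)%:C *
     (cutK P x tau - (G1 (-1) (cutq q) x tau + G2 (-1) (cutq q) (cutK P) x tau))) = 0.
  apply: (@kernel_moment (-1) r x `|r^-1| (sn r) (fun t => (1 - cos (r * t)) / r ^+ 2) _ hx _ _ _ _ _ _ q P M (S^~ ((r%:C) ^+ 2)) 0 1) => //.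
  - exact: continuous_sn.
  - by move=> t; rewrite /sn (negPf r0) normrM -[leRHS]mul1r ler_wpM2r// sin_max.
  - move=> t; have h := is_derive_cosr r t.
    have := @is_deriveB R R^o R^o (cst 1) _ t 1 _ _ (is_derive_cst _ _ _) h.
    move=> /(is_derive_scale (r ^+ 2)^-1).
    have -> : (fun s : R => (r ^+ 2)^-1 * ((cst 1 \- (fun s => cos (r * s))) s)) =
       (fun t => (1 - cos (r * t)) / r ^+ 2) by apply/funext => u /=; rewrite mulrC.
    by move=> h'; apply: is_derive_eq; rewrite sub0r opprK mulKf// expf_neq0.
  - by rewrite mulr0 cos0 subrr mul0r.
  - by move=> t; rewrite mulrN cosN mulN1r opprK.
  - move=> t h; rewrite /sn (negPf r0) !mulrDr mulrN cosD cosB; field.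
    exact: r0.
  - by rewrite rmorphXn/=; exact: ivp.
  - by move=> s; rewrite mulr1 mulr0 add0r.
  - move=> s hs; rewrite rep// csin_div_real//; congr (_ + _).
    by congr (_ +i* _); apply: eq_Rintegral => t _; rewrite csin_div_real.
have := cintZ r%:C (measurable_itv _) I0; rewrite E mulr0 => <-.
apply: eq_cint => t _; rewrite mulrA -rmorphM/=; congr (_%:C * _).
by rewrite /sn (negPf r0); field; exact: r0.
Qed.

End kernel_equation.

(** * Gronwall estimates and stability of the kernels *)

Lemma gronwall_step_le (R : realType) (A B x : R) : A * x <= B - A ->
  (B - A) * x <= (B - A) ^+ 2 -> B * x <= (B - A) + (B - A) ^+ 2.
Proof. lra. Qed.

Lemma bisection_eq (R : realType) (A B P : R) : P != 0 ->
  (A + B) / 2 - A + ((A + B) / 2 - A) ^+ 2 / P +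
  (B - (A + B) / 2 + (B - (A + B) / 2) ^+ 2 / P) = B - A + (B - A) ^+ 2 / (2 * P).
Proof. by move=> P0; field; rewrite P0. Qed.

Lemma midpoint_itv (R : realType) (A B : R) : A <= B -> A <= (A + B) / 2 <= B.
Proof. by move=> h; apply/andP; split; lra. Qed.

Section gronwall.
Variable R : realType.
Local Notation mu := (@lebesgue_measure R).
Variables (u : R -> R) (beta : R).
Hypothesis Iu : mu.-integrable setT (EFin \o u).
Hypothesis u0 : forall t, 0 <= u t.
Hypothesis usupp : forall t, t <= 0 -> u t = 0.
Hypothesis beta0 : 0 < beta.

Definition sigma (b : R) : R := \int[mu]_(t in `]-oo, b]) u t.
(** The integrating factor of Gronwall's lemma: formally its derivative is [beta * u * esig], so
    dividing by it turns the integral inequality into a contraction for a weighted supremum norm. *)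
Definition esig (b : R) : R := expR (beta * sigma b).

Lemma sigmaB a b : a <= b -> sigma b - sigma a = \int[mu]_(t in `]a, b]) u t.
Proof.
move=> ab; apply: Rintegral_itvB; rewrite ?bnd_simp//; exact: integrable_subT.
Qed.

Lemma sigma_le a b : a <= b -> sigma a <= sigma b.
Proof. by move=> ab; rewrite -subr_ge0 sigmaB//; apply: Rintegral_ge0. Qed.

Lemma sigma0 : sigma 0 = 0.
Proof.
rewrite /sigma (@eq_Rintegral _ _ _ mu `]-oo, 0]%classic (fun=> 0)); last first.
  by move=> t; rewrite inE/= in_itv/= => /usupp.
exact: Rintegral0.
Qed.

Lemma sigma_total b : sigma b <= \int[mu]_t u t.
Proof.
rewrite /sigma Rintegral_mkcond; apply: le_Rintegral => //.
- rewrite -restrict_EFin; apply/integrable_restrict => //; rewrite setTI.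
  exact: integrable_subT.
- by move=> t _; rewrite patchE; case: ifP.
Qed.

Lemma sigma_ge0 b : 0 <= sigma b.
Proof. by apply: Rintegral_ge0. Qed.

Lemma sigma_continuous : continuous sigma.
Proof.
move=> b; have If : cintegrable setT (fun t => (u t)%:C).
  split => //; apply: (@eq_integrable _ _ _ mu setT measurableT (EFin \o (fun=> 0))) => //.
  exact: integrable0.
have [+ _] := cabs_continuous (fun e => @cprim_near R (fun t => (u t)%:C) b e If).
exact.
Qed.

Let esig_le a b : a <= b -> esig a <= esig b.
Proof. by move=> ab; rewrite /esig ler_expR ler_pM2l// sigma_le. Qed.

Lemma esig_ge1 b : 1 <= esig b.
Proof. by rewrite /esig -expR0 ler_expR mulr_ge0 ?(ltW beta0)// sigma_ge0. Qed.

Let esig_cont : continuous esig.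
Proof.
move=> b; apply: (@continuous_comp _ _ _ (fun b => beta * sigma b)); last exact: continuous_expR.
by apply: cvgM; [exact: cvg_cst|exact: sigma_continuous].
Qed.

Lemma integrable_u_esig : mu.-integrable setT (EFin \o (fun t => u t * esig t)).
Proof.
pose B := expR (beta * \int[mu]_t u t).
apply: (@integrable_bound R setT _ _ measurableT _ _ (integrableRZ B measurableT Iu)).
  apply: measurable_funM; first by have /measurable_int/measurable_EFinP := Iu.
  exact: continuous_measurable_fun.
move=> t _; rewrite ger0_norm; last by rewrite mulr_ge0// (le_trans _ (esig_ge1 t)).
by rewrite mulrC ler_wpM2r// /esig ler_expR ler_pM2l// sigma_total.
Qed.

Let J a b := beta * \int[mu]_(t in `]a, b]) (u t * esig t).

Let JD a b c : a <= b -> b <= c -> J a c = J a b + J b c.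
Proof.
move=> ab bc; rewrite /J -mulrDr; congr (_ * _).
pose P b := \int[mu]_(t in `]-oo, b]) (u t * esig t).
have PB v w : v <= w -> P w - P v = \int[mu]_(t in `]v, w]) (u t * esig t).
  move=> vw; apply: Rintegral_itvB; rewrite ?bnd_simp//.
  exact: (integrable_subT _ integrable_u_esig).
by rewrite -!PB ?(le_trans ab bc)//; ring.
Qed.

(** Formally [J a b] is the increment of [esig]. With [x = beta * (sigma b - sigma a)] it is at most
    [esig b * x], while [1 + x <= expR x] bounds [esig a * x] by the increment; the error is
    quadratic in the increment. *)
Let J1 a b : a <= b -> J a b <= (esig b - esig a) + (esig b - esig a) ^+ 2.
Proof.
move=> ab.
set x := beta * (sigma b - sigma a).
have x0 : 0 <= x by rewrite mulr_ge0 ?(ltW beta0)// subr_ge0 sigma_le.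
have Ja : J a b <= esig b * x.
  rewrite /J /x mulrCA; apply: ler_wpM2l; first exact: ltW.
  rewrite sigmaB// -RintegralZl//; last exact: integrable_subT.
  apply: le_Rintegral => //.
  - exact: (integrable_subT _ integrable_u_esig).
  - exact: (integrable_subT _ (integrableRZ _ measurableT Iu)).
  - move=> t /=; rewrite in_itv/= => /andP[_ tb]; rewrite mulrC ler_wpM2r//.
    exact: esig_le.
have d : esig a * x <= esig b - esig a.
  have -> : esig b = esig a * expR x.
    by rewrite /esig -expRD; congr expR; rewrite /x; ring.
  rewrite -[X in _ - X]mulr1 -mulrBr ler_wpM2l ?expR_ge0//.
  by have := expR_ge1Dx x; lra.
have a1 := esig_ge1 a.
apply: le_trans Ja _.
have xd : x <= esig b - esig a.
  by apply: le_trans d; rewrite -[leLHS]mul1r ler_wpM2r.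
have : (esig b - esig a) * x <= (esig b - esig a) ^+ 2.
  by rewrite expr2 ler_wpM2l// subr_ge0 esig_le.
exact: gronwall_step_le.
Qed.

(** Cutting where [esig] takes its mean value halves the increment on each side and hence the total
    quadratic error. Bisection removes it in the limit, without a chain rule for absolutely
    continuous functions. *)
Let Jn n a b : a <= b ->
  J a b <= (esig b - esig a) + (esig b - esig a) ^+ 2 / 2 ^+ n.
Proof.
elim: n a b => [|n IH] a b ab; first by rewrite expr0 divr1; exact: J1.
have [c] : exists2 c, c \in `[a, b] & esig c = (esig a + esig b) / 2.
  apply: IVT => //; first by apply: continuous_subspaceT; exact: esig_cont.
  have /midpoint_itv/andP[h1 h2] := esig_le ab.
  by rewrite ge_min h1 le_max h2 orbT.
rewrite in_itv/= => /andP[ac cb] ec.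
rewrite (JD ac cb); apply: le_trans (lerD (IH _ _ ac) (IH _ _ cb)) _.
have P0 : 2 ^+ n != 0 :> R by rewrite expf_neq0// pnatr_eq0.
by rewrite ec (exprS 2 n) (bisection_eq _ _ P0) lexx.
Qed.

Lemma integral_u_esig_le x : 0 <= x ->
  beta * \int[mu]_(t in `]-oo, x]) (u t * esig t) <= esig x - 1.
Proof.
move=> x0.
have -> : beta * \int[mu]_(t in `]-oo, x]) (u t * esig t) = J 0 x.
  rewrite /J; congr (_ * _); rewrite Rintegral_mkcond [RHS]Rintegral_mkcond.
  apply: eq_Rintegral => t _; rewrite !patchE !mem_setE !in_itv/=.
  by case: (ltP 0 t) => //= t0; rewrite (usupp t0) mul0r if_same.
have -> : esig x - 1 = esig x - esig 0 by rewrite /esig sigma0 mulr0 expR0.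
apply/ler_addgt0Pr => e e0.
set d := esig x - esig 0.
have cv : (d ^+ 2 * 2^-1 ^+ n) @[n --> \oo] --> (0 : R).
  rewrite -(mulr0 (d ^+ 2)); apply: cvgM; first exact: cvg_cst.
  by apply: cvg_expr; rewrite ger0_norm ?invr_ge0// invf_lt1// ltr1n.
have /cvgrPdist_lt /(_ _ e0) [n _ /(_ n (leqnn n))] := cv.
rewrite /= sub0r normrN => h; apply: le_trans (Jn n x0) _; rewrite lerD2l -/d.
by apply/ltW; rewrite -exprVn; apply: le_lt_trans h; exact: ler_norm.
Qed.

(* Bootstraps the best constant [N] such that [cabs F <= N * esig]. *)
Lemma kernel_gronwall (F : R -> R -> R[i]) (M a : R) : kernel_reg F M -> 0 <= a ->
  (forall N, 0 <= N -> (forall s t, cabs (F s t) <= N * esig s) ->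
    forall x tau, 0 < tau -> tau < x -> x <= pi ->
    cabs (F x tau) <= a + beta * \int[mu]_(t in `]-oo, x]) (u t * (N * esig t))) ->
  forall x tau, cabs (F x tau) <= a * esig x.
Proof.
move=> [_ _ FM Fsupp _] a0 H.
have e0 s : 0 < esig s by exact: lt_le_trans ltr01 (esig_ge1 s).
pose S := [set y | exists s t, y = cabs (F s t) / esig s].
have Sub : ubound S M.
  move=> _ [s [t ->]]; rewrite ler_pdivrMr//; apply: le_trans (FM s t) _.
  by rewrite -[leLHS]mulr1 ler_wpM2l ?esig_ge1// (le_trans (cabs_ge0 _) (FM s t)).
have supS : has_sup S by split; [exists (cabs (F 0 0) / esig 0), 0, 0|exists M].
set N := sup S.
have FN s t : cabs (F s t) <= N * esig s.
  rewrite -ler_pdivrMr//; apply: sup_upper_bound => //.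
  by exists s, t.
have N0 : 0 <= N.
  by have := le_trans (cabs_ge0 _) (FN 0 0); rewrite pmulr_lge0.
have key x tau : 0 < tau -> tau < x -> x <= pi -> cabs (F x tau) <= a + N * (esig x - 1).
  move=> t0 tx xp; apply: le_trans (H N N0 FN x tau t0 tx xp) _; rewrite lerD2l.
  have -> : \int[mu]_(t in `]-oo, x]) (u t * (N * esig t)) =
      N * \int[mu]_(t in `]-oo, x]) (u t * esig t).
    rewrite -RintegralZl//; last exact: (integrable_subT _ integrable_u_esig).
    by apply: eq_Rintegral => t _; rewrite mulrCA.
  rewrite mulrCA ler_wpM2l//; apply: integral_u_esig_le.
  by rewrite ltW// (lt_trans t0).
have [Na|aN] := leP N a.
  move=> x tau; apply: le_trans (FN x tau) _; rewrite ler_wpM2r//; exact: ltW.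
exfalso; pose B := expR (beta * \int[mu]_t u t).
have eB s : esig s <= B by rewrite /esig ler_expR ler_pM2l// sigma_total.
have B1 : 1 <= B by exact: le_trans (esig_ge1 0) (eB 0).
have B0 : 0 < B by exact: lt_le_trans B1.
(* The bound [key] says that each ratio is at most [N - (N - a) / esig s]; as [esig <= B], this
   improves on the supremum [N] by a fixed amount. *)
have : N <= N - (N - a) / B.
  apply: sup_le_ub; first by case: supS.
  move=> _ [s [t ->]]; rewrite ler_pdivrMr//.
  have h : (N - a) / B * esig s <= N - a.
    by rewrite mulrAC ler_pdivrMr// ler_wpM2l// subr_ge0 ltW.
  case: (boolP ((0 < t < s) && (s <= pi))) => [/andP[/andP[t0 ts] sp]|/Fsupp ->].
    by apply: le_trans (key s t t0 ts sp) _; rewrite mulrBr mulr1 mulrBl; lra.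
  rewrite cabs0 mulrBl; have : N * 1 <= N * esig s by rewrite ler_wpM2l// esig_ge1.
  lra.
rewrite lerBrDl gerDr pmulr_lle0 ?invr_gt0// subr_le0 leNgt.
by rewrite aN.
Qed.

End gronwall.

(** * Bounds for a kernel and for the difference of two kernels *)

Section stability.
Variable R : realType.
Local Notation mu := (@lebesgue_measure R).
Local Notation MR := (measurableTypeR R).
Local Notation Re := (@complex.Re R).
Local Notation Im := (@complex.Im R).

Lemma kernel_reg_bound (F : R -> R -> R[i]) (M M' : R) : kernel_reg F M ->
  (forall s t, cabs (F s t) <= M') -> kernel_reg F M'.
Proof. by move=> [? ? _ ? ?] ?; split. Qed.

Lemma kernel_regB (F F' : R -> R -> R[i]) (M M' : R) : kernel_reg F M -> kernel_reg F' M' ->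
  kernel_reg (fun s t => F s t - F' s t) (M + M').
Proof.
move=> [mr mi FM Fs Fc] [mr' mi' FM' Fs' Fc']; split.
- apply: (eq_measurable_fun (fun z : MR * MR => Re (F z.1 z.2) - Re (F' z.1 z.2))).
    by move=> z _; rewrite ReB.
  exact: measurable_funB.
- apply: (eq_measurable_fun (fun z : MR * MR => Im (F z.1 z.2) - Im (F' z.1 z.2))).
    by move=> z _; rewrite ImB.
  exact: measurable_funB.
- by move=> s t; apply: le_trans (cabsB _ _) _; exact: lerD.
- by move=> s t h; rewrite Fs// Fs'// subrr.
- move=> s t t0 ts; have [cr ci] := Fc s t t0 ts; have [cr' ci'] := Fc' s t t0 ts; split.
    have -> : Re \o (fun t => F s t - F' s t) = (fun t => (Re \o F s) t - (Re \o F' s) t).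
      by apply/funext => u; rewrite /= ReB.
    exact: (cvgB cr cr').
  have -> : Im \o (fun t => F s t - F' s t) = (fun t => (Im \o F s) t - (Im \o F' s) t).
    by apply/funext => u; rewrite /= ImB.
  exact: (cvgB ci ci').
Qed.

Lemma cprim_sub (f g : R -> R[i]) (b : R) : cintegrable setT f -> cintegrable setT g ->
  cprim (fun t => f t - g t) b = cprim f b - cprim g b.
Proof.
move=> If Ig; apply: cintB => //.
- exact: (cintegrableS measurableT _ (@subsetT _ _) If).
- exact: (cintegrableS measurableT _ (@subsetT _ _) Ig).
Qed.

Lemma kJ_sub (eps : R) (F F' : R -> R -> R[i]) (M M' s tau h : R) :
  kernel_reg F M -> kernel_reg F' M' ->
  kJ eps (fun s t => F s t - F' s t) s tau h = kJ eps F s tau h - kJ eps F' s tau h.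
Proof.
move=> rF rF'; have I1 := kernel_reg_cintegrable rF s; have I2 := kernel_reg_cintegrable rF' s.
by rewrite /kJ !(cprim_sub _ I1 I2); ring.
Qed.

Lemma G1_sub (eps : R) (q q' : R -> R[i]) (x tau : R) :
  cintegrable setT q -> cintegrable setT q' ->
  G1 eps q x tau - G1 eps q' x tau = G1 eps (fun t => q t - q' t) x tau.
Proof. by move=> Iq Iq'; rewrite /G1 !(cprim_sub _ Iq Iq'); ring. Qed.

(** Bilinearity, as in [q F - q' F' = (q - q') F + q' (F - F')]: each term keeps one small
    factor. *)
Lemma G2_sub (eps : R) (q q' : R -> R[i]) (F F' : R -> R -> R[i]) (M M' x tau : R) :
  `|eps| <= 1 -> cintegrable setT q -> cintegrable setT q' ->
  kernel_reg F M -> kernel_reg F' M' ->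
  G2 eps q F x tau - G2 eps q' F' x tau =
  G2 eps (fun t => q t - q' t) F x tau + G2 eps q' (fun s t => F s t - F' s t) x tau.
Proof.
move=> eps1 Iq Iq' rF rF'; rewrite /G2 -mulrBr -mulrDr; congr (_ * _).
have Id : cintegrable setT (fun t => q t - q' t).
  exact: (cintegrableD measurableT Iq (cintegrableN measurableT Iq')).
have A1 := cintegrable_q_kJ x tau eps1 Iq rF.
have A2 := cintegrable_q_kJ x tau eps1 Iq' rF'.
have A3 := cintegrable_q_kJ x tau eps1 Id rF.
have A4 := cintegrable_q_kJ x tau eps1 Iq' (kernel_regB rF rF').
rewrite -(cintB measurableT A1 A2) -(cintD measurableT A3 A4).
apply: eq_cint => s _; rewrite (kJ_sub _ _ _ _ rF rF'); ring.
Qed.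

(** Unlike in [G2_le], the bound keeps the dependence on [s] and stops at [x], as Gronwall's lemma
    requires. The factor [pi / 2] is the half in [G2] times [x <= pi] from [kJ_size]. *)
Lemma G2_size (eps : R) (q : R -> R[i]) (F : R -> R -> R[i]) (M : R) (m : R -> R) (x tau : R) :
  `|eps| <= 1 -> cintegrable setT q -> (forall s, ~~ (0 < s < pi) -> q s = 0) ->
  kernel_reg F M -> (forall s t, cabs (F s t) <= m s) ->
  mu.-integrable setT (EFin \o (fun s => cabs (q s) * m s)) ->
  0 <= tau -> x <= pi ->
  cabs (G2 eps q F x tau) <= pi / 2 * \int[mu]_(s in `]-oo, x]) (cabs (q s) * m s).
Proof.
move=> eps1 Iq qs rF Fm Im t0 xpi; have m0 s : 0 <= m s by exact: le_trans (cabs_ge0 _) (Fm s 0).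
rewrite /G2 cabsM cabsR ger0_norm ?invr_ge0// mulrC (mulrC pi) -mulrA.
rewrite [leRHS]mulrC ler_pM2r ?invr_gt0//.
rewrite -RintegralZl//; last exact: (integrable_subT _ Im).
rewrite -Rintegral_indicM.
apply: le_cabs_cint_bound => //.
- exact: (cintegrable_cmeas (cintegrable_q_kJ x tau eps1 Iq rF)).
- move=> s _; rewrite cabsM.
  case: (boolP (0 < s < pi)) => [/andP[s0 sp]|/qs ->]; last first.
    by rewrite cabs0 !mul0r !mulr0.
  have [sx|xs] := leP s x; last first.
    have -> : Num.max (x - s) 0 = 0 by apply/max_idPr; rewrite subr_le0 ltW.
    rewrite (kJ0 _ _ rF t0) cabs0 mulr0; apply: mulr_ge0; first by rewrite indicE ler0n.
    by apply: mulr_ge0; [exact: pi_ge0|exact: mulr_ge0 (cabs_ge0 _) (m0 s)].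
  rewrite indicE mem_set/= ?in_itv//= mul1r mulrCA.
  have -> : Num.max (x - s) 0 = x - s by apply/max_idPl; rewrite subr_ge0.
  have xs0 : 0 <= x - s by rewrite subr_ge0.
  have := kJ_size rF eps1 (Fm s) (ltW s0) t0 xs0.
  have -> : s + (x - s) = x by ring.
  move=> h.
  apply: ler_wpM2l; first exact: cabs_ge0.
  by apply: le_trans h _; rewrite mulrC; apply: ler_wpM2r.
- have := integrableRZ pi measurableT Im => h.
  apply: (@integrable_bound R setT _ _ measurableT _ _ (integrableRnorm measurableT h)).
    apply: measurable_funM; last by have /measurable_int/measurable_EFinP := h.
    by apply: measurable_indic; exact: measurable_itv.
  move=> s _; rewrite normrM -[leRHS]mul1r ler_wpM2r// indicE.
  by case: (_ \in _); rewrite ?normr1 ?normr0.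
Qed.

Lemma solves_eq_le (eps : R) (q : R -> R[i]) (F : R -> R -> R[i]) (M : R) :
  `|eps| <= 1 -> cintegrable setT q -> (forall s, ~~ (0 < s < pi) -> q s = 0) ->
  kernel_reg F M -> solves_eq eps q F ->
  forall x tau, cabs (F x tau) <=
    (\int[mu]_t cabs (q t)) * expR (pi / 2 * \int[mu]_t cabs (q t)).
Proof.
move=> eps1 Iq qs rF sF x tau.
set N1 := \int[mu]_t cabs (q t).
have N10 : 0 <= N1 by apply: Rintegral_ge0 => t _; exact: cabs_ge0.
have pi2 : 0 < pi / 2 :> R by rewrite divr_gt0// pi_gt0.
have Ia := cintegrable_cabs measurableT Iq.
have us t : t <= 0 -> cabs (q t) = 0.
  by move=> t0; rewrite qs ?cabs0// negb_and -leNgt t0.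
have g0 t : 0 <= cabs (q t) by exact: cabs_ge0.
have K := @kernel_gronwall R (fun t => cabs (q t)) (pi / 2) Ia g0 us pi2 F M N1 rF N10.
apply: le_trans (K _ x tau) _; last first.
  by rewrite ler_wpM2l// /esig ler_expR ler_pM2l// sigma_total.
move=> N N0 FN {}x {}tau t0 tx xp; rewrite sF//.
apply: le_trans (cabsD _ _) _; apply: lerD; first exact: G1_le.
apply: (@G2_size eps q F M (fun s => N * esig (fun t => cabs (q t)) (pi / 2) s)) => //; last exact: ltW.
have := integrableRZ N measurableT (integrable_u_esig Ia g0 pi2).
by apply: eq_integrable => // s _ /=; rewrite mulrCA.
Qed.

Lemma cabs_sub_eqDD (A B a b c d : R[i]) : A = a + b -> B = c + d ->
  cabs (A - B) <= cabs (a - c) + cabs (b - d).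
Proof. by move=> -> ->; exact: cabs_subDD. Qed.

Section difference.
Variables (eps S d : R) (q q' : R -> R[i]) (F F' : R -> R -> R[i]) (M M' : R).
Hypothesis eps1 : `|eps| <= 1.
Hypothesis Iq : cintegrable setT q.
Hypothesis Iq' : cintegrable setT q'.
Hypothesis qs : forall s, ~~ (0 < s < pi) -> q s = 0.
Hypothesis qs' : forall s, ~~ (0 < s < pi) -> q' s = 0.
Hypothesis rF : kernel_reg F M.
Hypothesis rF' : kernel_reg F' M'.
Hypothesis sF : solves_eq eps q F.
Hypothesis sF' : solves_eq eps q' F'.
Hypothesis qS : \int[mu]_t cabs (q t) <= S.
Hypothesis qS' : \int[mu]_t cabs (q' t) <= S.
Hypothesis qd : \int[mu]_t cabs (q t - q' t) <= d.

Let MF := S * expR (pi / 2 * S).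
Let MD := d * (1 + pi / 2 * MF) * expR (pi / 2 * S).

Let Id : cintegrable setT (fun t => q t - q' t).
Proof. exact: (cintegrableD measurableT Iq (cintegrableN measurableT Iq')). Qed.

Let pi2 : 0 < pi / 2 :> R. Proof. by rewrite divr_gt0// pi_gt0. Qed.

Let S0 : 0 <= S.
Proof. by apply: le_trans qS; apply: Rintegral_ge0 => t _; exact: cabs_ge0. Qed.

Let d0 : 0 <= d.
Proof. by apply: le_trans qd; apply: Rintegral_ge0 => t _; exact: cabs_ge0. Qed.

Lemma kernel_le x tau : cabs (F x tau) <= MF.
Proof.
apply: le_trans (solves_eq_le eps1 Iq qs rF sF x tau) _.
apply: ler_pM; [by apply: Rintegral_ge0 => t _; exact: cabs_ge0|exact: expR_ge0|exact: qS|].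
by rewrite ler_expR ler_pM2l.
Qed.

(** The difference solves the equation with potential [q'] and two source terms, [G1] for [q - q']
    and [G2] for [q - q'] and [F], of size [d] and [pi / 2 * d * MF]. Gronwall's lemma supplies the
    exponential. *)
Lemma kernel_sub_le x tau : cabs (F x tau - F' x tau) <= MD.
Proof.
have MF0 : 0 <= MF by rewrite mulr_ge0// expR_ge0.
have a0 : 0 <= d * (1 + pi / 2 * MF) by rewrite mulr_ge0// addr_ge0// mulr_ge0// ltW.
have Ia' := cintegrable_cabs measurableT Iq'.
have us t : t <= 0 -> cabs (q' t) = 0.
  by move=> t0; rewrite qs' ?cabs0// negb_and -leNgt t0.
have g0 t : 0 <= cabs (q' t) by exact: cabs_ge0.
have rD := kernel_regB rF rF'.
have K := @kernel_gronwall R (fun t => cabs (q' t)) (pi / 2) Ia' g0 us pi2 _ _ _ rD a0.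
apply: le_trans (K _ x tau) _; last first.
  rewrite ler_wpM2l// /esig ler_expR ler_pM2l//.
  exact: le_trans (sigma_total Ia' g0 _) qS'.
move=> N N0 FN {}x {}tau t0 tx xp.
have Idk : mu.-integrable setT (EFin \o (fun s => cabs (q s - q' s) * MF)).
  have := integrableRZ MF measurableT (cintegrable_cabs measurableT Id).
  by apply: eq_integrable => // s _ /=; rewrite mulrC.
rewrite (sF t0 tx xp) (sF' t0 tx xp) opprD addrACA (G1_sub _ _ _ Iq Iq').
rewrite (G2_sub _ _ eps1 Iq Iq' rF rF') addrA.
apply: le_trans (cabsD _ _) _; apply: lerD.
  apply: le_trans (cabsD _ _) _; rewrite mulrDr mulr1; apply: lerD.
    exact: le_trans (G1_le eps1 Id _ _) qd.
  have h := @G2_size eps _ F M (fun=> MF) x tau eps1 Id _ rF kernel_le Idk (ltW t0) xp.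
  apply: le_trans (h _) _.
    by move=> s hs; rewrite qs// qs'// subrr.
  rewrite [leRHS](_ : _ = pi / 2 * (d * MF)); last by ring.
  apply: ler_wpM2l; first exact: ltW.
  apply: (@le_trans _ _ (\int[mu]_s (cabs (q s - q' s) * MF))).
    rewrite Rintegral_mkcond; apply: le_Rintegral => //.
    - rewrite -restrict_EFin; apply/integrable_restrict => //; rewrite setTI.
      exact: (integrable_subT _ Idk).
    - by move=> s _; rewrite patchE; case: ifP => // _; rewrite mulr_ge0 ?cabs_ge0.
  rewrite RintegralZr//; last exact: (cintegrable_cabs measurableT Id).
  exact: (ler_wpM2r MF0 qd).
apply: (@G2_size eps q' _ (M + M') (fun s => N * esig (fun t => cabs (q' t)) (pi / 2) s)) => //; last exact: ltW.
have := integrableRZ N measurableT (integrable_u_esig Ia' g0 pi2).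
by apply: eq_integrable => // s _ /=; rewrite mulrCA.
Qed.

(** The increments of the difference carry the small factor, as both [d] and [MD] are proportional
    to [d]; [is_cderive_lip] turns them into bounds for derivatives. In 3/2, the 3 comes from
    [kJ_lip] and the half from [G2]. *)
Lemma G2_sub_lip (x tau x' tau' : R) :
  cabs ((G2 eps q F x tau - G2 eps q' F' x tau) - (G2 eps q F x' tau' - G2 eps q' F' x' tau'))
  <= 3 / 2 * (d * MF + S * MD) * (`|tau - tau'| + `|x - x'|).
Proof.
have MF0 : 0 <= MF by rewrite mulr_ge0// expR_ge0.
have MD0 : 0 <= MD by exact: le_trans (cabs_ge0 _) (kernel_sub_le 0 0).
apply: le_trans (cabs_sub_eqDD (G2_sub x tau eps1 Iq Iq' rF rF') (G2_sub x' tau' eps1 Iq Iq' rF rF')) _.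
have rF2 := kernel_reg_bound rF kernel_le.
have rD2 := kernel_reg_bound (kernel_regB rF rF') kernel_sub_le.
have h1 := G2_lip eps1 Id rF2 x tau x' tau'.
have h2 := G2_lip eps1 Iq' rD2 x tau x' tau'.
apply: le_trans (lerD h1 h2) _.
set L := `|tau - tau'| + _.
have L0 : 0 <= L by rewrite addr_ge0.
have h3 : 2^-1 * (3 * MF * L) * \int[mu]_t cabs (q t - q' t) <= 2^-1 * (3 * MF * L) * d.
  apply: ler_wpM2l qd; apply: mulr_ge0; first by rewrite invr_ge0.
  by apply: mulr_ge0 L0; apply: mulr_ge0 MF0.
have h4 : 2^-1 * (3 * MD * L) * \int[mu]_t cabs (q' t) <= 2^-1 * (3 * MD * L) * S.
  apply: ler_wpM2l qS'; apply: mulr_ge0; first by rewrite invr_ge0.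
  by apply: mulr_ge0 L0; apply: mulr_ge0 MD0.
apply: le_trans (lerD h3 h4) _.
by rewrite le_eqVlt; apply/orP; left; apply/eqP; field.
Qed.

End difference.
End stability.

(** * Differentiability of the integral terms *)

Section complex_derivatives.
Variable R : realType.
Local Notation mu := (@lebesgue_measure R).
Local Notation MR := (measurableTypeR R).
Local Notation Re := (@complex.Re R).
Local Notation Im := (@complex.Im R).
Implicit Types (f g : R -> R[i]) (x : R) (z : R[i]).

Definition is_cderive f x z : Prop :=
  is_derive x 1 (Re \o f) (Re z) /\ is_derive x 1 (Im \o f) (Im z).

Lemma is_cderive_cst c x : is_cderive (fun=> c) x 0.
Proof. by split; exact: is_derive_cst. Qed.

Lemma is_cderiveD f g x z w : is_cderive f x z -> is_cderive g x w ->
  is_cderive (fun y => f y + g y) x (z + w).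
Proof.
move=> [fr fi] [gr gi]; split.
- have -> : Re \o (fun y => f y + g y) = (Re \o f) + (Re \o g).
    by apply/funext => y; rewrite /= ReD.
  by rewrite ReD; exact: is_deriveD.
- have -> : Im \o (fun y => f y + g y) = (Im \o f) + (Im \o g).
    by apply/funext => y; rewrite /= ImD.
  by rewrite ImD; exact: is_deriveD.
Qed.

Lemma is_cderiveZ c f x z : is_cderive f x z -> is_cderive (fun y => c * f y) x (c * z).
Proof.
move=> [fr fi]; split.
- have -> : Re \o (fun y => c * f y) =
      (fun y => Re c * (Re \o f) y) + (fun y => (- Im c) * (Im \o f) y).
    by apply/funext => y; rewrite /= ReM -mulNr.
  rewrite ReM -mulNr; apply: is_deriveD; exact: is_derive_scale.
- have -> : Im \o (fun y => c * f y) =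
      (fun y => Re c * (Im \o f) y) + (fun y => Im c * (Re \o f) y).
    by apply/funext => y; rewrite /= ImM.
  rewrite ImM; apply: is_deriveD; exact: is_derive_scale.
Qed.

Lemma is_cderiveB f g x z w : is_cderive f x z -> is_cderive g x w ->
  is_cderive (fun y => f y - g y) x (z - w).
Proof.
move=> df dg; rewrite -mulN1r.
have -> : (fun y => f y - g y) = (fun y => f y + (-1) * g y).
  by apply/funext => y; rewrite mulN1r.
exact: (is_cderiveD df (is_cderiveZ (-1) dg)).
Qed.

Lemma is_cderive_affine f (a b : R) x z : is_cderive f (a * x + b) z ->
  is_cderive (fun y => f (a * y + b)) x (a%:C * z).
Proof.
have h : is_derive x 1 (fun y : R => a * y + b) a.
  have := @is_deriveD R R^o R^o (fun y => a * y) (cst b) x 1 _ _ (is_derive_mull a x) (is_derive_cst _ _ _).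
  by rewrite addr0.
move=> [fr fi]; split.
- rewrite ReZ mulrC; exact: (@is_derive1_comp R (Re \o f) (fun y => a * y + b) x _ _ fr h).
- rewrite ImZ mulrC; exact: (@is_derive1_comp R (Im \o f) (fun y => a * y + b) x _ _ fi h).
Qed.

Lemma is_cderive_near f g x z : (\forall y \near x, f y = g y) -> is_cderive f x z ->
  is_cderive g x z.
Proof.
move=> fg [fr fi]; have fgx := nbhs_singleton fg.
split; apply/diff_quot_cvgP.
- move/diff_quot_cvgP : fr; apply: cvg_trans; apply: near_eq_cvg.
  have : x^' [set y | f y = g y] by apply: filterS fg => y ? _.
  by apply: filterS => y /= fy; rewrite /diff_quot /= fy fgx.
- move/diff_quot_cvgP : fi; apply: cvg_trans; apply: near_eq_cvg.
  have : x^' [set y | f y = g y] by apply: filterS fg => y ? _.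
  by apply: filterS => y /= fy; rewrite /diff_quot /= fy fgx.
Qed.

(** One direction at a time, so that the Lipschitz constant itself bounds the modulus of the
    derivative. *)
Lemma is_cderive_lip f x z L : 0 <= L -> is_cderive f x z ->
  (forall y, cabs (f y - f x) <= L * `|y - x|) -> cabs z <= L.
Proof.
move=> L0 [/diff_quot_cvgP fr /diff_quot_cvgP fi] fL; apply: cabs_dirP => // c d cd1.
have cv : (c * diff_quot (Re \o f) x y + d * diff_quot (Im \o f) x y) @[y --> x^'] --> c * Re z + d * Im z.
  by apply: cvgD; apply: cvgM => //; exact: cvg_cst.
rewrite -(cvg_lim (@Rhausdorff R) cv); apply: limr_le; first by apply/cvg_ex; eexists; exact: cv.
have : x^' [set y | y != x] by rewrite /dnbhs /within/=; apply: filterE.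
apply: filterS => y /= yx.
have yx0 : 0 < `|y - x| by rewrite normr_gt0 subr_eq0.
apply: (@le_trans _ _ (cabs (f y - f x) / `|y - x|)); last first.
  by rewrite ler_pdivrMr.
have E : c * diff_quot (Re \o f) x y + d * diff_quot (Im \o f) x y =
  (c * Re (f y - f x) + d * Im (f y - f x)) / (y - x).
  by rewrite /diff_quot ReB ImB /=; ring.
rewrite E; apply: le_trans (ler_norm _) _; rewrite normrM normfV.
rewrite ler_pM2r ?invr_gt0// ler_norml; apply/andP; split; last exact: cabs_dir_le.
have := @cabs_dir_le R (f y - f x) (- c) (- d); rewrite !sqrrN => /(_ cd1).
by rewrite !mulNr; lra.
Qed.

Lemma is_cderive_cint (f : R -> R -> R[i]) (g : R -> R) x :
  (forall y, cintegrable setT (f y)) -> mu.-integrable setT (EFin \o g) ->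
  (forall y y' s, cabs (f y s - f y' s) <= g s * `|y - y'|) ->
  {ae mu, forall s, exists z, is_cderive (f ^~ s) x z} ->
  exists z, is_cderive (fun y => cint setT (f y)) x z.
Proof.
move=> If Ig fg aef.
have cr : cvg (diff_quot (fun y => \int[mu]_s Re (f y s)) x y @[y --> x^']).
  apply: (@cvg_diff_quot_Rintegral R (fun y s => Re (f y s)) g) => //.
  - by move=> y; have [] := If y.
  - by move=> y y' s; rewrite -ReB; exact: le_trans (normRe_le_cabs _) (fg _ _ _).
  - move: aef; apply: aeS => s [z [/diff_quot_cvgP h _]].
    by apply/cvg_ex; exists (Re z).
have ci : cvg (diff_quot (fun y => \int[mu]_s Im (f y s)) x y @[y --> x^']).
  apply: (@cvg_diff_quot_Rintegral R (fun y s => Im (f y s)) g) => //.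
  - by move=> y; have [] := If y.
  - by move=> y y' s; rewrite -ImB; exact: le_trans (normIm_le_cabs _) (fg _ _ _).
  - move: aef; apply: aeS => s [z [_ /diff_quot_cvgP h]].
    by apply/cvg_ex; exists (Im z).
move/cvg_ex : cr => [zr hr]; move/cvg_ex : ci => [zi hi].
by exists (zr +i* zi); split; apply/diff_quot_cvgP.
Qed.

Lemma ae_except4 (P : R -> Prop) (a b c d : R) :
  (forall s, s != a -> s != b -> s != c -> s != d -> P s) -> {ae mu, forall s, P s}.
Proof.
move=> H; have N : mu.-negligible ([set a] `|` [set b] `|` [set c] `|` [set d]).
  by do 3 (apply: negligibleU; last exact: negligible_set1); exact: negligible_set1.
apply: negligibleS N => s /= nP; apply: contrapT => h; apply: nP.
by apply: H; apply/eqP => E; apply: h; rewrite E /=; tauto.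
Qed.

Section kernel_derivatives.
Variables (eps : R) (q : R -> R[i]) (F : R -> R -> R[i]) (M : R).
Hypothesis eps1 : `|eps| <= 1.
Hypothesis Iq : cintegrable setT q.
Hypothesis rF : kernel_reg F M.

Lemma cprim_cderive s b : b != 0 -> b != s -> exists z, is_cderive (cprim (F s)) b z.
Proof.
move=> b0 bs; have [_ _ FM _ cF] := rF; have [cr ci] := cF s b b0 bs.
have [dr di] := cprim_derivable (kernel_reg_cmeas rF s) (FM s) (kernel_reg_supp rF s) cr ci.
exists (('D_1 (Re \o cprim (F s)) b) +i* ('D_1 (Im \o cprim (F s)) b)).
by split; [exact: (DeriveDef dr erefl)|exact: (DeriveDef di erefl)].
Qed.

(** The primitive of [F s] is differentiable where [F s] is continuous, that is off 0 and [s]. *)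
Let good (s b : R) := (b != 0) && (b != s).

(** Affine arguments serve both variables: slopes 0 and 1 for the derivative in [x], slopes 1 and 0
    for the one in [tau]. *)
Lemma kJ_cderive (a1 a2 c1 c2 s x : R) :
  good s ((a1 * x + c1) + (a2 * x + c2)) -> good s ((a1 * x + c1) - (a2 * x + c2)) ->
  good s ((a2 * x + c2) - (a1 * x + c1)) ->
  exists z, is_cderive (fun y => kJ eps F s (a1 * y + c1) (a2 * y + c2)) x z.
Proof.
have aff e1 e2 : good s (e1 * x + e2) -> exists z, is_cderive (fun y => cprim (F s) (e1 * y + e2)) x z.
  move=> /andP[g0 gs]; have [z hz] := cprim_cderive g0 gs.
  by exists (e1%:C * z); exact: is_cderive_affine.
have E1 y : (a1 * y + c1) + (a2 * y + c2) = (a1 + a2) * y + (c1 + c2) by ring.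
have E2 y : (a1 * y + c1) - (a2 * y + c2) = (a1 - a2) * y + (c1 - c2) by ring.
have E3 y : (a2 * y + c2) - (a1 * y + c1) = (a2 - a1) * y + (c2 - c1) by ring.
rewrite E1 E2 E3 => /aff[z1 h1] /aff[z2 h2] /aff[z3 h3].
exists (z1 - z2 + eps%:C * z3).
have -> : (fun y => kJ eps F s (a1 * y + c1) (a2 * y + c2)) =
  (fun y => cprim (F s) ((a1 + a2) * y + (c1 + c2)) - cprim (F s) ((a1 - a2) * y + (c1 - c2))
     + eps%:C * cprim (F s) ((a2 - a1) * y + (c2 - c1))).
  by apply/funext => y; rewrite /kJ E1 E2 E3.
exact: (is_cderiveD (is_cderiveB h1 h2) (is_cderiveZ _ h3)).
Qed.

Let Ig : mu.-integrable setT (EFin \o (fun s => 3 * M * cabs (q s))).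
Proof. exact: (integrableRZ _ measurableT (cintegrable_cabs measurableT Iq)). Qed.

Let M0 : 0 <= M. Proof. exact: kernel_reg_ge0 rF. Qed.

Let lip (x tau x' tau' s : R) :
  cabs (q s * kJ eps F s tau (Num.max (x - s) 0) - q s * kJ eps F s tau' (Num.max (x' - s) 0))
  <= 3 * M * cabs (q s) * (`|tau - tau'| + `|x - x'|).
Proof.
have [_ _ FM _ _] := rF.
rewrite -mulrBr cabsM (mulrC (3 * M)) -mulrA; apply: ler_wpM2l; first exact: cabs_ge0.
apply: le_trans (kJ_lip rF eps1 (FM s) _ _ _ _) _.
apply: ler_wpM2l; first by rewrite mulr_ge0.
rewrite lerD2l; apply: le_trans (norm_max0 _ _) _.
by rewrite opprD addrACA subrr addr0.
Qed.

(** For fixed [x] and [tau], a primitive in [kJ] meets a possible jump of [F s] for at most three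
    values of [s < x]. With [s = x], the corner of the maximum, these are the four points removed by
    [ae_except4]. *)
Let good_pts (x tau s : R) : 0 < tau -> tau < x -> s < x ->
  s != x - tau -> s != (x + tau) / 2 -> s != (x - tau) / 2 ->
  [/\ good s (tau + (x - s)), good s (tau - (x - s)) & good s (x - s - tau)].
Proof.
move=> t0 tx sx n1 n2 n3; split; apply/andP; split.
- by apply/eqP => E; lra.
- by apply/eqP => E; move/eqP: n2; apply; lra.
- by apply/eqP => E; move/eqP: n1; apply; lra.
- by apply/eqP => E; lra.
- by apply/eqP => E; move/eqP: n1; apply; lra.
- by apply/eqP => E; move/eqP: n3; apply; lra.
Qed.

Lemma G2_cderive1 x tau : 0 < tau -> tau < x ->
  exists z, is_cderive (fun y => G2 eps q F y tau) x z.
Proof.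
move=> t0 tx.
have [||||z hz] := @is_cderive_cint (fun y s => q s * kJ eps F s tau (Num.max (y - s) 0))
  (fun s => 3 * M * cabs (q s)) x; last first.
- by exists ((2^-1)%:C * z); exact: is_cderiveZ.
- apply: (@ae_except4 _ x (x - tau) ((x + tau) / 2) ((x - tau) / 2)) => s nx n1 n2 n3.
  have [sx|xs] := ltP s x; last first.
    have {}xs : x < s by rewrite lt_neqAle eq_sym nx.
    exists 0; apply: (is_cderive_near _ (is_cderive_cst 0 x)).
    have : \forall y \near x, y < s by exact: lt_nbhsl.
    apply: filterS => y ys; have -> : Num.max (y - s) 0 = 0.
      by apply/max_idPr; rewrite subr_le0 ltW.
    by rewrite (kJ0 _ _ rF (ltW t0)) mulr0.
  have [g1 g2 g3] := good_pts t0 tx sx n1 n2 n3.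
  have [|||z hz] := @kJ_cderive 0 1 tau (- s) s x; rewrite ?mul0r ?mul1r ?add0r//.
  exists (q s * z); apply: (is_cderive_near _ (is_cderiveZ (q s) hz)).
  have : \forall y \near x, s < y by exact: lt_nbhsr.
  apply: filterS => y sy; rewrite mul0r mul1r add0r.
  have -> // : Num.max (y - s) 0 = y - s by apply/max_idPl; rewrite subr_ge0 ltW.
- by move=> y y' s; apply: le_trans (lip _ _ _ _ _) _; rewrite subrr normr0 add0r.
- exact: Ig.
- by move=> y; exact: (cintegrable_q_kJ y tau eps1 Iq rF).
Qed.

Lemma G2_cderive2 x tau : 0 < tau -> tau < x ->
  exists z, is_cderive (fun t => G2 eps q F x t) tau z.
Proof.
move=> t0 tx.
have [||||z hz] := @is_cderive_cint (fun t s => q s * kJ eps F s t (Num.max (x - s) 0))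
  (fun s => 3 * M * cabs (q s)) tau; last first.
- by exists ((2^-1)%:C * z); exact: is_cderiveZ.
- apply: (@ae_except4 _ x (x - tau) ((x + tau) / 2) ((x - tau) / 2)) => s nx n1 n2 n3.
  have [sx|xs] := ltP s x; last first.
    exists 0; apply: (is_cderive_near _ (is_cderive_cst 0 tau)).
    have -> : Num.max (x - s) 0 = 0 by apply/max_idPr; rewrite subr_le0.
    have : \forall y \near tau, 0 < y by exact: lt_nbhsr.
    by apply: filterS => y y0; rewrite (kJ0 _ _ rF (ltW y0)) mulr0.
  have [g1 g2 g3] := good_pts t0 tx sx n1 n2 n3.
  have -> : Num.max (x - s) 0 = x - s by apply/max_idPl; rewrite subr_ge0 ltW.
  have [|||z hz] := @kJ_cderive 1 0 0 (x - s) s tau; rewrite ?mul0r ?mul1r ?add0r ?addr0//.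
  exists (q s * z); apply: (is_cderive_near _ (is_cderiveZ (q s) hz)).
  have : nbhs tau (setT : set R) by exact: filterT.
  by apply: filterS => y _; rewrite mul0r mul1r add0r addr0.
- by move=> y y' s; apply: le_trans (lip _ _ _ _ _) _; rewrite subrr normr0 addr0.
- exact: Ig.
- by move=> y; exact: (cintegrable_q_kJ x y eps1 Iq rF).
Qed.

End kernel_derivatives.
End complex_derivatives.

(** * Affine changes of variable and the L2 norm *)

Section affine_change_of_variable.
Variable R : realType.
Local Notation mu := (@lebesgue_measure R).
Local Notation MR := (measurableTypeR R).

Lemma measurable_affine (a b : R) : measurable_fun setT ((fun t => a * t + b) : MR -> MR).
Proof. by apply: measurable_funD => //; exact: measurable_funM. Qed.

Lemma affine_preimage_oc (a b c d : R) : a != 0 ->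
  mu ((fun t : R => a * t + b) @^-1` `]c, d]) = (`|a|^-1%:E * mu `]c, d]%classic)%E.
Proof.
move=> a0.
have Hm : (`|a|^-1%:E * mu `]c, d]%classic)%E = (if (c < d)%R then ((d - c) / `|a|)%R%:E else 0)%E.
  rewrite lebesgue_measure_itv/= lte_fin; case: ifP => _; last by rewrite mule0.
  by rewrite -EFinD -EFinM mulrC.
rewrite Hm; have [an|ap] := ltP a 0.
  have na : 0 < - a by rewrite oppr_gt0.
  have -> : (fun t : R => a * t + b) @^-1` `]c, d] = `[(d - b) / a, (c - b) / a[%classic.
    apply/seteqP; split => t /=; rewrite !in_itv/= ler_ndivrMr// ltr_ndivlMr// => /andP[h1 h2];
      apply/andP; split; lra.
  rewrite lebesgue_measure_itv/= lte_fin ltr_nM2r ?invr_lt0// ltrD2r.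
  case: ifP => // _; rewrite -EFinB; congr EFin.
  by rewrite ltr0_norm// invrN mulrN -mulNr -mulrBl; congr (_ / _); ring.
have {ap}ap : 0 < a by rewrite lt_neqAle eq_sym a0.
have -> : (fun t : R => a * t + b) @^-1` `]c, d] = `](c - b) / a, (d - b) / a]%classic.
  apply/seteqP; split => t /=; rewrite !in_itv/= ler_pdivlMr// ltr_pdivrMr// => /andP[h1 h2];
    apply/andP; split; lra.
rewrite lebesgue_measure_itv/= lte_fin ltr_pM2r ?invr_gt0// ltrD2r.
case: ifP => // _; rewrite -EFinB; congr EFin.
by rewrite gtr0_norm// -mulrBl; congr (_ / _); ring.
Qed.

(** The push-forward, scaled by the modulus of [a], agrees with Lebesgue measure on half-open
    intervals, so uniqueness applies. Negative slopes are included because [(x - t) / 2] occurs. *)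
Lemma lebesgue_measure_affine (a b : R) (A : set MR) : a != 0 -> measurable A ->
  mu ((fun t : R => a * t + b) @^-1` A) = (`|a|^-1%:E * mu A)%E.
Proof.
move=> a0 mA; have na : 0 < `|a| by rewrite normr_gt0.
pose phi : MR -> MR := fun t => a * t + b.
have mphi : measurable_fun setT phi by exact: measurable_affine.
pose pm : {measure set MR -> \bar R} := pushforward mu phi.
pose nu : {measure set MR -> \bar R} := mscale (NngNum (ltW na)) (pm mphi).
have H (X : set R) : ocitv X -> mu X = nu X.
  move=> [[c d] _ <-].
  transitivity (`|a|%:E * mu ((fun t : R => (a * t + b)%R) @^-1` `]c, d]))%E; last by [].
  by rewrite affine_preimage_oc// muleA -EFinM mulfV ?mul1e// gt_eqF.
have E : mu A = nu A by exact: (@lebesgue_measure_unique R nu H A mA).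
transitivity (`|a|^-1%:E * (`|a|%:E * mu ((fun t : R => (a * t + b)%R) @^-1` A)))%E; last by rewrite E.
by rewrite muleA -EFinM mulVf ?mul1e// gt_eqF.
Qed.

(** At slopes 1/2 and -1/2 this carries the almost everywhere derivative of the primitive of [q] to
    the arguments [(x + t) / 2] and [(x - t) / 2], for each fixed [x]; hence the theorem holds for
    every [x]. *)
Lemma ae_affine (a b : R) (P : R -> Prop) : a != 0 ->
  {ae mu, forall t, P t} -> {ae mu, forall t, P (a * t + b)}.
Proof.
move=> a0 [A [mA A0 PA]].
exists ((fun t : R => a * t + b) @^-1` A); split.
- by rewrite -[X in measurable X]setTI; exact: (measurable_affine a b measurableT mA).
- by rewrite lebesgue_measure_affine// A0 mule0.
- by move=> t /= nP; exact: PA.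
Qed.

Lemma integral_affine (a b : R) (f : R -> \bar R) : a != 0 ->
  measurable_fun (setT : set MR) (f : MR -> \bar R) -> (forall t, 0 <= f t)%E ->
  (\int[mu]_t f (a * t + b)%R = `|a|^-1%:E * \int[mu]_t f t)%E.
Proof.
move=> a0 mf f0; have na : 0 < `|a|^-1 by rewrite invr_gt0 normr_gt0.
pose phi : MR -> MR := fun t => a * t + b.
have mphi : measurable_fun setT phi by exact: measurable_affine.
have f1 : {in (setT : set MR), forall y : MR, (0 <= f y)%E} by move=> y _; exact: f0.
have := @ge0_integral_pushforward _ _ MR MR R phi mphi mu setT f measurableT mf f1.
rewrite preimage_setT => E; transitivity (\int[mu]_x (f \o phi) x)%E; first by [].
rewrite -E.
transitivity (\int[mscale (NngNum (ltW na)) mu]_x f x)%E.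
  by apply: eq_measure_integral => A mA _; exact: (lebesgue_measure_affine b a0 mA).
by rewrite ge0_integral_mscale.
Qed.

End affine_change_of_variable.

Section L2_norm.
Variable R : realType.
Local Notation mu := (@lebesgue_measure R).
Local Notation MR := (measurableTypeR R).
Implicit Types f g : R -> R.
Definition N2 (f : R -> R) : \bar R := 'N[mu]_(2%:E)[EFin \o f].

Import HBNNSimple.

(* [f] need not be measurable: its integral is a supremum over the simple functions below it. *)
Lemma ae_le_integral (f g : R -> \bar R) : (forall t, 0 <= f t)%E -> (forall t, 0 <= g t)%E ->
  measurable_fun (setT : set MR) (g : MR -> \bar R) ->
  {ae mu, forall t, f t <= g t}%E -> (\int[mu]_t f t <= \int[mu]_t g t)%E.
Proof.
move=> f0 g0 mg [A [mA A0 fgA]].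
rewrite (@ge0_integralTE _ MR R mu f f0).
apply: ge_ereal_sup => _ [h hf <-].
have := integral_nnsfun mu measurableT h; rewrite patch_setT => <-.
apply: ae_ge0_le_integral => //.
- by move=> t _; rewrite lee_fin.
- by apply/measurable_EFinP; exact: measurable_funPT.
exists A; split => // t /= nh; apply: fgA => /= fg; apply: nh => _.
exact: le_trans (hf t) fg.
Qed.

Lemma N2E f : N2 f = ((\int[mu]_t (f t ^+ 2)%:E) `^ 2^-1)%E.
Proof.
rewrite /N2 unlock; congr (_ `^ _)%E; apply: eq_integral => t _ /=.
by rewrite -[2%R]/(2%:R) powR_mulrn// real_normK// num_real.
Qed.

(** Only the majorant is taken measurable: [f] will be the modulus of a difference of partial
    derivatives, about which nothing but an almost everywhere bound is at hand. *)
Lemma N2_ae_le f g : measurable_fun (setT : set MR) (g : MR -> R) ->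
  {ae mu, forall t, `|f t| <= g t} -> (N2 f <= N2 g)%E.
Proof.
move=> mg fg; rewrite !N2E; apply: gt0_ler_poweR; rewrite ?invr_ge0//.
- by rewrite in_itv/= leey integral_ge0// => t _; rewrite lee_fin sqr_ge0.
- by rewrite in_itv/= leey integral_ge0// => t _; rewrite lee_fin sqr_ge0.
apply: ae_le_integral.
- by move=> t; rewrite lee_fin sqr_ge0.
- by move=> t; rewrite lee_fin sqr_ge0.
- by apply/measurable_EFinP; exact: measurable_funX.
move: fg; apply: aeS => t fg.
rewrite lee_fin -real_normK ?num_real//.
by rewrite ler_sqr ?nnegrE// (le_trans _ fg).
Qed.

(** With slope 1/2 in modulus and coefficient 1/4 the factor is [sqrt 2 / 4], for each of the two
    copies of [q] in the derivative of [G1]. *)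
Lemma N2_affine (a b c : R) f : a != 0 -> 0 <= c -> measurable_fun (setT : set MR) (f : MR -> R) ->
  N2 (fun t => c * f (a * t + b)) = ((c * Num.sqrt (`|a|^-1))%:E * N2 f)%E.
Proof.
move=> a0 c0 mf; rewrite !N2E.
have i0 : (0 <= \int[mu]_t (f t ^+ 2)%:E)%E by apply: integral_ge0 => t _; rewrite lee_fin sqr_ge0.
have mf2 : measurable_fun (setT : set MR) (fun t : MR => (f t ^+ 2)%:E).
  by apply/measurable_EFinP; exact: measurable_funX.
transitivity ((((c ^+ 2 * `|a|^-1)%:E * \int[mu]_t (f t ^+ 2)%:E) `^ 2^-1)%E).
  congr (_ `^ _)%E.
  rewrite EFinM -muleA -(@integral_affine R a b (fun t => (f t ^+ 2)%:E))//; last first.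
    by move=> t; rewrite lee_fin sqr_ge0.
  rewrite -ge0_integralZl//.
  - by apply: eq_integral => t _; rewrite exprMn EFinM.
  - exact: (measurableT_comp mf2 (measurable_affine a b)).
  - by move=> t _; rewrite lee_fin sqr_ge0.
  - by rewrite lee_fin sqr_ge0.
rewrite poweRM//; last by rewrite lee_fin mulr_ge0// ?invr_ge0// sqr_ge0.
by rewrite poweR_EFin powR12_sqrt ?mulr_ge0 ?sqr_ge0 ?invr_ge0// sqrtrM ?sqr_ge0// sqrtr_sqr ger0_norm.
Qed.

End L2_norm.

Section potentials.
Variable R : realType.
Local Notation mu := (@lebesgue_measure R).
Local Notation MR := (measurableTypeR R).
Local Notation Re := (@complex.Re R).
Local Notation Im := (@complex.Im R).

Lemma N2_indic (c x : R) : 0 <= c -> 0 <= x ->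
  N2 (fun t => c * \1_`]0, x[ t) = (c * Num.sqrt x)%:E.
Proof.
move=> c0 x0; rewrite N2E.
have -> : (\int[mu]_t ((c * \1_`]0, x[ t) ^+ 2)%:E = (c ^+ 2 * x)%:E)%E.
  transitivity (\int[mu]_t ((c ^+ 2)%:E * (\1_`]0, x[ t)%:E))%E.
    apply: eq_integral => t _; rewrite -EFinM indicE exprMn; congr EFin; congr (_ * _).
    by case: (_ \in _); rewrite /= ?expr1n ?expr0n.
  rewrite ge0_integralZl//.
  - rewrite integral_indic// setIT /= lebesgue_measure_itv/= lte_fin EFinM.
    have [->|xn0] := eqVneq x 0; first by rewrite ltxx.
    have -> : 0 < x by rewrite lt_neqAle eq_sym xn0 x0.
    by rewrite oppr0 adde0.
  - by apply/measurable_EFinP; exact/measurable_indicP.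
  - by rewrite lee_fin sqr_ge0.
by rewrite poweR_EFin powR12_sqrt ?mulr_ge0 ?sqr_ge0// sqrtrM ?sqr_ge0// sqrtr_sqr ger0_norm.
Qed.

Lemma N2_ge0 (f : R -> R) : (0 <= N2 f)%E.
Proof. exact: Lnorm_ge0. Qed.

Lemma N2_add (f g : R -> R) : measurable_fun (setT : set MR) (f : MR -> R) ->
  measurable_fun (setT : set MR) (g : MR -> R) -> (N2 (fun t => f t + g t)%R <= N2 f + N2 g)%E.
Proof. by move=> mf mg; apply: minkowski_EFin => //; lra. Qed.

(** Hölder's inequality against the indicator of []0, pi[]; the factor [sqrt pi] passes from here
    into [S] and [d]. *)
Lemma integral_le_N2 (u : R -> R) : measurable_fun (setT : set MR) (u : MR -> R) ->
  (forall t, 0 <= u t) -> (forall t, ~~ (0 < t < pi) -> u t = 0) ->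
  (\int[mu]_t (u t)%:E <= N2 u * (Num.sqrt pi)%:E)%E.
Proof.
move=> mu_ u0 us.
have mi : measurable_fun (setT : set MR) (fun t : MR => (1 * \1_`]0, pi[ t : R)).
  by apply: measurable_funM => //; exact/measurable_indicP.
have h2 : (2^-1 + 2^-1 = 1 :> R) by lra.
have := @hoelder _ MR R mu u (fun t => 1 * \1_`]0, pi[ t) 2 2 mu_ mi (ltr0Sn _ 1) (ltr0Sn _ 1) h2.
rewrite -/(N2 u) -/(N2 (fun t => 1 * \1_`]0, pi[ t)) N2_indic ?pi_ge0// mul1r.
apply: le_trans; rewrite Lnorm1 le_eqVlt; apply/orP; left; apply/eqP.
apply: eq_integral => t _ /=; rewrite mul1r indicE mem_setE in_itv/=.
have [_|/us ->] := boolP (0 < t < pi); last by rewrite mul0r normr0.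
by rewrite mulr1 ger0_norm.
Qed.

Lemma L2normE (f : R -> R[i]) : L2norm 0 pi f = N2 (fun t => cabs (cutq f t)).
Proof.
rewrite /L2norm /N2; apply: eq_Lnorm => t; rewrite /= patchE mem_setE in_itv/= /cutq.
by case: ifP => // _; rewrite cabs0.
Qed.

Lemma cutq_cmeas (q : R -> R[i]) : cmeas `]0, pi[ q -> cmeas setT (cutq q).
Proof.
move=> [mr mi]; split.
- have -> : Re \o cutq q = (Re \o q) \_ `]0, pi[.
    by apply/funext => t /=; rewrite patchE mem_setE in_itv/= /cutq; case: ifP.
  exact: (@measurable_restrictT _ _ MR MR _ (Re \o q) (measurable_itv _)).1.
- have -> : Im \o cutq q = (Im \o q) \_ `]0, pi[.
    by apply/funext => t /=; rewrite patchE mem_setE in_itv/= /cutq; case: ifP.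
  exact: (@measurable_restrictT _ _ MR MR _ (Im \o q) (measurable_itv _)).1.
Qed.

Lemma integrable_finite (u : R -> R) : measurable_fun (setT : set MR) (u : MR -> R) ->
  (forall t, 0 <= u t) -> (\int[mu]_t (u t)%:E < +oo)%E -> mu.-integrable setT (EFin \o u).
Proof.
move=> mu_ u0 h; apply/integrableP; split; first exact/measurable_EFinP.
apply: le_lt_trans h; rewrite le_eqVlt; apply/orP; left; apply/eqP.
by apply: eq_integral => t _ /=; rewrite ger0_norm.
Qed.

Lemma L2_integrable (f : R -> R[i]) (r : R) : cmeas setT f ->
  (forall t, ~~ (0 < t < pi) -> f t = 0) ->
  (N2 (fun t => cabs (f t)) <= r%:E)%E ->
  cintegrable setT f /\ \int[mu]_t cabs (f t) <= Num.sqrt pi * r.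
Proof.
move=> mf fs fr; have ma := cmeas_cabs mf.
have le : (\int[mu]_t (cabs (f t))%:E <= (Num.sqrt pi * r)%:E)%E.
  apply: le_trans (integral_le_N2 ma (fun t => cabs_ge0 (f t)) _) _.
    by move=> t ft; rewrite /comp (fs _ ft) cabs0.
  by rewrite (mulrC _ r) EFinM; apply: lee_pmul => //; rewrite ?N2_ge0// lee_fin sqrtr_ge0.
have Ia : mu.-integrable setT (EFin \o (fun t => cabs (f t))).
  apply: integrable_finite => //; first by move=> t; exact: cabs_ge0.
  exact: le_lt_trans le (ltry _).
split; last by rewrite -lee_fin /Rintegral fineK//; exact: integrable_fin_num.
by apply: (cintegrable_bound measurableT mf _ Ia) => t _.
Qed.

Lemma in_L2_cmeas (q : R -> R[i]) : in_L2 0 pi q -> cmeas `]0, pi[ q.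
Proof. by move=> [mr mi _]; split. Qed.

Lemma in_L2_integrable (q : R -> R[i]) (r : R) : in_L2 0 pi q -> (L2norm 0 pi q <= r%:E)%E ->
  [/\ cintegrable `]0, pi[ q, cintegrable setT (cutq q) &
      \int[mu]_t cabs (cutq q t) <= Num.sqrt pi * r].
Proof.
move=> /in_L2_cmeas mq; rewrite L2normE => qr.
have [I1 I2] := L2_integrable (cutq_cmeas mq) (@cutq_supp _ q) qr.
split => //; apply: (@eq_cintegrable R `]0, pi[%classic (cutq q)); last exact: (cintegrableS measurableT _ _ I1).
  exact: measurable_itv.
by move=> t /=; rewrite in_itv/= /cutq => ->.
Qed.

End potentials.

(** * Partial derivatives of the kernels *)

Section kernel_partials.
Variable R : realType.
Local Notation mu := (@lebesgue_measure R).
Local Notation MR := (measurableTypeR R).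
Local Notation Re := (@complex.Re R).
Local Notation Im := (@complex.Im R).

Lemma cprim_ae_cderive (q : R -> R[i]) : cintegrable setT q ->
  {ae mu, forall b, is_cderive (cprim q) b (q b)}.
Proof.
have ftc (h : R -> R) : mu.-integrable setT (EFin \o h) ->
    {ae mu, forall b : R, is_derive b 1 (fun x : R => \int[mu]_(t in `]-oo, x]) h t) (h b)}.
  move=> Ih; have locf : locally_integrable [set: R] h.
    by apply: open_integrable_locally => //; exact: openT.
  have := @FTC1Ny R h (fun y => integrable_subT (measurable_itv _) Ih) locf.
  by apply: aeS => x [dH dHx]; split; [exact: dH|rewrite -derive1E; exact: dHx].
move=> [/ftc Ir /ftc Ii]; move: Ir Ii; apply: aeS2 => b hr hi; split; [exact: hr|exact: hi].
Qed.

(** At [x = pi] the interval [[t, pi]] offers points on the left only; properness still makes limits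
    along the filter unique. *)
Lemma within_itv_dnbhs_proper (a b x : R) : a < x -> x <= b ->
  ProperFilter (within `[a, b] x^').
Proof.
move=> ax xb; apply: Build_ProperFilter.
rewrite /within/= => /nbhs_ballP[e /= e0 H].
pose y := Num.max (x - e / 2) ((a + x) / 2).
have yx : y < x by rewrite gt_max; apply/andP; split; lra.
have ay : a <= y by rewrite le_max; apply/orP; right; lra.
have ye : x - e / 2 <= y by rewrite le_max lexx.
apply: (H y).
- by rewrite /ball/= gtr0_norm ?subr_gt0//; lra.
- by rewrite lt_eqF.
- by rewrite /= in_itv/= ay/=; lra.
Qed.

(** Applied with [g = G1 + G2], which agrees with the kernel on [A] near [x] and has a two-sided
    derivative even if [x] is an end point of [A]; restricting the filter gives the derivative
    relative to [A]. *)
Lemma derive_inP (A : set R) (f g : R -> R[i]) (x : R) (z : R[i]) :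
  ProperFilter (within A x^') -> f x = g x ->
  (\forall y \near x, A y -> f y = g y) -> is_cderive g x z ->
  derivable_in A f x /\ derive_in A f x = z.
Proof.
move=> PA fgx fg [gr gi].
have H (p : R[i] -> R) l : is_derive x 1 (p \o g) l ->
    diff_quot (fun t => p (f t)) x y @[y --> within A x^'] --> l.
  move=> /diff_quot_cvgP gl.
  have gA : diff_quot (p \o g) x y @[y --> within A x^'] --> l by exact: cvg_within_filter.
  apply: cvg_trans gA; apply: near_eq_cvg.
  rewrite /prop_near1/= /within/=.
  by move: fg; apply: filterS => y fy _ Ay; rewrite /diff_quot /= fy// fgx.
have hr := H _ _ gr; have hi := H _ _ gi; split.
  by split; apply/cvg_ex; eexists; [exact: hr|exact: hi].
rewrite /derive_in; apply: complex_ext => /=.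
- exact: (cvg_lim (@Rhausdorff R) hr).
- exact: (cvg_lim (@Rhausdorff R) hi).
Qed.

Section partials.
Variables (eps : R) (q : R -> R[i]) (K : R -> R -> R[i]) (M : R).
Hypothesis eps1 : `|eps| <= 1.
Hypothesis Iq : cintegrable setT q.
Hypothesis rF : kernel_reg (cutK K) M.
Hypothesis sF : solves_eq eps q (cutK K).

Let F := cutK K.

Let KE x t : 0 < t -> t < x -> x <= pi -> K x t = G1 eps q x t + G2 eps q F x t.
Proof. by move=> t0 tx xp; rewrite -sF// /cutK t0 tx xp. Qed.

(** The derivative of [G1] in [x] for [sgn = eps] and in [t] for [sgn = - eps]; 1/4 is the half in
    [G1] times the inner slope. The arguments are affine in [t] to match [ae_affine] and
    [N2_affine]. *)
Definition G1d (sgn : R) (x t : R) : R[i] :=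
  (4^-1)%:C * q (2^-1 * t + x / 2) + (sgn / 4)%:C * q (- 2^-1 * t + x / 2).

Lemma G1_cderive (x t : R) : is_cderive (cprim q) (2^-1 * t + x / 2) (q (2^-1 * t + x / 2)) ->
  is_cderive (cprim q) (- 2^-1 * t + x / 2) (q (- 2^-1 * t + x / 2)) ->
  is_cderive (fun y => G1 eps q y t) x (G1d eps x t) /\
  is_cderive (G1 eps q x) t (G1d (- eps) x t).
Proof.
set b1 := (2^-1 * t + x / 2); set b2 := (- 2^-1 * t + x / 2) => h1 h2; split.
- have k1 : is_cderive (cprim q) (2^-1 * x + t / 2) (q b1).
    by have -> : 2^-1 * x + t / 2 = b1 by rewrite /b1; ring.
  have k2 : is_cderive (cprim q) (2^-1 * x + - t / 2) (q b2).
    by have -> : 2^-1 * x + - t / 2 = b2 by rewrite /b2; ring.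
  have := is_cderiveZ (2^-1)%:C
    (is_cderiveD (is_cderive_affine k1) (is_cderiveZ eps%:C (is_cderive_affine k2))).
  have -> : (fun y => (2^-1)%:C * (cprim q (2^-1 * y + t / 2) +
      eps%:C * cprim q (2^-1 * y + - t / 2))) = (fun y => G1 eps q y t).
    apply/funext => y; rewrite /G1; congr (_ * (cprim q _ + _ * cprim q _)); ring.
  have -> // : (2^-1)%:C * ((2^-1)%:C * q b1 + eps%:C * ((2^-1)%:C * q b2)) = G1d eps x t.
  rewrite /G1d -/b1 -/b2 mulrDr !mulrA -!rmorphM/=.
  by congr (_%:C * _ + _%:C * _); field.
- have := is_cderiveZ (2^-1)%:C
    (is_cderiveD (is_cderive_affine h1) (is_cderiveZ eps%:C (is_cderive_affine h2))).
  have -> : (fun y => (2^-1)%:C * (cprim q (2^-1 * y + x / 2) +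
      eps%:C * cprim q (- 2^-1 * y + x / 2))) = G1 eps q x.
    apply/funext => y; rewrite /G1; congr (_ * (cprim q _ + _ * cprim q _)); ring.
  have -> // : (2^-1)%:C * ((2^-1)%:C * q b1 + eps%:C * ((- 2^-1)%:C * q b2)) = G1d (- eps) x t.
  rewrite /G1d -/b1 -/b2 mulrDr !mulrA -!rmorphM/=.
  by congr (_%:C * _ + _%:C * _); field.
Qed.

(** The exceptional values of [t] come from [G1] alone, since [G2] is differentiable in both
    variables at each point with [0 < t < x]. *)
Lemma kernel_partials (x : R) : 0 < x <= pi ->
  {ae mu, forall t : R, 0 < t < x ->
    [/\ derivable_in `[t, pi] (K^~ t) x, derivable_in `[0, x] (K x) t,
      exists2 z, is_cderive (fun y => G2 eps q F y t) x z & partial1 K x t = G1d eps x t + z &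
      exists2 z, is_cderive (G2 eps q F x) t z & partial2 K x t = G1d (- eps) x t + z]}.
Proof.
move=> /andP[x0 xp].
have n1 : (2^-1 : R) != 0 by rewrite invr_eq0.
have n2 : - (2^-1 : R) != 0 by rewrite oppr_eq0.
have := ae_affine (x / 2) n2 (cprim_ae_cderive Iq).
have := ae_affine (x / 2) n1 (cprim_ae_cderive Iq).
apply: aeS2 => t h1 h2 /andP[t0 tx].
have [g1 g2] := G1_cderive h1 h2.
have [z1 hz1] := G2_cderive1 eps1 Iq rF t0 tx.
have [z2 hz2] := G2_cderive2 eps1 Iq rF t0 tx.
have [d1 e1] : derivable_in `[t, pi] (K^~ t) x /\ partial1 K x t = G1d eps x t + z1.
  apply: (derive_inP (within_itv_dnbhs_proper tx xp) _ _ (is_cderiveD g1 hz1)).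
    exact: KE.
  have : \forall y \near x, t < y by exact: lt_nbhsr.
  by apply: filterS => y ty; rewrite /= in_itv/= => /andP[_ yp]; exact: KE.
have [d2 e2] : derivable_in `[0, x] (K x) t /\ partial2 K x t = G1d (- eps) x t + z2.
  apply: (derive_inP (within_itv_dnbhs_proper t0 (ltW tx)) _ _ (is_cderiveD g2 hz2)).
    exact: KE.
  have n0 : \forall y \near t, 0 < y by exact: lt_nbhsr.
  have nx : \forall y \near t, y < x by exact: lt_nbhsl.
  by move: n0 nx; apply: filterS2 => y y0 yx _; exact: KE.
by split => //; [exists z1|exists z2].
Qed.

End partials.
End kernel_partials.

(** * The norm of the partial derivatives and the constant *)

Section final_estimate.
Variable R : realType.
Local Notation mu := (@lebesgue_measure R).
Local Notation MR := (measurableTypeR R).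
Local Notation Re := (@complex.Re R).
Local Notation Im := (@complex.Im R).

Lemma cabs_G1d_sub (q q' : R -> R[i]) (sgn x t : R) : `|sgn| <= 1 ->
  cabs (G1d q sgn x t - G1d q' sgn x t) <=
  4^-1 * cabs (q (2^-1 * t + x / 2) - q' (2^-1 * t + x / 2)) +
  4^-1 * cabs (q (- 2^-1 * t + x / 2) - q' (- 2^-1 * t + x / 2)).
Proof.
move=> s1; rewrite /G1d opprD addrACA -!mulrBr.
apply: le_trans (cabsD _ _) _; rewrite !cabsM !cabsR; apply: lerD.
  by rewrite ger0_norm ?invr_ge0.
apply: ler_wpM2r; first exact: cabs_ge0.
by rewrite normrM (@ger0_norm _ (4^-1)) ?invr_ge0// ler_piMl ?invr_ge0.
Qed.

(** Minkowski's inequality for the majorant [g1 + g2 + g3]: two rescaled copies of the modulus of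
    [q - q'], each contributing [sqrt 2 / 4] of its norm, and the constant [L] on []0, x[]. *)
Lemma partial_L2norm_le (q q' D D' : R -> R[i]) (sgn x L : R) : `|sgn| <= 1 -> 0 <= x -> 0 <= L ->
  measurable_fun (setT : set MR) ((fun t => cabs (q t - q' t)) : MR -> R) ->
  {ae mu, forall t, 0 < t < x -> exists z z',
    [/\ D t = G1d q sgn x t + z, D' t = G1d q' sgn x t + z' & cabs (z - z') <= L]} ->
  (L2norm 0 x (fun t => (D t - D' t)%R) <=
    (Num.sqrt 2 / 2)%:E * N2 (fun t => cabs (q t - q' t)%R) + (L * Num.sqrt x)%:E)%E.
Proof.
move=> s1 x0 L0; set u := (fun t => cabs (q t - q' t)) => mu_ H.
pose g1 t := 4^-1 * u (2^-1 * t + x / 2).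
pose g2 t := 4^-1 * u (- 2^-1 * t + x / 2).
pose g3 t : R := L * \1_`]0, x[ t.
have m4 (a b : R) : measurable_fun (setT : set MR) ((fun t => 4^-1 * u (a * t + b)) : MR -> R).
  apply: measurable_funM; first exact: measurable_cst.
  exact: (measurableT_comp mu_ (measurable_affine a b)).
have m3 : measurable_fun (setT : set MR) (g3 : MR -> R).
  by apply: measurable_funM; [exact: measurable_cst|exact/measurable_indicP].
have m12 : measurable_fun (setT : set MR) ((fun t => g1 t + g2 t) : MR -> R).
  by apply: measurable_funD; exact: m4.
have u0 t : 0 <= u t by exact: cabs_ge0.
have le1 : (L2norm 0 x (fun t => (D t - D' t)%R) <= N2 (fun t => ((g1 t + g2 t) + g3 t)%R))%E.
  rewrite /L2norm; apply: N2_ae_le; first exact: measurable_funD.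
  move: H; apply: aeS => t; rewrite patchE mem_setE in_itv/= /g3 indicE mem_setE in_itv/=.
  have a0 : 0 <= g1 t by rewrite mulr_ge0 ?invr_ge0.
  have b0 : 0 <= g2 t by rewrite mulr_ge0 ?invr_ge0.
  case: ifP => [_ /(_ isT) [z [z' [-> -> zL]]]|_ _]; last first.
    by rewrite normr0 mulr0 addr0 addr_ge0.
  rewrite mulr1 ger0_norm; last exact: cabs_ge0.
  have -> : G1d q sgn x t + z - (G1d q' sgn x t + z') = (G1d q sgn x t - G1d q' sgn x t) + (z - z').
    by rewrite opprD addrACA.
  exact: le_trans (cabsD _ _) (lerD (cabs_G1d_sub q q' x t s1) zL).
apply: le_trans le1 _; apply: le_trans (N2_add m12 m3) _.
rewrite N2_indic//; apply: leeD => //.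
apply: le_trans (N2_add (m4 _ _) (m4 _ _)) _.
have n1 : (2^-1 : R) != 0 by rewrite invr_eq0.
have n2 : - (2^-1 : R) != 0 by rewrite oppr_eq0.
have p4 : 0 <= 4^-1 :> R by rewrite invr_ge0.
rewrite (N2_affine _ n1 p4 mu_) (N2_affine _ n2 p4 mu_).
rewrite normrN (@ger0_norm _ (2^-1)) ?invr_ge0// invrK -ge0_muleDl ?lee_fin ?mulr_ge0 ?sqrtr_ge0//.
rewrite -EFinD le_eqVlt; apply/orP; left; apply/eqP; congr (_%:E * _)%E.
by field.
Qed.

(** With [E = pi ^ (3/2) * r] and [e = expR (E / 2)] the left side is at most [3/2 * E * dl] times
    [2 e + E/2 * e ^ 2]. Since [1 + E / 2 <= e], the last factor is at most
    [3 e ^ 4 = 3 expR (2 E)], which gives 9/2 in place of 12. *)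
Lemma stability_constant_le (r dl x S d MF MD : R) : 0 < r -> 0 <= dl -> 0 < x <= pi ->
  S = Num.sqrt pi * r -> d = Num.sqrt pi * dl -> MF = S * expR (pi / 2 * S) ->
  MD = d * (1 + pi / 2 * MF) * expR (pi / 2 * S) ->
  3 / 2 * (d * MF + S * MD) * Num.sqrt x <=
  12 * r * pi `^ (3 / 2) * expR (2 * pi `^ (3 / 2) * r) * dl.
Proof.
move=> r0 dl0 /andP[x0 xp] SE dE MFE MDE.
have pi0 : 0 < pi :> R := pi_gt0 R.
have sp0 : 0 < Num.sqrt pi :> R by rewrite sqrtr_gt0.
have sp2 : Num.sqrt pi ^+ 2 = pi :> R by rewrite sqr_sqrtr// ltW.
have -> : pi `^ (3 / 2) = pi * Num.sqrt pi :> R.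
  have -> : 3 / 2 = 1 + 2^-1 :> R by lra.
  by rewrite powRD ?powRr1 ?powR12_sqrt ?ltW// gt_eqF ?implybT.
pose E := pi * Num.sqrt pi * r; pose e := expR (E / 2).
have E0 : 0 < E by rewrite !mulr_gt0.
have eS : expR (pi / 2 * S) = e by rewrite /e /E SE; congr expR; field.
have e4 : expR (2 * (pi * Num.sqrt pi) * r) = e ^+ 4.
  by rewrite /e -expRM_natl; congr expR; rewrite /E; field.
have e1 : 1 + E / 2 <= e by exact: expR_ge1Dx.
rewrite e4.
have -> : 12 * r * (pi * Num.sqrt pi) * e ^+ 4 * dl = 12 * E * e ^+ 4 * dl by rewrite /E; ring.
have L0 : 0 <= 3 / 2 * (d * MF + S * MD).
  have S0 : 0 <= S by rewrite SE mulr_ge0// ltW.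
  have d0 : 0 <= d by rewrite dE mulr_ge0// ltW.
  have MF0 : 0 <= MF by rewrite MFE mulr_ge0// expR_ge0.
  have MD0 : 0 <= MD.
    by rewrite MDE mulr_ge0 ?expR_ge0// mulr_ge0// addr_ge0// mulr_ge0// divr_ge0// ltW.
  by rewrite mulr_ge0 ?divr_ge0// addr_ge0// mulr_ge0.
apply: (@le_trans _ _ (3 / 2 * (d * MF + S * MD) * Num.sqrt pi)).
  by apply: ler_wpM2l => //; exact: ler_wsqrtr.
have -> : 3 / 2 * (d * MF + S * MD) * Num.sqrt pi = 3 / 2 * E * dl * (e * (2 + E / 2 * e)).
  have aux (p s : R) : p = s ^+ 2 ->
    3 / 2 * (s * dl * (s * r * e) + s * r * (s * dl * (1 + p / 2 * (s * r * e)) * e)) * s =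
    3 / 2 * (p * s * r) * dl * (e * (2 + p * s * r / 2 * e)) by move=> ->; field.
  by rewrite MDE MFE eS dE SE; exact: aux.
have h : e * (2 + E / 2 * e) <= 3 * e ^+ 4.
  have ge1 : 1 <= e by lra.
  have ee : e <= e ^+ 2 by rewrite expr2; nra.
  have e23 : e ^+ 2 <= e ^+ 3 by rewrite exprS [leRHS]exprS; apply: ler_wpM2l; [lra|rewrite expr1].
  have e34 : e ^+ 3 <= e ^+ 4 by rewrite exprS [leRHS]exprS; apply: ler_wpM2l; [lra|].
  have k : E / 2 * e ^+ 2 <= e ^+ 3.
    by rewrite [leRHS]exprS; apply: ler_wpM2r; [rewrite sqr_ge0|lra].
  have -> : e * (2 + E / 2 * e) = 2 * e + E / 2 * e ^+ 2 by ring.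
  lra.
apply: (@le_trans _ _ (3 / 2 * E * dl * (3 * e ^+ 4))).
  by apply: ler_wpM2l => //; rewrite !mulr_ge0// ltW.
have : 0 <= E * e ^+ 4 * dl by rewrite !mulr_ge0 ?exprn_ge0 ?expR_ge0// ltW.
have -> : 3 / 2 * E * dl * (3 * e ^+ 4) = 9 / 2 * (E * e ^+ 4 * dl) by ring.
have -> : 12 * E * e ^+ 4 * dl = 12 * (E * e ^+ 4 * dl) by ring.
by lra.
Qed.

End final_estimate.

Section kernel_stability.
Variable R : realType.
Local Notation mu := (@lebesgue_measure R).
Local Notation MR := (measurableTypeR R).

Lemma solves_eq_ae_has_partials (eps x : R) (q : R -> R[i]) (K : R -> R -> R[i]) :
  `|eps| <= 1 -> cintegrable setT q ->
  (exists2 M, kernel_reg (cutK K) M & solves_eq eps q (cutK K)) ->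
  0 < x <= pi -> ae_has_partials K x.
Proof.
move=> e1 Iq [M rF sF] xp; have := kernel_partials e1 Iq rF sF xp.
by apply: aeS => t h /h[].
Qed.

Lemma Bconst_gt0 (r : R) : 0 < r -> 0 < Bconst r.
Proof.
move=> r0; rewrite /Bconst ltr_wpDr ?divr_gt0 ?sqrtr_gt0//.
by rewrite !mulr_ge0 ?powR_ge0 ?expR_ge0// ltW.
Qed.

Lemma kernel_stability (eps r x : R) (q qt : R -> R[i]) (K Kt : R -> R -> R[i]) :
  `|eps| <= 1 -> 0 < r -> in_L2 0 pi q -> in_L2 0 pi qt ->
  (L2norm 0 pi q <= r%:E)%E -> (L2norm 0 pi qt <= r%:E)%E ->
  (exists2 M, kernel_reg (cutK K) M & solves_eq eps (cutq q) (cutK K)) ->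
  (exists2 M, kernel_reg (cutK Kt) M & solves_eq eps (cutq qt) (cutK Kt)) ->
  0 < x <= pi ->
  (L2norm 0 x (fun t => (partial1 K x t - partial1 Kt x t)%R) <=
     (Bconst r)%:E * L2norm 0 pi (fun t => (q t - qt t)%R))%E /\
  (L2norm 0 x (fun t => (partial2 K x t - partial2 Kt x t)%R) <=
     (Bconst r)%:E * L2norm 0 pi (fun t => (q t - qt t)%R))%E.
Proof.
move=> e1 r0 hq hqt qr qtr [M rF sF] [M' rF' sF'] xp.
have [_ Iq qS] := in_L2_integrable hq qr.
have [_ Iqt qtS] := in_L2_integrable hqt qtr.
pose w t := cutq q t - cutq qt t.
have wE : L2norm 0 pi (fun t => (q t - qt t)%R) = N2 (fun t => cabs (w t)).
  rewrite L2normE; congr N2; apply/funext => t; rewrite /w /cutq.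
  by case: ifP => // _; rewrite subrr.
have mw : cmeas setT w.
  exact: (cintegrable_cmeas (cintegrableD measurableT Iq (cintegrableN measurableT Iqt))).
have mcw := cmeas_cabs mw.
have ws t : ~~ (0 < t < pi) -> w t = 0 by move=> h; rewrite /w !cutq_supp// subrr.
have B0 := Bconst_gt0 r0.
(* An infinite right-hand side is settled apart, so that the rest can use the real number [dl]. *)
rewrite wE; have [winf|wfin] := eqVneq (N2 (fun t => cabs (w t))) +oo%E.
  rewrite winf gt0_muley; last by rewrite lte_fin; exact: B0.
  by split; exact: leey.
have wdl : N2 (fun t => cabs (w t)) = (fine (N2 (fun t => cabs (w t))))%:E.
  by rewrite fineK// ge0_fin_numE ?N2_ge0// lt_neqAle wfin leey.
set dl := fine _ in wdl.
have dl0 : 0 <= dl by apply: fine_ge0; exact: N2_ge0.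
have wle : (N2 (fun t => cabs (w t)) <= dl%:E)%E by rewrite wdl.
have [_ wd] := L2_integrable mw ws wle.
pose S := Num.sqrt pi * r; pose d := Num.sqrt pi * dl.
pose MF := S * expR (pi / 2 * S).
pose MD := d * (1 + pi / 2 * MF) * expR (pi / 2 * S).
pose L := 3 / 2 * (d * MF + S * MD).
have lip := @G2_sub_lip R eps S d (cutq q) (cutq qt) (cutK K) (cutK Kt) M M' e1 Iq Iqt
  (@cutq_supp _ q) (@cutq_supp _ qt) rF rF' sF sF' qS qtS wd.
have L0 : 0 <= L.
  have : 0 <= L * (`|0 - 0| + `|1 - 0|) := le_trans (cabs_ge0 _) (lip 1 0 0 0).
  by rewrite !subr0 normr0 normr1 add0r mulr1.
have /andP[x0 _] := xp.
have fin : ((Num.sqrt 2 / 2)%:E * N2 (fun t => cabs (w t)) + (L * Num.sqrt x)%:E <=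
    (Bconst r)%:E * N2 (fun t => cabs (w t)))%E.
  rewrite wdl -!EFinM -EFinD lee_fin /Bconst mulrDl lerD2l.
  exact: (@stability_constant_le R r dl x S d MF MD r0 dl0 xp erefl erefl erefl erefl).
have P := kernel_partials e1 Iq rF sF xp.
have P' := kernel_partials e1 Iqt rF' sF' xp.
have Ne1 : `|- eps| <= 1 by rewrite normrN.
split; apply: le_trans _ fin.
- apply: (@partial_L2norm_le R (cutq q) (cutq qt) _ _ eps x L e1 (ltW x0) L0 mcw).
  move: P P'; apply: aeS2 => t h h' tx.
  have [_ _ [z hz ->] _] := h tx; have [_ _ [z' hz' ->] _] := h' tx.
  exists z, z'; split => //.
  (* [z - z'] is the derivative of the difference of the two [G2] terms, whose Lipschitz constant is
     [L]. *)
  apply: (is_cderive_lip L0 (is_cderiveB hz hz')) => y.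
  by apply: le_trans (lip _ _ _ _) _; rewrite subrr normr0 add0r.
- apply: (@partial_L2norm_le R (cutq q) (cutq qt) _ _ (- eps) x L Ne1 (ltW x0) L0 mcw).
  move: P P'; apply: aeS2 => t h h' tx.
  have [_ _ _ [z hz ->]] := h tx; have [_ _ _ [z' hz' ->]] := h' tx.
  exists z, z'; split => //.
  apply: (is_cderive_lip L0 (is_cderiveB hz hz')) => y.
  by apply: le_trans (lip _ _ _ _) _; rewrite subrr normr0 addr0.
Qed.

End kernel_stability.

Theorem theorem5 (R : realType) (r : R) (hr : 0 < r)
    (q qt : R -> R[i])
    (hq : in_L2 0 pi q) (hqt : in_L2 0 pi qt)
    (hqr : (L2norm 0 pi q <= r%:E)%E) (hqrt : (L2norm 0 pi qt <= r%:E)%E)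
    (K P Kt Pt : R -> R -> R[i])
    (hK : cosine_kernel q K) (hP : sine_kernel q P)
    (hKt : cosine_kernel qt Kt) (hPt : sine_kernel qt Pt)
    (x : R) (hx : 0 < x <= pi) :
  [/\ ae_has_partials K x, ae_has_partials Kt x,
      ae_has_partials P x & ae_has_partials Pt x] /\
  let bound := ((Bconst r)%:E * L2norm 0 pi (fun t => (q t - qt t)%R))%E in
  [/\ (L2norm 0 x (fun t => (partial1 K x t - partial1 Kt x t)%R) <= bound)%E,
      (L2norm 0 x (fun t => (partial2 K x t - partial2 Kt x t)%R) <= bound)%E,
      (L2norm 0 x (fun t => (partial1 P x t - partial1 Pt x t)%R) <= bound)%E &
      (L2norm 0 x (fun t => (partial2 P x t - partial2 Pt x t)%R) <= bound)%E].
Proof.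
have [Iq Iq' _] := in_L2_integrable hq hqr.
have [Iqt Iqt' _] := in_L2_integrable hqt hqrt.
have e1 : `|1 : R| <= 1 by rewrite normr1.
have e2 : `|- 1 : R| <= 1 by rewrite normrN1.
have sK := cosine_kernel_solves Iq hK.
have sKt := cosine_kernel_solves Iqt hKt.
have sP := sine_kernel_solves Iq hP.
have sPt := sine_kernel_solves Iqt hPt.
split.
  split.
  - exact: (solves_eq_ae_has_partials e1 Iq' sK hx).
  - exact: (solves_eq_ae_has_partials e1 Iqt' sKt hx).
  - exact: (solves_eq_ae_has_partials e2 Iq' sP hx).
  - exact: (solves_eq_ae_has_partials e2 Iqt' sPt hx).
move=> bound.
have [k1 k2] := kernel_stability e1 hr hq hqt hqr hqrt sK sKt hx.
have [p1 p2] := kernel_stability e2 hr hq hqt hqr hqrt sP sPt hx.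
by split; [exact: k1|exact: k2|exact: p1|exact: p2].
Qed.
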